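(* Let $\Omega$ be $\mathbb{R}^d$, a bounded smooth domain of $\mathbb{R}^d$, or the torus $R\,\mathbb{T}^d$. Let $p\in[1,\infty)$, $T>0$. Consider, for $t\in[0,T]$, the equations $$(E_1)\ \ \partial_t\mu+\operatorname{div}(\mu\,\mathbf{v}^\mu[\mu])=0,\qquad (E_2)\ \ \partial_t\nu+\operatorname{div}(\nu\,\mathbf{v}^\nu[\nu])=0\qquad\text{on }[0,T]\times\Omega,$$ with boundary conditions $\mu\,\mathbf{v}^\mu[\mu]\cdot\mathbf{n}=0$, $\nu\,\mathbf{v}^\nu[\nu]\cdot\mathbf{n}=0$ on $\partial\Omega$ if $\Omega$ is a bounded domain. Assume (I): there are sets $\mathcal{A}_1\subset\mathcal{A}_2\subset\mathcal{P}_p(\Omega)\cap L^1(\Omega)$ such that if $\mu_0\in\mathcal{A}_1$, $\nu_0\in\mathcal{A}_2$, then $(E_1)$ and $(E_2)$ admit unique weak solutions $\mu_t\in\mathcal{A}_1$, $\nu_t\in\mathcal{A}_2$ with initial conditions $\mu_0$, $\nu_0$, respectively. Moreover, if $\mu_0=\nu_0$ the solutions satisfy: (1) $t\mapsto\mu_t$ and $t\mapsto\nu_t$ are narrowly continuous; (2) there exist $h>0$ and $\delta>0$ such that $(t,x)\mapsto\mathbf{v}^\mu[\mu_t]$ and $(t,x)\mapsto\mathbf{v}^\nu[\nu_t]$ belong to $L^{2+\delta}(0,h;\mathrm{BL}(\Omega))$; (3) if $\rho\in\mathcal{A}_1$ then $|\mathbf{v}^\mu[\rho]-\mathbf{v}^\nu[\rho]|^p\in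 C(\Omega)\cap L^\infty(\Omega)$; (4) there exists $h>0$ such that $(t,x)\mapsto\mathbf{v}^\nu[\nu_t]-\mathbf{v}^\mu[\mu_t]$ is in $L^\infty((0,h)\times\Omega)$, and for each compact $K\subset\overline{\Omega}$, $$\operatorname*{ess\,sup}_{0\le\tau\le h}\Big\|\big|\mathbf{v}^\nu[\nu_\tau]-\mathbf{v}^\mu[\mu_\tau]\big|^p-\big|\mathbf{v}^\nu[\mu_0]-\mathbf{v}^\mu[\mu_0]\big|^p\Big\|_{L^\infty(K)}\to0\quad\text{as }h\to0;$$ (5) if $\Omega$ is a bounded domain, $\mathbf{v}^\mu[\mu_t]\cdot\mathbf{n}=0$ and $\mathbf{v}^\nu[\nu_t]\cdot\mathbf{n}\le0$ hold pointwise on $\partial\Omega$ for a.e. $t\in[0,h]$, for some small $h>0$. Assume (II): for all $\mu_0\in\mathcal{A}_1$, $\nu_0\in\mathcal{A}_2$, the corresponding solutions $\mu_t$ of $(E_1)$, $\nu_t$ of $(E_2)$ are absolutely continuous in $\mathcal{W}_p$, i.e. there is $0\le h\in L^1_{\rm loc}([0,\infty))$ such that $\mathcal{W}_p(\mu_t,\mu_s),\ \mathcal{W}_p(\nu_t,\nu_s)\le\int_s^th(u)\,du$ for all $s<t$ in $[0,T]$. Assume (III): $(E_1)$ and $(E_2)$ generate (autonomous) semigroups on $(\mathcal{A}_1,\mathcal{W}_p)$ and $(\mathcal{A}_2,\mathcal{W}_p)$, respectively. Moreover, for each $t$ there is a constant $K(t)>0$ such that the semigroup $\mathcal{S}_t$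 generated by $(E_2)$ satisfies $$\mathcal{W}_p(\mathcal{S}_t\nu_0^1,\mathcal{S}_t\nu_0^2)\le K(t)\,\mathcal{W}_p(\nu_0^1,\nu_0^2)\qquad\text{for all }\nu_0^1,\nu_0^2\in\mathcal{A}_2,$$ and $t\mapsto K(t)$ is continuous. Let $\mu_t$, $\nu_t$ be the solutions of $(E_1)$ and $(E_2)$ with the same initial condition $\mu_0=\nu_0\in\mathcal{A}_1$. Then, for all $t\in[0,T]$, $$\mathcal{W}_p(\mu_t,\nu_t)\le\int_0^tK(t-s)\left(\int_\Omega\big|\mathbf{v}^\nu[\mu_s]-\mathbf{v}^\mu[\mu_s]\big|^p\,d\mu_s\right)^{1/p}ds.$$
   Context: $R\,\mathbb{T}^d$ ($R>0$) is identified with $(-R,R]^d$ with periodic boundary and equipped with the quotient distance. $\mathbf{n}$ is the outer unit normal to $\partial\Omega$. $\mathcal{P}_p(\Omega)$ is the set of probability measures on $\Omega$ with finite $p$-th moment; $\mathcal{W}_p^p(\mu,\nu)=\inf_\pi\int_{\Omega\times\Omega}|x-y|^pd\pi(x,y)$ over couplings $\pi$ of $\mu$ and $\nu$. Absolutely continuous measures are identified with their densities. $\mathrm{BL}(\Omega)$ is the space of bounded Lipschitz functions with norm $\|f\|_{\mathrm{BL}(\Omega)}=\|f\|_{L^\infty(\Omega)}+\mathrm{Lip}(f)$, $\mathrm{Lip}(f)=\sup_{x\ne y}\frac{|f(x)-f(y)|}{|x-y|}$. The notation $\mathbf{v}[\rho]$ means an $\mathbb{R}^d$-valued vector field on $\Omega$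 which may depend on $x$ and on the density $\rho$ (via its spatial derivatives and nonlocal operators such as convolutions). A family $\{\mathcal{S}_t\}_{t\in[0,T]}$ of maps of a metric space into itself is an autonomous semigroup if $\mathcal{S}_0$ is the identity and $\mathcal{S}_t\circ\mathcal{S}_s=\mathcal{S}_{t+s}$ whenever $t,s,t+s\in[0,T]$. The semigroup generated by an equation maps $\rho_0$ to the solution at time $t$ with initial condition $\rho_0$ at time $0$. *)

(* Defs.v *)
From HB Require Import structures.
From mathcomp Require Import all_boot all_order all_algebra.
From mathcomp Require Import all_classical all_reals all_analysis.
From mathcomp Require Import measurable_realfun ess_sup_inf.

Set Implicit Arguments.
Unset Strict Implicit.
Unset Printing Implicit Defensive.

Import Order.TTheory GRing.Theory Num.Def Num.Theory.
Import numFieldNormedType.Exports.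

Local Open Scope classical_set_scope.
Local Open Scope ring_scope.

(* The sigma-algebra on row vectors generated by the coordinates (as the
   library does for tuples); on R^n it is the Borel sigma-algebra. *)
Section measurable_rV.
Context {d} {T : sigmaRingType d}.
Variable n : nat.

Let coors : 'I_n -> 'rV[T]_n -> T := fun i x => x ord0 i.

Let rV_set0 : g_sigma_preimage coors set0.
Proof. exact: sigma_algebra0. Qed.

Let rV_setC A : g_sigma_preimage coors A -> g_sigma_preimage coors (~` A).
Proof. exact: sigma_algebraC. Qed.

Let rV_bigcup (F : _^nat) : (forall i, g_sigma_preimage coors (F i)) ->
  g_sigma_preimage coors (\bigcup_i (F i)).
Proof. exact: sigma_algebra_bigcup. Qed.

HB.instance Definition _ := @isMeasurable.Build (measure_tuple_display d)
  'rV[T]_n (g_sigma_preimage coors) rV_set0 rV_setC rV_bigcup.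

End measurable_rV.

Lemma measurable_coord d (T : sigmaRingType d) n (i : 'I_n) :
  measurable_fun [set: 'rV[T]_n] (fun x : 'rV[T]_n => x ord0 i).
Proof.
move=> _ Y mY; rewrite setTI; apply: sub_sigma_algebra => /=.
rewrite -bigcup_seq/=; exists i => /=; first by rewrite mem_index_enum.
by exists Y => //; rewrite setTI.
Qed.

Lemma measurable_fun_coordP d1 d2 (T1 : measurableType d1)
    (T2 : measurableType d2) n (f : T1 -> 'rV[T2]_n) :
  (forall i, measurable_fun [set: T1] (fun t => f t ord0 i)) ->
  measurable_fun [set: T1] f.
Proof.
move=> mf.
have H : g_sigma_preimage (fun (i : 'I_n) t => f t ord0 i) `<=` measurable.
  apply: smallest_sub; first exact: sigma_algebra_measurable.
  rewrite -bigcup_seq; apply: bigcup_sub => i _.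
  by move=> A [B mB <-]; exact: mf.
move=> _ A mA; apply: H.
have -> : (fun (i : 'I_n) t => f t ord0 i) =
  (fun i => (fun x : 'rV[T2]_n => x ord0 i) \o f) by [].
by rewrite g_sigma_preimage_comp; exists A.
Qed.

Section lebesgue_rV.
Context {R : realType}.
Variables (n : nat) (m : {sigma_finite_measure set 'rV[R]_n -> \bar R}).

Definition rV_cons (z : measurableTypeR R * 'rV[R]_n) : 'rV[R]_n.+1 :=
  \row_i oapp (z.2 ord0) z.1 (unlift ord0 i).

Definition rV_uncons (x : 'rV[R]_n.+1) : measurableTypeR R * 'rV[R]_n :=
  (x ord0 ord0, \row_i x ord0 (lift ord0 i)).

Lemma rV_consK : cancel rV_cons rV_uncons.
Proof.
move=> [a y]; rewrite /rV_uncons mxE unlift_none/=; congr pair.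
by apply/rowP => i; rewrite !mxE liftK.
Qed.

Lemma measurable_rV_cons : measurable_fun setT rV_cons.
Proof.
apply: measurable_fun_coordP => i.
case: (unliftP ord0 i) => [j ->|->].
  have -> : (fun t => rV_cons t ord0 (lift ord0 j)) =
      (fun x : 'rV[R]_n => x ord0 j) \o snd.
    by apply/funext => t /=; rewrite mxE liftK.
  by apply: measurableT_comp => //; exact: measurable_coord.
have -> : (fun t => rV_cons t ord0 ord0) = fst.
  by apply/funext => t /=; rewrite mxE unlift_none.
exact: measurable_fst.
Qed.

Lemma measurable_rV_uncons : measurable_fun setT rV_uncons.
Proof.
apply/measurable_fun_pairP; split => /=; first exact: measurable_coord.
apply: measurable_fun_coordP => i.
have -> : (fun t => (snd \o rV_uncons) t ord0 i) =
    (fun x : 'rV[R]_n.+1 => x ord0 (lift ord0 i)).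
  by apply/funext => t /=; rewrite mxE.
exact: measurable_coord.
Qed.

Definition lebesgue_rV_step : set 'rV[R]_n.+1 -> \bar R :=
  pushforward (@lebesgue_measure R \x m)%E rV_cons.

Let mpre A : measurable A -> measurable (rV_cons @^-1` A).
Proof. by move=> mA; rewrite -[X in measurable X]setTI; exact: measurable_rV_cons. Qed.

Let step0 : lebesgue_rV_step set0 = 0%E.
Proof. by rewrite /lebesgue_rV_step /pushforward preimage_set0 measure0. Qed.

Let step_ge0 A : (0 <= lebesgue_rV_step A)%E.
Proof. by rewrite /lebesgue_rV_step /pushforward measure_ge0. Qed.

Let step_sigma_additive : semi_sigma_additive lebesgue_rV_step.
Proof.
move=> F mF tF mUF; rewrite /lebesgue_rV_step /pushforward preimage_bigcup.
apply: measure_semi_sigma_additive => [k| |]; first exact: mpre.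
- apply/trivIsetP => /= i j _ _ ij; rewrite -preimage_setI.
  by move/trivIsetP : tF => /(_ _ _ _ _ ij) ->//; rewrite preimage_set0.
- by rewrite -preimage_bigcup; exact: mpre.
Qed.

HB.instance Definition _ := isMeasure.Build _ _ _ lebesgue_rV_step
  step0 step_ge0 step_sigma_additive.

Let lebesgue_rV_step_sigma_finite : sigma_finite setT lebesgue_rV_step.
Proof.
have /sigma_finiteP[F [TF ndF Foo]] := sigma_finiteT (@lebesgue_measure R).
have /sigma_finiteP[G [TG ndG Goo]] := sigma_finiteT m.
pose H k : set 'rV[R]_n.+1 := rV_uncons @^-1` (F k `*` G k).
exists H.
  apply/seteqP; split => // x _.
  have : (\bigcup_k F k) (rV_uncons x).1 by rewrite -TF.
  have : (\bigcup_k G k) (rV_uncons x).2 by rewrite -TG.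
  move=> [i _ Gi] [j _ Fj]; exists (maxn i j) => //; split.
    by apply: (subsetPset _ _ (ndF _ _ (leq_maxr i j))).
  by apply: (subsetPset _ _ (ndG _ _ (leq_maxl i j))).
move=> k; have [mF Fk] := Foo k; have [mG Gk] := Goo k; split.
  rewrite -[X in measurable X]setTI; apply: measurable_rV_uncons => //.
  exact: measurableX.
have HK : rV_cons @^-1` H k = F k `*` G k.
  rewrite /H -comp_preimage (_ : rV_uncons \o rV_cons = id) ?preimage_id//.
  by apply/funext; exact: rV_consK.
rewrite /lebesgue_rV_step /pushforward HK product_measure1E//.
by rewrite lte_mul_pinfty// ge0_fin_numE.
Qed.

HB.instance Definition _ := Measure_isSigmaFinite.Build _ _ _
  lebesgue_rV_step lebesgue_rV_step_sigma_finite.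

End lebesgue_rV.

Fixpoint lebesgue_rV (R : realType) (n : nat) :
    {sigma_finite_measure set 'rV[R]_n -> \bar R} :=
  match n with
  | 0 => [the {sigma_finite_measure set _ -> \bar R} of \d_(0 : 'rV[R]_0)]
  | n'.+1 => [the {sigma_finite_measure set _ -> \bar R} of
               lebesgue_rV_step (lebesgue_rV R n')]
  end.

Lemma measurable_rV_box (R : realType) n (A : 'I_n -> set R) :
  (forall i, measurable (A i)) ->
  measurable [set x : 'rV[R]_n | forall i, A i (x ord0 i)].
Proof.
move=> mA; rewrite [X in measurable X](_ : _ =
  \big[setI/setT]_(i < n) ((fun x : 'rV[R]_n => x ord0 i) @^-1` A i)).
  apply: bigsetI_measurable => i _.
  by rewrite -[X in measurable X]setTI; exact: measurable_coord.
apply/seteqP; split => x /=.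
  by move=> xA; rewrite -bigcap_seq => i _; exact: xA.
by rewrite -bigcap_seq => + i; apply => /=; rewrite mem_index_enum.
Qed.

Lemma lebesgue_rV_box (R : realType) n (A : 'I_n -> set R) :
  (forall i, measurable (A i)) ->
  lebesgue_rV R n [set x : 'rV[R]_n | forall i, A i (x ord0 i)] =
  (\prod_(i < n) (@lebesgue_measure R (A i)))%E.
Proof.
elim: n A => [|n ih] A mA /=.
  by rewrite big_ord0 diracE mem_set// => -[].
rewrite /lebesgue_rV_step /pushforward [X in (_ \x _)%E X](_ : _ =
    A ord0 `*` [set y : 'rV[R]_n | forall i, A (lift ord0 i) (y ord0 i)]).
  have mB := @measurable_rV_box R n (fun i => A (lift ord0 i)) (fun i => mA _).
  have mA0 : measurable (A ord0 : set (measurableTypeR R)) := mA ord0.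
  by rewrite (product_measure1E _ _ mA0 mB) big_ord_recl -ih.
apply/seteqP; split => [[a y]/= xA|[a y]/= [Aa Ay] i].
  split; first by have := xA ord0; rewrite mxE unlift_none.
  by move=> i; have := xA (lift ord0 i); rewrite mxE liftK.
by rewrite mxE; case: unliftP => [j ->|->].
Qed.

Section domains.
Context {R : realType} {d : nat}.
Local Notation E := 'rV[R]_d.+1.
Local Notation leb := (@lebesgue_measure R).
Local Notation lebE := (lebesgue_rV R d.+1).

(* The norm of the library on 'rV[R]_d.+1 is the sup norm, hence the following
   Euclidean norm. *)
Definition dotv (x y : E) : R := \sum_i x ord0 i * y ord0 i.
Definition enorm (x : E) : R := Num.sqrt (dotv x x).

Fixpoint partials (s : seq 'I_d.+1) (f : E -> R) : E -> R :=
  if s is i :: s' then fun x => 'D_(delta_mx ord0 i) (partials s' f) x else f.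

Definition smooth (f : E -> R) := forall s,
  continuous (partials s f) /\
  forall i x, derivable (partials s f) x (delta_mx ord0 i).

Definition grad (f : E -> R) (x : E) : E :=
  \row_i 'D_(delta_mx ord0 i) f x.

Definition local_defining (Om : set E) (x : E) (r : E -> R) :=
  [/\ smooth r, grad r x != 0 & \forall y \near x, (Om y <-> r y < 0)].

Definition outer_normal (Om : set E) (x n : E) :=
  (closure Om `\` Om) x /\
  exists2 r, local_defining Om x r & n = (enorm (grad r x))^-1 *: grad r x.

Definition bounded_smooth_domain (Om : set E) :=
  [/\ open Om, connected Om, Om !=set0, bounded_set Om &
      forall x, (closure Om `\` Om) x -> exists r, local_defining Om x r].

(* [Torus L] is (-L, L]^(d+1) with opposite faces identified. *)
Inductive domain :=
  | Whole
  | Bounded of set E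
  | Torus of R.

Definition admissible (D : domain) : Prop :=
  match D with
  | Whole => True
  | Bounded Om => bounded_smooth_domain Om
  | Torus L => 0 < L
  end.

Definition carrier (D : domain) : set E :=
  match D with
  | Whole => setT
  | Bounded Om => Om
  | Torus L => [set x | forall i, - L < x ord0 i <= L]
  end.

Definition dclosure (D : domain) : set E :=
  if D is Bounded Om then closure Om else carrier D.

Definition ddist (D : domain) (x y : E) : R :=
  if D is Torus L then
    inf [set enorm (x - y + (2 * L) *: map_mx intr k) | k in [set: 'rV[int]_d.+1]]
  else enorm (x - y).

Definition dcontinuous (D : domain) (f : E -> R) :=
  forall x, carrier D x -> forall e, 0 < e -> exists2 a, 0 < a &
    forall y, carrier D y -> ddist D x y < a -> `|f x - f y| < e.

(* Compactness in the metric space (dclosure D, ddist D). *)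
Definition dcompact (D : domain) (K : set E) :=
  K `<=` dclosure D /\
  forall u : nat -> E, (forall n, K (u n)) ->
    exists2 x, K x & exists2 g : nat -> nat,
      {homo g : m n / (m < n)%N} & ddist D (u (g n)) x @[n --> \oo] --> 0.

(* Restrictions to [dclosure D] of smooth compactly supported functions: they
   need not vanish near the boundary of a bounded domain, so that testing
   against them encodes the no-flux condition. *)
Definition test_function (D : domain) (phi : E -> R) :=
  smooth phi /\
  if D is Torus L then forall x i, phi (x + (2 * L) *: delta_mx ord0 i) = phi x
  else exists M, forall x, M < enorm x -> phi x = 0.

(* The norm of L^oo(A): f is extended by 0 outside A, so that the norm is 0 (and
   not -oo) when A is negligible. *)
Definition Linf (A : set E) (f : E -> R) : \bar R :=
  ('N[lebE]_+oo [(EFin \o f) \_ A])%E.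

Definition Lip (D : domain) (f : E -> E) : \bar R :=
  ereal_sup [set (enorm (f z.1 - f z.2) / ddist D z.1 z.2)%:E | z in
    [set z : E * E | [/\ carrier D z.1, carrier D z.2 & z.1 != z.2]]].

Definition BLnorm (D : domain) (f : E -> E) : \bar R :=
  (Linf (carrier D) (enorm \o f) + Lip D f)%E.

Definition BL_simple (D : domain) (V : R -> E -> E) :=
  exists (m : nat) (B : 'I_m -> set R) (f : 'I_m -> E -> E),
    (forall i, measurable (B i) /\ (BLnorm D (f i) < +oo)%E) /\
    (forall t x, V t x = \sum_(i < m) (\1_(B i) t : R) *: f i x).

(* The Bochner space L^q(0,h;BL). *)
Definition Lq_BL (D : domain) (q h : R) (V : R -> E -> E) :=
  (exists s : nat -> R -> E -> E,
     (forall n, BL_simple D (s n)) /\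
     (\forall t \ae leb, 0 < t < h ->
        BLnorm D (fun x => V t x - s n t x) @[n --> \oo] --> 0%E)) /\
  (\int[leb]_(t in `]0%R, h[) (BLnorm D (V t)) `^ q < +oo)%E.

Definition Linf_cyl (D : domain) (h : R) (V : R -> E -> E) :=
  measurable_fun (`]0, h[ `*` carrier D) (fun z : measurableTypeR R * E => V z.1 z.2) /\
  ('N[leb \x lebE]_+oo
     [(fun z : measurableTypeR R * E => (enorm (V z.1 z.2))%:E)
        \_ (`]0%R, h[ `*` carrier D)] < +oo)%E.

Definition boundary_value (Om : set E) (f : E -> E) (x l : E) :=
  f y @[y --> within Om (nbhs x)] --> l.

Local Notation P := (probability E R).

Definition Pp_L1 (D : domain) (p : R) : set P := [set mu |
  [/\ mu (~` carrier D) = 0%E,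
      (\int[mu]_x (enorm x `^ p)%:E < +oo)%E &
      exists rho : E -> R,
        [/\ lebE.-integrable setT (EFin \o rho), (forall x, 0 <= rho x) &
            forall A, measurable A -> mu A = (\int[lebE]_(x in A) (rho x)%:E)%E]]].

Definition coupling (mu nu : P) : set (probability (E * E)%type R) :=
  [set pi | forall A, measurable A ->
     pi (A `*` setT) = mu A /\ pi (setT `*` A) = nu A].

Definition Wp (D : domain) (p : R) (mu nu : P) : \bar R :=
  ((ereal_inf [set \int[pi]_z (ddist D z.1 z.2 `^ p)%:E | pi in coupling mu nu])
    `^ p^-1)%E.

Definition narrowly_continuous (D : domain) (T : R) (mu : R -> P) :=
  forall f : E -> R, dcontinuous D f ->
    (exists M, forall x, carrier D x -> `|f x| <= M) ->
    {within `[0, T], continuous (fun t => \int[mu t]_(x in carrier D) f x)}.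

(* Weak form of d_t mu + div (mu v[mu]) = 0 with no flux through the boundary,
   integrated up to every t in [0, T]; testing only against functions of (t, x)
   supported in [0, T) would determine mu t merely for almost every t. *)
Definition weak_solution (D : domain) (T : R) (v : P -> E -> E) (mu : R -> P) :=
  [/\ forall A, measurable A -> measurable_fun `[0, T] (fun t => mu t A),
      measurable_fun (`[0, T] `*` carrier D)
        (fun z : measurableTypeR R * E => v (mu z.1) z.2),
      forall K, dcompact D K ->
        (\int[leb]_(s in `[0%R, T]) \int[mu s]_(x in K `&` carrier D)
           (enorm (v (mu s) x))%:E < +oo)%E &
      forall phi, test_function D phi -> forall t, 0 <= t <= T ->
        \int[mu t]_(x in carrier D) phi x =
        (\int[mu 0]_(x in carrier D) phi x) +
        (\int[leb]_(s in `[0, t]) \int[mu s]_(x in carrier D)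
          dotv (v (mu s) x) (grad phi x))].

Definition solution_in (D : domain) (T : R) (v : P -> E -> E) (A : set P)
    (rho0 : P) (mu : R -> P) :=
  [/\ mu 0 = rho0, forall t, 0 <= t <= T -> A (mu t) & weak_solution D T v mu].

Definition well_posed (D : domain) (T : R) (v : P -> E -> E) (A : set P) :=
  forall rho0, A rho0 ->
    (exists mu, solution_in D T v A rho0 mu) /\
    (forall mu mu', solution_in D T v A rho0 mu ->
       solution_in D T v A rho0 mu' -> forall t, 0 <= t <= T -> mu t = mu' t).

Definition semigroup_on (T : R) (A : set P) (S : R -> P -> P) :=
  [/\ forall t rho, 0 <= t <= T -> A rho -> A (S t rho),
      forall rho, A rho -> S 0 rho = rho &
      forall t s rho, 0 <= t -> 0 <= s -> t + s <= T -> A rho ->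
        S t (S s rho) = S (t + s) rho].

Definition generates_semigroup (D : domain) (T : R) (v : P -> E -> E)
    (A : set P) (S : R -> P -> P) :=
  semigroup_on T A S /\
  forall rho0, A rho0 -> solution_in D T v A rho0 (fun t => S t rho0).

End domains.

Arguments domain : clear implicits.

(* Main.v *)
(* The curve [s |-> S2 (t - s) (mu s)] joins [nu t] to [mu t]. Since
   [mu (s + h) = S1 h (mu s)], its increment over [s, s + h] is at most
   [K (t - s - h) * Wp (S1 h (mu s)) (S2 h (mu s))], so everything rests on the
   infinitesimal estimate
   [limsup_(h -> 0) Wp (S1 h rho) (S2 h rho) / h <= |v^nu[rho] - v^mu[rho]|_(L^p(rho))].
   It is summed by a Dini argument that only uses simple functions below the
   integrand, whose measurability in [s] is not known.
   For the infinitesimal estimate, both velocity fields are extended by McShane's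
   formula to the whole space, with sup norm and Lipschitz constant bounded by
   some l(t) in L^2. The solutions are then the images of [rho] under the flows
   of the extended fields: the flow is the limit of dyadic Euler schemes, along
   which the weak equation, tested with mollified Lipschitz functions, transports
   integrals up to errors that vanish with the mesh. The two flows provide a
   coupling of [S1 h rho] and [S2 h rho], in which the displacement of [x] is the
   time integral of the difference of the fields at [x] up to (int_0^h l)^2,
   and (int_0^h l)^2 = o(h) because l is in L^2. Finally (I.4) replaces the
   difference at time s by the one at time 0, on a compact set of almost full
   [rho]-measure; its complement is controlled by the L^oo bound. *)
Require Import Defs.
From HB Require Import structures.
From mathcomp Require Import all_boot all_order all_algebra.
From mathcomp Require Import all_classical all_reals all_analysis.
From mathcomp Require Import measurable_realfun ess_sup_inf ring lra.

Import Order.TTheory GRing.Theory Num.Def Num.Theory.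
Import numFieldNormedType.Exports.

Local Open Scope classical_set_scope.
Local Open Scope ring_scope.

Set Implicit Arguments.
Unset Strict Implicit.

(** * A Dini comparison principle *)

(** The velocity differences are bounded only at almost every point, so the two flows are compared
    through displacements computed at the starting point, never along trajectories: exceptional sets
    of points then matter at time 0 only, and [rho] ignores them because it has a density.
    Exchanging sections turns [for almost every time, almost every point] into [for almost every
    point, almost every time]. A weak solution is identified with an image measure by pulling test
    functions back through Euler steps. A pulled-back function is only Lipschitz, so it is mollified
    anew at each step. With [om] the integral of [l] over the step, [L] the Lipschitz constant of
    the function and [e] the mollification radius, the commutator costs [L * om * e], and the
    second-order terms cost [om ^ 2] times a constant that depends on [e]. Since the sum of the
    [om ^ 2] is at most the mesh times the integral of [l ^ 2], the mesh goes to zero at fixed [e],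
    and [e] goes to zero last. On the torus everything is computed with periodic fields on the whole
    space, and images are folded back into the cell. *)

Lemma ge0_le_integral_lower d (X : measurableType d) (R : realType)
    (m : {measure set X -> \bar R}) (A : set X) (f g : X -> \bar R) :
  (forall x, A x -> (0 <= f x)%E) -> (forall x, A x -> (f x <= g x)%E) ->
  (\int[m]_(x in A) f x <= \int[m]_(x in A) g x)%E.
Proof.
move=> f0 fg; have g0 x : A x -> (0 <= g x)%E.
  by move=> Ax; exact: le_trans (f0 _ Ax) (fg _ Ax).
(* The integral of a nonnegative function is a supremum over the simple functions below it, which
   makes it monotone without any measurability. *)
rewrite !ge0_integralE//; apply: le_ereal_sup => _ [h hf <-]; exists h => //= x.
apply: le_trans (hf x) _; rewrite /patch; case: ifPn => // /set_mem; exact: fg.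
Qed.

Lemma countType_bigcup_measurable d (X : measurableType d) (I : countType)
    (P : set I) (F : I -> set X) :
  (forall i, P i -> measurable (F i)) -> measurable (\bigcup_(i in P) F i).
Proof.
move=> mF; rewrite bigcup_mkcond; apply: countable_bigcupT_measurable => //.
by move=> i; case: ifPn => // /set_mem; exact: mF.
Qed.

Lemma countType_bigcap_measurable d (X : measurableType d) (I : countType)
    (P : set I) (F : I -> set X) :
  (forall i, P i -> measurable (F i)) -> measurable (\bigcap_(i in P) F i).
Proof.
move=> mF; rewrite -[X in measurable X]setCK setC_bigcap; apply: measurableC.
by apply: countType_bigcup_measurable => i Pi; apply: measurableC; exact: mF.
Qed.

Section measurable_comparison.
Context d (X : measurableType d) (R : realType).
Variables f g : X -> R.
Hypothesis mf : measurable_fun setT f.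
Hypothesis mg : measurable_fun setT g.

Lemma measurable_ltr_set : measurable [set x | f x < g x].
Proof.
rewrite [X in measurable X](_ : _ = (fun x => f x < g x) @^-1` [set true])//.
by rewrite -[X in measurable X]setTI; exact: measurable_fun_ltr.
Qed.

Lemma measurable_ler_set : measurable [set x | f x <= g x].
Proof.
rewrite [X in measurable X](_ : _ = (fun x => f x <= g x) @^-1` [set true])//.
by rewrite -[X in measurable X]setTI; exact: measurable_fun_ler.
Qed.

End measurable_comparison.

Section dini.
Context {R : realType}.
Local Notation leb := (@lebesgue_measure R).
Variables (t : R) (phi G : R -> R).
Hypothesis t0 : 0 < t.
Hypothesis G0 : forall s : R, 0 <= s <= t -> 0 <= G s.
Hypothesis phic : forall s : R, 0 <= s <= t -> forall e : R, 0 < e -> exists2 a : R, 0 < a &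
  forall r : R, 0 <= r <= t -> `|r - s| < a -> `|phi r - phi s| < e.
Hypothesis phi0 : phi 0 = 0.
Hypothesis dphi : forall s : R, 0 <= s < t -> forall e : R, 0 < e -> exists2 a : R, 0 < a &
  forall h : R, 0 < h < a -> s + h <= t -> phi (s + h) - phi s <= h * (G s + e).

(** Freezing [phi] outside [[0, t]] gives a continuous function on the whole line, so that the sets
    of increments below are measurable. *)
Let clamp (s : R) := Num.max 0 (Num.min s t).

Let clamp_itv (s : R) : 0 <= clamp s <= t.
Proof. by rewrite /clamp le_max lexx/= ge_max (ltW t0)/= ge_min lexx orbT. Qed.

Let clampE (s : R) : 0 <= s <= t -> clamp s = s.
Proof. by move=> /andP[s0 st]; rewrite /clamp (min_idPl st) (max_idPr s0). Qed.

Let clamp_lip (r s : R) : `|clamp r - clamp s| <= `|r - s|.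
Proof.
rewrite /clamp /Num.max /Num.min.
by do !case: ifPn; rewrite -?leNgt => *; rewrite ler_norml;
  have := ler_norm (r - s); have := ler_norm (s - r); rewrite (distrC s r) => *; apply/andP; split; lra.
Qed.

Let psi s := phi (clamp s).

Let psi_cont : continuous psi.
Proof.
move=> s; apply/cvgrPdist_lt => e e0.
have [a a0 ha] := phic (clamp_itv s) e0.
near=> r; rewrite distrC; apply: ha => //.
apply: le_lt_trans (clamp_lip _ _) _.
by near: r; apply: cvgr_distC_lt.
Unshelve. all: by end_near. Qed.

Section level_sets.
Variable e : R.
Hypothesis e0 : 0 < e.

(** Rational increments keep [E] a countable combination of measurable sets, and [grow] needs only
    one increment at each point. Increments that leave [[0, t]] are vacuously accepted. *)
Let slow j (q : rat) : set R := [set s | s + ratr q <= t ->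
  psi (s + ratr q) - psi s <= (j.+1%:R * e) * ratr q].

Let mslow j q : measurable (slow j q).
Proof.
have mpsi : measurable_fun setT psi by exact: continuous_measurable_fun.
have mq : measurable_fun setT (fun s : R => s + ratr q) by exact: measurable_funD.
have -> : slow j q = [set s | t < s + ratr q] `|`
    [set s | psi (s + ratr q) - psi s <= (j.+1%:R * e) * ratr q].
  apply/seteqP; split => s; rewrite /slow/=.
    by case: (leP (s + ratr q) t) => [h /(_ isT)|]; [right|left].
  by move=> [h|//]; rewrite leNgt h.
apply: measurableU.
  exact: measurable_ltr_set.
by apply: measurable_ler_set => //; apply: measurable_funB => //; exact: measurableT_comp.
Qed.

Let E j : set R := \bigcup_n \bigcap_(q in [set q : rat | 0 < (ratr q : R) < n.+1%:R^-1]) slow j q.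

Let mE j : measurable (E j).
Proof.
by apply: bigcup_measurable => n _; exact: countType_bigcap_measurable.
Qed.

(** For positive [j] this is a measurable part of the level set where [G] is at least [j * e], a set
    that may itself fail to be measurable. The shifted index makes [C 0] all of [[0, t[]: this layer
    pays for rounding [G] up to a multiple of [e]. *)
Let C j : set R := `[0, t[ `\` (if j is i.+1 then E i else set0).

Let mC j : measurable (C j).
Proof. by apply: measurableD; [exact: measurable_itv|case: j]. Qed.

Let Ebig (s : R) j : 0 <= s < t -> G s < j.+1%:R * e -> E j s.
Proof.
move=> st Gj; have d0 : 0 < j.+1%:R * e - G s by rewrite subr_gt0.
have [a a0 ha] := dphi st d0.
have [n] := ltr_add_invr a0; rewrite add0r => hn.
exists n => // q /= /andP[q0 qn] sqt.
have qa : ratr q < a by apply: (lt_trans qn); exact: hn.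
rewrite /psi !clampE; [|lra|lra].
have := ha (ratr q); rewrite q0 qa => /(_ isT sqt).
by rewrite subrKC mulrC.
Qed.

Let C_G (s : R) j : C j.+1 s -> j.+1%:R * e <= G s.
Proof.
by move=> [/= + nE]; rewrite in_itv/= => st; rewrite leNgt; apply/negP => /(Ebig st).
Qed.

(** The partial sums of the layers stay below [G]: at a point of [C N.+1] the first [N.+1] layers
    contribute at most [N.+1 * e], which [G] exceeds there; elsewhere the last layer contributes
    nothing. *)
Let lower : ((\sum_(j <oo) (e%:E * leb (C j.+1))) <=
  \int[leb]_(s in `[0%R, t]) (G s)%:E)%E.
Proof.
have mI : measurable `[0, t]%classic by exact: measurable_itv.
under eq_eseriesr => j _.
  rewrite (_ : (e%:E * leb (C j.+1))%E =
    (\int[leb]_(s in `[0%R, t]) (e%:E * (\1_(C j.+1) s)%:E))%E); last first.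
    rewrite ge0_integralZl//=; last 2 first.
      by apply/measurable_EFinP; exact: (measurable_indic (mC _)).
      by rewrite lee_fin ltW.
    rewrite integral_indic; [|exact: mI|exact: mC]; rewrite setIidl// => s [/= + _]; rewrite !in_itv/=.
    by move=> /andP[-> /ltW].
  over.
rewrite -integral_nneseries//; last 2 first.
- move=> n; apply: emeasurable_funM => //.
  by apply/measurable_EFinP; exact: (measurable_indic (mC _)).
- by move=> n x _; rewrite -EFinM lee_fin mulr_ge0// ltW.
apply: ge0_le_integral_lower => s.
  by move=> _; apply: nneseries_ge0 => n _ _; rewrite -EFinM lee_fin mulr_ge0// ltW.
rewrite /= in_itv/= => st.
apply: lime_le.
  by apply: is_cvg_nneseries => n _ _; rewrite -EFinM lee_fin mulr_ge0// ltW.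
apply: nearW => N.
under eq_bigr do rewrite -EFinM.
rewrite sumEFin lee_fin; elim: N => [|N ih]; first by rewrite big_geq// G0.
have [CN|CN] := pselect (C N.+1 s); last first.
  by rewrite big_nat_recr//= indicE memNset// mulr0 addr0.
apply: le_trans (C_G CN); apply: (@le_trans _ _ (\sum_(0 <= j < N.+1) e)).
  apply: ler_sum => j _; rewrite indicE; case: (s \in _) => /=; first by rewrite mulr1.
  by rewrite mulr0 ltW.
by rewrite sumr_const_nat subn0 mulr_natl.
Qed.

Section cover.
Variable U : nat -> set R.
Hypothesis oU : forall j, open (U j).
Hypothesis CU : forall j, C j `<=` U j.
Hypothesis leU : forall j, (leb (U j `\` C j) < (e / (2 ^ j.+1)%:R)%:E)%E.

Let mU j : measurable (U j).
Proof. exact: open_measurable. Qed.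

Let mUI j (r : R) : measurable (U j `&` `[0%R, r]%classic).
Proof. by apply: measurableI; [exact: mU|exact: measurable_itv]. Qed.

Let Psi (r : R) := (\sum_(j <oo) e%:E * leb (U j `&` `[0%R, r]%classic))%E.

Let term_ge0 (r : R) j : (0 <= e%:E * leb (U j `&` `[0%R, r]%classic))%E.
Proof. by rewrite mule_ge0// lee_fin ltW. Qed.

Let Psi_mono (r s : R) : r <= s -> (Psi r <= Psi s)%E.
Proof.
move=> rs; apply: lee_nneseries => [j _ _|j _]; first exact: term_ge0.
rewrite lee_pmul2l// ?lte_fin// le_measure ?inE//.
- exact: mUI.
- exact: mUI.
- by apply: setIS => x /=; rewrite !in_itv/= => /andP[-> /le_trans]; exact.
Qed.

(** If [J] is the first index with [s] in [E J], then [s] lies in the [J.+1] open sets [U 0], ...,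
    [U J]. Over a short rational step each of them adds [e] times the step to [Psi], and together
    they pay for the slope [J.+1 * e] that [E J] allows to [phi]. *)
Let grow (s : R) : 0 <= s < t ->
  exists2 r : R, s < r <= t & (Psi s + (phi r - phi s)%:E <= Psi r)%E.
Proof.
move=> st.
have [j0 Ej0] : exists j, `[< E j s >].
  exists (Num.bound (G s / e)); apply/asboolP/Ebig => //.
  have : 0 <= G s / e by apply: divr_ge0; [apply: G0; lra|exact: ltW].
  move=> /archi_boundP; rewrite ltr_pdivrMr// => /lt_trans; apply.
  by rewrite ltr_pM2r// ltr_nat.
case: (ex_minnP (ex_intro (fun j => `[< E j s >]) j0 Ej0)) => J /asboolP EJ minJ.
have CJ j : (j <= J)%N -> C j s.
  move=> jJ; split; first by rewrite /= in_itv.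
  case: j jJ => [|i] iJ //= Ei.
  by move: iJ; rewrite ltnNge minJ//; exact/asboolP.
have [a a0 Ua] : exists2 a : R, 0 < a & forall j, (j <= J)%N ->
    forall r : R, `|s - r| < a -> U j r.
  have H j : (j <= J)%N -> exists2 a : R, 0 < a & forall r : R, `|s - r| < a -> U j r.
    move=> jJ; have : nbhs s (U j) by apply: open_nbhs_nbhs; split => //; exact/CU/CJ.
    by move=> /nbhs_ballP[a a0 ha]; exists a => // r; exact: ha.
  elim: J {EJ minJ CJ} H => [|J ih] H.
    have [a a0 ha] := H 0%N (leqnn _); exists a => // j.
    by rewrite leqn0 => /eqP->.
  have [a a0 ha] := H J.+1 (leqnn _).
  have [b b0 hb] := ih (fun j jJ => H j (leqW jJ)).
  exists (Num.min a b); first by rewrite lt_min a0.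
  move=> j; rewrite leq_eqVlt => /predU1P[->|jJ] r; rewrite lt_min => /andP[ra rb].
    exact: ha.
  exact: (hb j).
have [n _ hn] := EJ.
pose b := Num.min (Num.min a n.+1%:R^-1) (t - s).
have b0 : 0 < b by rewrite !lt_min a0 invr_gt0 ltr0n subr_gt0; case/andP : st.
have [q] := rat_in_itvoo b0.
rewrite in_itv/= !lt_min => /andP[q0 /andP[/andP[qa qn] qt]].
have sqt : s + ratr q <= t by lra.
have := hn q; rewrite /= q0 qn => /(_ isT) /(_ sqt).
rewrite /psi !clampE; [|lra|lra] => hphi.
exists (s + ratr q); first by apply/andP; split=> //; lra.
pose c (j : nat) := (if (j <= J)%N then (e * ratr q)%:E else 0)%E.
have c0 j : (0 <= c j)%E.
  by rewrite /c; case: ifP => // _; rewrite lee_fin mulr_ge0 ?ltW.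
apply: (@le_trans _ _ (Psi s + \sum_(j <oo) c j)%E).
  rewrite leeD2l//.
  apply: (@le_trans _ _ (\sum_(0 <= j < J.+1) c j)%E); last by apply: nneseries_lim_ge => j _ _; exact: c0.
  rewrite (eq_big_nat _ _ (F2 := fun=> (e * ratr q)%:E)); last first.
    by move=> j /andP[_]; rewrite ltnS /c => ->.
  rewrite sumEFin lee_fin sumr_const_nat subn0; apply: le_trans hphi _.
  by rewrite -mulrA mulr_natl.
rewrite /Psi -nneseriesD//.
apply: lee_nneseries => [j _ _|j _]; first by rewrite adde_ge0.
rewrite /c; case: ifPn => jJ; last first.
  rewrite adde0 lee_pmul2l// ?lte_fin// le_measure ?inE//.
  - exact: mUI.
  - exact: mUI.
  - by apply: setIS => x /=; rewrite !in_itv/= => /andP[-> xs]/=; lra.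
rewrite EFinM -ge0_muleDr//; last by rewrite lee_fin ltW.
rewrite lee_pmul2l// ?lte_fin//.
have -> : (ratr q)%:E = leb `]s, s + ratr q].
  by rewrite lebesgue_measure_itv/= lte_fin ltrDl q0 -EFinB addrAC subrr add0r.
rewrite -measureU//=; last 2 first.
- exact: mUI.
- apply/seteqP; split => x //= [[_]]; rewrite !in_itv/= => /andP[_ xs] /andP[sx _].
  by move: (lt_le_trans sx xs); rewrite ltxx.
apply: le_measure; rewrite ?inE.
- apply: measurableU; last exact: measurable_itv.
  exact: mUI.
- exact: mUI.
move=> x [[Ux]|] /=; rewrite !in_itv/= => /andP[h1 h2].
  by split => //; rewrite h1/=; lra.
split; last by apply/andP; split => //; lra.
by apply: (Ua _ jJ); rewrite distrC ger0_norm; lra.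
Qed.

(** Continuity of [phi] and monotonicity of [Psi] carry the inequality to the supremum of the points
    where it holds; [grow] forces that supremum to be [t]. *)
Let phi_Psi : ((phi t)%:E <= Psi t)%E.
Proof.
pose S := [set r : R | 0 <= r <= t /\ ((phi r)%:E <= Psi r)%E].
have S0 : S 0.
  split; first by rewrite lexx ltW.
  by rewrite phi0; apply: nneseries_ge0.
have St : ubound S t by move=> r [/andP[]].
have supS : has_sup S by split; [exists 0|exists t].
have s0 : 0 <= sup S by apply: ub_le_sup => //; exists t.
have st : sup S <= t by apply: ge_sup => //; exists 0.
have SS : S (sup S).
  split; first by rewrite s0 st.
  apply/lee_addgt0Pr => n n0.
  have [|a a0 ha] := phic _ n0 (s := sup S); first by rewrite s0.
  have [r Sr ra] := sup_adherent a0 supS.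
  have rs : r <= sup S by apply: ub_le_sup => //; exists t.
  case: (Sr) => rt pr; apply: (@le_trans _ _ ((phi r)%:E + n%:E)%E).
    rewrite -EFinD lee_fin.
    have : `|phi r - phi (sup S)| < n by apply: ha => //; rewrite distrC ger0_norm; lra.
    by rewrite ltr_norml => /andP[? _]; lra.
  by rewrite leeD2r//; apply: le_trans pr _; exact: Psi_mono.
move: st; rewrite le_eqVlt => /predU1P[<-|st]; first by case: SS.
have [|r /andP[sr rt] hr] := @grow (sup S); first by rewrite s0.
suff : r <= sup S by rewrite leNgt sr.
apply: ub_le_sup; first by exists t.
split; first by rewrite rt andbT; lra.
apply: le_trans hr; case: SS => _ h.
apply: (@le_trans _ _ ((phi (sup S))%:E + (phi r - phi (sup S))%:E)%E).
  by rewrite -EFinD lee_fin; lra.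
exact: leeD2r.
Qed.

(** [C 0] has measure [t] and costs [e * t], the other layers lie below [G], and the excess of the
    open sets [U j] over the [C j] costs at most [e * e] in total. *)
Lemma dini_cover : ((phi t)%:E <=
  \int[leb]_(s in `[0%R, t]) (G s)%:E + (e * (t + e))%:E)%E.
Proof.
have tC n : (0 <= e%:E * leb (C n))%E by rewrite mule_ge0// lee_fin ltW.
apply: le_trans phi_Psi _.
apply: (@le_trans _ _ (\sum_(j <oo) (e%:E * leb (C j) + (e * e / (2 ^ j.+1)%:R)%:E))%E).
  apply: lee_nneseries => // j _.
  rewrite -mulrA EFinM -ge0_muleDr//; last first.
    by rewrite lee_fin divr_ge0// ltW.
  rewrite lee_pmul2l// ?lte_fin//.
  apply: (@le_trans _ _ (leb (U j))).
    apply: le_measure; rewrite ?inE; [exact: mUI|exact: mU|exact: subIsetl].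
  rewrite -(setDUK (@CU j)) measureU; last 3 first.
  - exact: mC.
  - by apply: measurableD; [exact: mU|exact: mC].
  - by rewrite setDIK.
  exact: (leeD2l _ (ltW (leU j))).
apply: le_trans (epsilon_trick _ _ _) _ => //; first by rewrite mulr_ge0// ltW.
rewrite mulrDr EFinD addeA leeD2r//.
apply: lime_le; first exact: is_cvg_nneseries.
apply: nearW => -[|N].
  rewrite big_geq// adde_ge0//; last by rewrite lee_fin mulr_ge0// ltW.
  by apply: integral_ge0 => s; rewrite /= in_itv/= => /G0.
rewrite big_nat_recl// addeC leeD//.
  rewrite EFinM lee_pmul2l ?lte_fin//.
  by rewrite /C setD0 lebesgue_measure_itv/= lte_fin t0 sube0.
apply: le_trans lower.
exact: (nneseries_lim_ge (u_ := fun j => (e%:E * leb (C j.+1))%E) (P := xpredT)).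
Qed.

End cover.

Lemma dini_le_integral_eps : ((phi t)%:E <=
  \int[leb]_(s in `[0%R, t]) (G s)%:E + (e * (t + e))%:E)%E.
Proof.
have H j : exists V, [/\ open V, C j `<=` V &
    (leb (V `\` C j) < (e / (2 ^ j.+1)%:R)%:E)%E].
  apply: lebesgue_regularity_outer => //; last by rewrite divr_gt0// ltr0n expn_gt0.
  apply: (@le_lt_trans _ _ (leb `[0, t[)).
    apply: le_measure; rewrite ?inE; [exact: mC|exact: measurable_itv|exact: subDsetl].
  by rewrite lebesgue_measure_itv/= lte_fin t0 sube0 ltry.
have [U hU] := choice H.
by apply: (dini_cover (U := U)) => j; case: (hU j).
Qed.

End level_sets.

Lemma dini_le_integral :
  ((phi t)%:E <= \int[leb]_(s in `[0%R, t]) (G s)%:E)%E.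
Proof.
apply/lee_addgt0Pr => n n0.
pose e := Num.min 1 (n / (t + 1)).
have e0 : 0 < e by rewrite lt_min ltr01 divr_gt0// addr_gt0.
apply: le_trans (dini_le_integral_eps e0) _.
rewrite leeD2l// lee_fin; apply: (@le_trans _ _ (n / (t + 1) * (t + 1))).
  have e1 : e <= 1 by rewrite ge_min lexx.
  have en : e <= n / (t + 1) by rewrite ge_min lexx orbT.
  by apply: ler_pM; [exact: ltW|rewrite ltW// addr_gt0|exact: en|rewrite lerD2l].
by rewrite divfK// gt_eqF// addr_gt0.
Qed.

End dini.

(** * Euclidean norm and quotient distance *)

Section euclidean.
Context {R : realType} {d : nat}.
Local Notation E := 'rV[R]_d.+1.

Lemma coord_le_norm (x : E) i : `|x ord0 i| <= `|x|.
Proof.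
have := le_bigmax 0 (fun k : 'I_1 * 'I_d.+1 => `|x k.1 k.2|) (ord0, i).
by rewrite -mx_normrE.
Qed.

Lemma norm_le_coord (x : E) (c : R) : (forall i, `|x ord0 i| <= c) -> `|x| <= c.
Proof.
move=> h; have -> : `|x| = mx_norm x by [].
have [->|] := eqVneq (mx_norm x) 0; first exact: le_trans (h ord0).
by move=> /mx_norm_neq0[[i j] ->] /=; rewrite (ord1 i).
Qed.

Lemma dotvC (x y : E) : dotv x y = dotv y x.
Proof. by apply: eq_bigr => i _; rewrite mulrC. Qed.

Lemma dotvDl (x y z : E) : dotv (x + y) z = dotv x z + dotv y z.
Proof. by rewrite -big_split; apply: eq_bigr => i _; rewrite mxE mulrDl. Qed.

Lemma dotvZl (a : R) (x z : E) : dotv (a *: x) z = a * dotv x z.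
Proof. by rewrite mulr_sumr; apply: eq_bigr => i _; rewrite mxE mulrA. Qed.

Lemma dotv_ge0 (x : E) : 0 <= dotv x x.
Proof. by apply: sumr_ge0 => i _; rewrite -expr2 sqr_ge0. Qed.

Lemma enorm_ge0 (x : E) : 0 <= enorm x.
Proof. exact: sqrtr_ge0. Qed.

Lemma sqr_enorm (x : E) : enorm x ^+ 2 = dotv x x.
Proof. by rewrite sqr_sqrtr ?dotv_ge0. Qed.

Lemma enorm0 : enorm (0 : E) = 0.
Proof. by rewrite /enorm /dotv big1 ?sqrtr0// => i _; rewrite mxE mul0r. Qed.

Lemma enormN (x : E) : enorm (- x) = enorm x.
Proof.
by rewrite /enorm; congr Num.sqrt; apply: eq_bigr => i _; rewrite mxE mulrNN.
Qed.

Lemma enormB (x y : E) : enorm (x - y) = enorm (y - x).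
Proof. by rewrite -enormN opprB. Qed.

Lemma coord_le_enorm (x : E) i : `|x ord0 i| <= enorm x.
Proof.
rewrite -(@ler_pXn2r _ 2)// ?nnegrE ?enorm_ge0// sqr_enorm real_normK ?num_real//.
rewrite /dotv (bigD1 i)//= -expr2 lerDl.
by apply: sumr_ge0 => j _; rewrite -expr2 sqr_ge0.
Qed.

Lemma enorm_le_sum (x : E) : enorm x <= \sum_i `|x ord0 i|.
Proof.
have s0 : 0 <= \sum_i `|x ord0 i| by apply: sumr_ge0.
rewrite -(@ler_pXn2r _ 2)// ?nnegrE ?enorm_ge0// sqr_enorm expr2 mulr_suml.
apply: ler_sum => i _; apply: le_trans (ler_norm _) _; rewrite normrM.
by rewrite ler_wpM2l// (bigD1 i)//= lerDl sumr_ge0.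
Qed.

Lemma enorm_le_norm (x : E) : enorm x <= d.+1%:R * `|x|.
Proof.
apply: le_trans (enorm_le_sum _) _; rewrite mulr_natl -[X in _ *+ X](card_ord d.+1).
by rewrite -sumr_const; apply: ler_sum => i _; exact: coord_le_norm.
Qed.

Lemma enorm_eq0 (x : E) : enorm x = 0 -> x = 0.
Proof.
move=> x0; apply/rowP => i; rewrite mxE; apply/eqP; rewrite -normr_le0 -x0.
exact: coord_le_enorm.
Qed.

(** Expanding the square of [enorm y *: x - enorm x *: y] gives the Cauchy-Schwarz inequality. *)
Lemma dotv_le (x y : E) : dotv x y <= enorm x * enorm y.
Proof.
have [x0|x0] := eqVneq (enorm x) 0.
  rewrite x0 (enorm_eq0 x0) mul0r /dotv big1// => i _.
  by rewrite mxE mul0r.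
have {}x0 : 0 < enorm x by rewrite lt_def x0 enorm_ge0.
have [y0|y0] := eqVneq (enorm y) 0.
  rewrite y0 (enorm_eq0 y0) mulr0 /dotv big1// => i _.
  by rewrite mxE mulr0.
have {}y0 : 0 < enorm y by rewrite lt_def y0 enorm_ge0.
have : 0 <= dotv (enorm y *: x - enorm x *: y) (enorm y *: x - enorm x *: y).
  exact: dotv_ge0.
rewrite -scaleNr dotvDl !dotvZl !(dotvC _ (_ + _)) !dotvDl !dotvZl (dotvC y x).
rewrite -!sqr_enorm => h.
have {h} : 0 <= 2 * (enorm x * enorm y) * (enorm x * enorm y - dotv x y) by lra.
by rewrite pmulr_rge0 ?subr_ge0// !mulr_gt0.
Qed.

Lemma enormD (x y : E) : enorm (x + y) <= enorm x + enorm y.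
Proof.
rewrite -(@ler_pXn2r _ 2)// ?nnegrE ?enorm_ge0 ?addr_ge0 ?enorm_ge0//.
rewrite sqr_enorm dotvDl !(dotvC _ (_ + _)) !dotvDl (dotvC y x) -!sqr_enorm.
have := dotv_le x y; lra.
Qed.

Lemma enormZ (a : R) (x : E) : enorm (a *: x) = `|a| * enorm x.
Proof.
apply/eqP; rewrite -(@eqrXn2 _ 2)// ?mulr_ge0 ?enorm_ge0//.
by rewrite exprMn !sqr_enorm dotvZl dotvC dotvZl mulrA real_normK ?num_real.
Qed.

Lemma enorm_lipschitz (x y : E) : `|enorm x - enorm y| <= enorm (x - y).
Proof.
have h1 := enormD (x - y) y; have h2 := enormD (y - x) x.
by rewrite !subrK enormB in h1 h2 *; rewrite ler_norml; apply/andP; split; lra.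
Qed.

End euclidean.

Section quotient_distance.
Context {R : realType} {d : nat}.
Local Notation E := 'rV[R]_d.+1.
Variable D : domain R d.
Hypothesis hD : admissible D.

Let toruset L (x y : E) : set R :=
  [set enorm (x - y + (2 * L) *: map_mx intr k) | k in [set: 'rV[int]_d.+1]].

Let has_inf_torus L (x y : E) : has_inf (toruset L x y).
Proof.
split; first by exists (enorm (x - y + (2 * L) *: map_mx intr 0)); exists 0.
by exists 0 => _ [k _ <-]; exact: enorm_ge0.
Qed.

Lemma torus_ddist_le (L : R) (x y : E) (k : 'rV[int]_d.+1) :
  ddist (Torus L) x y <= enorm (x - y + (2 * L) *: map_mx intr k).
Proof. by apply: ge_inf; [case: (has_inf_torus L x y)|exists k]. Qed.

Lemma torus_ddist_lt (L : R) (x y : E) (c : R) : ddist (Torus L) x y < c ->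
  exists k : 'rV[int]_d.+1, enorm (x - y + (2 * L) *: map_mx intr k) < c.
Proof. by move=> /(inf_lt (has_inf_torus L x y).1)[_ [k _ <-] kc]; exists k. Qed.

Lemma ddist_ge0 (x y : E) : 0 <= ddist D x y.
Proof.
case: D => [|Om|L]; rewrite /=; [exact: enorm_ge0|exact: enorm_ge0|].
apply: lb_le_inf; first by case: (has_inf_torus L x y).
by move=> _ [k _ <-]; exact: enorm_ge0.
Qed.

Lemma ddist_le (x y : E) : ddist D x y <= enorm (x - y).
Proof.
case: D => //= L; have := torus_ddist_le L x y 0.
by rewrite map_mx0 ?scaler0 ?addr0// .
Qed.

Lemma ddistxx (x : E) : ddist D x x = 0.
Proof.
by apply/eqP; rewrite eq_le ddist_ge0 andbT -(@enorm0 R d) -(subrr x) ddist_le.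
Qed.

Lemma ddistC (x y : E) : ddist D x y = ddist D y x.
Proof.
suff h (u v : E) : ddist D u v <= ddist D v u by apply/eqP; rewrite eq_le !h.
case: D => [|Om|L]; [by rewrite /= enormB|by rewrite /= enormB|].
apply: lb_le_inf; first by case: (has_inf_torus L v u).
move=> _ [k _ <-]; apply: le_trans (torus_ddist_le L u v (- k)) _.
rewrite -enormN le_eqVlt; apply/orP; left; apply/eqP; congr enorm.
by apply/rowP => i; rewrite !mxE intrN; ring.
Qed.

Lemma ddist_triangle (y x z : E) : ddist D x z <= ddist D x y + ddist D y z.
Proof.
case: D => [|Om|L].
- by rewrite /= (le_trans _ (enormD _ _))// subrKA.
- by rewrite /= (le_trans _ (enormD _ _))// subrKA.
apply/ler_addgt0Pr => e e0; have e20 : 0 < e / 2 by rewrite divr_gt0.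
have [k hk] := @torus_ddist_lt L x y (ddist (Torus L) x y + e / 2) ltac:(by rewrite ltrDl).
have [l hl] := @torus_ddist_lt L y z (ddist (Torus L) y z + e / 2) ltac:(by rewrite ltrDl).
apply: le_trans (torus_ddist_le L x z (k + l)) _.
have -> : x - z + (2 * L) *: map_mx intr (k + l) =
    (x - y + (2 * L) *: map_mx intr k) + (y - z + (2 * L) *: map_mx intr l).
  by apply/rowP => i; rewrite !mxE intrD; ring.
have := enormD (x - y + (2 * L) *: map_mx intr k) (y - z + (2 * L) *: map_mx intr l).
lra.
Qed.

Lemma torus_ddist_shift (L : R) (x y : E) (k : 'rV[int]_d.+1) :
  ddist (Torus L) (x + (2 * L) *: map_mx intr k) y = ddist (Torus L) x y.
Proof.
suff h (u : E) l : ddist (Torus L) (u + (2 * L) *: map_mx intr l) y <= ddist (Torus L) u y.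
  apply/eqP; rewrite eq_le h/=.
  have := h (x + (2 * L) *: map_mx intr k) (- k).
  by rewrite map_mxN scalerN addrK.
apply: lb_le_inf; first by case: (has_inf_torus L u y).
move=> _ [m _ <-]; apply: le_trans (torus_ddist_le L _ y (m - l)) _.
rewrite le_eqVlt; apply/orP; left; apply/eqP; congr enorm.
by apply/rowP => i; rewrite !mxE intrB; ring.
Qed.

(** A nonzero period shifts some coordinate by at least [2 * L]. If that coordinate of [x - y] is at
    most [2 * L - r], the shifted one is still at least [r], so a distance below [r] is realised
    without any shift. *)
Lemma torus_ddist_small (L r : R) (x y : E) : 0 < L ->
  (forall i, `|x ord0 i - y ord0 i| <= 2 * L - r) -> ddist (Torus L) x y < r ->
  forall i, `|x ord0 i - y ord0 i| < r.
Proof.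
move=> L0 xy /torus_ddist_lt[k kr] i.
have := le_lt_trans (coord_le_enorm _ i) kr; rewrite !mxE => h.
have [ki|ki] := eqVneq (k ord0 i) 0; first by rewrite ki mulr0 addr0 in h.
exfalso; have k1 : 1 <= `|(k ord0 i)%:~R : R|.
  by rewrite -intr_norm ler1z; move: ki; rewrite -normr_gt0.
have : 2 * L <= `|2 * L * (k ord0 i)%:~R|.
  by rewrite normrM (gtr0_norm (_ : 0 < 2 * L)) ?mulr_gt0// ler_peMr// mulr_ge0// ltW.
have := xy i; have := ler_normB (x ord0 i - y ord0 i + 2 * L * (k ord0 i)%:~R) (x ord0 i - y ord0 i).
rewrite addrAC subrr add0r; lra.
Qed.

End quotient_distance.

(** * Measurability in coordinates, half-open boxes and countable dense sets *)

Section measurability.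
Context {R : realType} {d : nat}.
Local Notation E := 'rV[R]_d.+1.

Definition box (l u : E) : set E :=
  [set x | forall i, `]l ord0 i, u ord0 i]%classic (x ord0 i)].

Lemma in_box (l u x : E) :
  box l u x <-> forall i, l ord0 i < x ord0 i <= u ord0 i.
Proof. by split => h i; have := h i; rewrite /= in_itv. Qed.

Lemma measurable_box (l u : E) : measurable (box l u).
Proof.
by apply: (@measurable_rV_box R _ (fun i => `]l ord0 i, u ord0 i]%classic)) => i;
  exact: measurable_itv.
Qed.

(** The sigma-algebra is generated by the coordinates, so an open set has to be exhibited as a
    countable union of half-open cubes with rational centres. *)
Lemma open_measurable_rV (U : set E) : open U -> measurable U.
Proof.
move=> oU.
pose mesh (p : 'rV[rat]_d.+1 * nat) : set E :=
  box (map_mx ratr p.1 - const_mx p.2.+1%:R^-1) (map_mx ratr p.1 + const_mx p.2.+1%:R^-1).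
rewrite [X in measurable X](_ : _ = \bigcup_(p in [set p | mesh p `<=` U]) mesh p).
  by apply: countType_bigcup_measurable => p _; exact: measurable_box.
apply/seteqP; split => [x Ux|x [p pU px]]; last exact: pU.
have : nbhs x U by exact: open_nbhs_nbhs.
move=> /nbhs_ballP[e /= e0 xeU].
have e20 : 0 < e / 2 by rewrite divr_gt0.
have [m [r [rE r0 hr]]] : exists m (r : R), [/\ m.+1%:R^-1 = r, 0 < r & r < e / 2].
  have [m] := ltr_add_invr e20; rewrite add0r => hm.
  by exists m, m.+1%:R^-1; split => //; rewrite invr_gt0.
have H i : exists q : rat, x ord0 i - r < ratr q < x ord0 i.
  have [q] := @rat_in_itvoo R (x ord0 i - r) (x ord0 i) ltac:(by rewrite ltrBlDr ltrDl).
  by rewrite in_itv/=; exists q.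
have [q hq] := choice H.
exists (\row_i q i, m); rewrite /mesh /= rE; first move=> y /in_box hy.
  apply: xeU; rewrite mx_norm_ball /ball_/=.
  apply: (@le_lt_trans _ _ (2 * r)); last by lra.
  apply: norm_le_coord => i; have := hy i; rewrite !mxE.
  by have /andP[? ?] := hq i => /andP[? ?]; rewrite ler_norml; apply/andP; split; lra.
by apply/in_box => i; have /andP[? ?] := hq i; rewrite !mxE; apply/andP; split; lra.
Qed.

Lemma continuous_measurable_rV (f : E -> R) : continuous f -> measurable_fun setT f.
Proof.
move=> /continuousP cf.
apply: (measurability _ (RGenOInfty.measurableE R)).
move=> _ [_ [r ->] <-]; rewrite setTI; apply: open_measurable_rV; apply: cf.
exact: interval_open.
Qed.

Lemma lipschitz_continuous_rV (f : E -> R) (k : R) :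
  (forall x y, `|f x - f y| <= k * `|x - y|) -> continuous f.
Proof.
move=> lf x A /nbhs_ballP[e /= e0 eA].
have k0 : 0 < `|k| + 1 by rewrite ltr_wpDl.
apply/nbhs_ballP; exists (e / (`|k| + 1)) => /=; first by rewrite divr_gt0.
move=> y; rewrite mx_norm_ball /ball_/= ltr_pdivlMr// mulrC => xy; apply: eA.
rewrite /ball/=; apply: le_lt_trans xy; apply: le_trans (lf x y) _.
by rewrite ler_wpM2r// (le_trans (ler_norm k))// lerDl.
Qed.

Lemma lipschitz_measurable_rV (f : E -> R) (k : R) :
  (forall x y, `|f x - f y| <= k * `|x - y|) -> measurable_fun setT f.
Proof. by move=> /lipschitz_continuous_rV; exact: continuous_measurable_rV. Qed.

Lemma measurable_enorm : measurable_fun setT (@enorm R d).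
Proof.
apply: (@lipschitz_measurable_rV _ d.+1%:R) => x y.
by apply: le_trans (enorm_lipschitz _ _) _; exact: enorm_le_norm.
Qed.

Section vector_valued.
Context {dd : measure_display} {X : measurableType dd}.

Lemma measurable_rVD (f g : X -> E) : measurable_fun setT f ->
  measurable_fun setT g -> measurable_fun setT (fun x => f x + g x).
Proof.
move=> mf mg; apply: measurable_fun_coordP => i.
rewrite (_ : (fun t => _) = (fun t => f t ord0 i) \+ (fun t => g t ord0 i)).
  by apply: measurable_funD;
    [exact: (measurableT_comp (measurable_coord i) mf)|exact: (measurableT_comp (measurable_coord i) mg)].
by apply/funext => t; rewrite mxE.
Qed.

Lemma measurable_rVZ (a : R) (f : X -> E) : measurable_fun setT f ->
  measurable_fun setT (fun x => a *: f x).
Proof.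
move=> mf; apply: measurable_fun_coordP => i.
rewrite (_ : (fun t => _) = (fun t => a * f t ord0 i)).
  by apply: measurable_funM => //; exact: (measurableT_comp (measurable_coord i) mf).
by apply/funext => t; rewrite mxE.
Qed.

Lemma measurable_rVB (f g : X -> E) : measurable_fun setT f ->
  measurable_fun setT g -> measurable_fun setT (fun x => f x - g x).
Proof.
move=> mf mg; rewrite (_ : (fun t => _) = (fun t => f t + (-1) *: g t)).
  by apply: measurable_rVD => //; exact: measurable_rVZ.
by apply/funext => t; rewrite scaleN1r.
Qed.

End vector_valued.

Lemma measurable_ddist (D : domain R d) :
  measurable_fun setT (fun z : E * E => ddist D z.1 z.2).
Proof.
have mB : measurable_fun setT (fun z : E * E => z.1 - z.2).
  by apply: measurable_rVB; [exact: measurable_fst|exact: measurable_snd].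
case: D => [|Om|L]; [exact: (measurableT_comp measurable_enorm mB)|exact: (measurableT_comp measurable_enorm mB)|].
apply: (measurability _ (RGenInftyO.measurableE R)).
move=> _ [_ [r ->] <-]; rewrite setTI.
rewrite [X in measurable X](_ : _ = \bigcup_(k : 'rV[int]_d.+1)
    [set z : E * E | enorm (z.1 - z.2 + (2 * L) *: map_mx intr k) < cst r z]).
  apply: countType_bigcup_measurable => k _; apply: measurable_ltr_set => //.
  by apply: (measurableT_comp measurable_enorm); exact: measurable_rVD.
apply/seteqP; split => z /=; rewrite in_itv/=.
  by move=> /torus_ddist_lt[k hk]; exists k.
by move=> [k _ hk]; apply: le_lt_trans hk; exact: torus_ddist_le.
Qed.

Section carriers.
Variable D : domain R d.
Hypothesis hD : admissible D.

Lemma measurable_carrier : measurable (carrier D).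
Proof.
case: D hD => [_|Om [oOm _ _ _ _]|L _] /=; [exact: measurableT|exact: open_measurable_rV|].
rewrite [X in measurable X](_ : _ = box (const_mx (- L)) (const_mx L)).
  exact: measurable_box.
by apply/seteqP; split => x /= h; [apply/in_box => i|move=> i]; first [move/in_box: h => /(_ i)|have := h i]; rewrite ?mxE.
Qed.

(** Boxes open below and closed above serve the three kinds of domain at once: the cell [(-L, L]] is
    not open, yet it contains such a box ending at each of its points. *)
Lemma carrier_box (x : E) : carrier D x -> exists2 r : R, 0 < r &
  box (x - const_mx r) x `<=` carrier D.
Proof.
case: D hD => [_ _|Om [oOm _ _ _ _] /= Ox|L L0 /= xL]; first by exists 1.
- have : nbhs x Om by exact: open_nbhs_nbhs.
  move=> /nbhs_ballP[e /= e0 xeU]; exists (e / 2); first by rewrite divr_gt0.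
  move=> y /in_box hy; apply: xeU; rewrite mx_norm_ball /ball_/=.
  apply: (@le_lt_trans _ _ (e / 2)); last by lra.
  apply: norm_le_coord => i; have := hy i; rewrite !mxE ler_norml => /andP[? ?].
  by apply/andP; split; lra.
(* The room below [x] inside the cell is limited by its smallest coordinate. *)
- have [i0 _ /= hm] := @arg_minP _ _ _ ord0 xpredT (fun i : 'I_d.+1 => x ord0 i) isT.
  exists (x ord0 i0 + L); first by have /andP[] := xL i0; lra.
  move=> y /in_box hy i; have := hy i; rewrite !mxE => /andP[h1 h2]; have /andP[h3 h4] := xL i.
  by have := hm i isT => ?; apply/andP; split; lra.
Qed.

Lemma lebesgue_half_open_box (x : E) (r : R) : 0 < r ->
  lebesgue_rV R d.+1 (box (x - const_mx r) x) =
  (r ^+ d.+1)%:E.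
Proof.
move=> r0; rewrite (@lebesgue_rV_box R _ (fun i => `](x - const_mx r) ord0 i, x ord0 i]%classic)) => [|i];
  last exact: measurable_itv.
rewrite (eq_bigr (fun=> r%:E)) => [|i _].
  by rewrite prodEFin big_const_ord iter_mulr_1.
by rewrite lebesgue_measure_itv/= lte_fin !mxE ltrBlDr ltrDl r0 -EFinB opprB addrC subrK.
Qed.

Lemma carrier_countable_dense : carrier D !=set0 -> exists q : nat -> E,
  (forall n, carrier D (q n)) /\
  (forall x e, carrier D x -> 0 < e -> exists n, `|x - q n| < e).
Proof.
move=> [x0 Dx0].
pose emb (v : 'rV[rat]_d.+1) : E := map_mx ratr v.
have near_rat (x : E) (e : R) : carrier D x -> 0 < e ->
    exists v, carrier D (emb v) /\ `|x - emb v| < e.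
  move=> Dx e0; have [r r0 hr] := carrier_box Dx.
  have re0 : 0 < Num.min r (e / 2) by rewrite lt_min r0 divr_gt0.
  have H i : exists q : rat, x ord0 i - Num.min r (e / 2) < ratr q < x ord0 i.
    have [q] := @rat_in_itvoo R (x ord0 i - Num.min r (e / 2)) (x ord0 i) ltac:(by rewrite ltrBlDr ltrDl).
    by rewrite in_itv/=; exists q.
  have [q hq] := choice H.
  have h1 : Num.min r (e / 2) <= r by rewrite ge_min lexx.
  have h2 : Num.min r (e / 2) <= e / 2 by rewrite ge_min lexx orbT.
  exists (\row_i q i); split.
    apply: hr; apply/in_box => i; rewrite !mxE; have /andP[? ?] := hq i.
    by apply/andP; split; lra.
  apply: (@le_lt_trans _ _ (e / 2)); last by lra.
  apply: norm_le_coord => i; rewrite !mxE; have /andP[? ?] := hq i.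
  by rewrite ler_norml; apply/andP; split; lra.
have [v0 [Dv0 _]] := near_rat x0 1 Dx0 ltr01.
pose q n : E := if unpickle n is Some v then
  (if `[< carrier D (emb v) >] then emb v else emb v0) else emb v0.
exists q; split.
  by move=> n; rewrite /q; case: unpickle => // v; case: asboolP.
move=> x e Dx e0; have [v [Dv hv]] := near_rat x e Dx e0.
by exists (pickle v); rewrite /q pickleK; case: asboolP.
Qed.

End carriers.
End measurability.

Lemma ex_image_probability d1 d2 (X : measurableType d1) (Y : measurableType d2)
    (R : realType) (P : probability X R) (f : X -> Y) :
  measurable_fun setT f -> exists Q : probability Y R,
  (forall A, Q A = P (f @^-1` A)) /\
  (forall g : Y -> \bar R, measurable_fun setT g -> (forall y, (0 <= g y)%E) ->
     (\int[Q]_y g y = \int[P]_x g (f x))%E).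
Proof.
move=> mf; pose f' : {mfun X >-> Y} := HB.pack f (isMeasurableFun.Build _ _ _ _ _ mf).
exists (distribution P f'); split => // g mg g0.
exact: (@ge0_integral_distribution _ _ _ _ _ P f' g mg g0).
Qed.

(** * The Wasserstein distance *)

Section Lp_norm_of_nonnegative_functions.
Context d (X : measurableType d) (R : realType).
Variables (m : {measure set X -> \bar R}) (p : R).
Hypothesis p1 : 1 <= p.

(** On nonnegative functions this is the L^p norm, written in the shape of the cost in [Wp] so that
    Minkowski's inequality applies to transport costs. *)
Definition Lpn (f : X -> R) : \bar R := ((\int[m]_z (f z `^ p)%:E) `^ p^-1)%E.

Let p0 : 0 < p. Proof. exact: lt_le_trans p1. Qed.

Lemma LpnE (f : X -> R) : (forall z, 0 <= f z) -> Lpn f = ('N[m]_p%:E[EFin \o f])%E.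
Proof.
move=> f0; rewrite unlock /Lpn; congr (_ `^ _)%E; apply: eq_integral => z _ /=.
by rewrite /= ger0_norm.
Qed.

Lemma measurable_powR_EFin (f : X -> R) : measurable_fun setT f ->
  measurable_fun setT (fun z => (f z `^ p)%:E).
Proof.
by move=> mf; apply/measurable_EFinP; exact: (measurableT_comp (measurable_powR p) mf).
Qed.

Lemma Lpn_congr (f g : X -> R) : (forall z, f z = g z) -> Lpn f = Lpn g.
Proof. by move=> /funext->. Qed.

Lemma LpnD (f g : X -> R) : measurable_fun setT f -> measurable_fun setT g ->
  (forall z, 0 <= f z) -> (forall z, 0 <= g z) ->
  (Lpn (fun z => f z + g z)%R <= Lpn f + Lpn g)%E.
Proof.
move=> mf mg f0 g0; rewrite !LpnE//; last by move=> z; rewrite addr_ge0.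
exact: (@minkowski_EFin _ _ _ m f g p).
Qed.

Lemma poweR_le (x y : \bar R) (r : R) : 0 <= r -> (0 <= x)%E -> (x <= y)%E ->
  (x `^ r <= y `^ r)%E.
Proof.
move=> r0 x0 xy; have y0 := le_trans x0 xy.
by apply: gt0_ler_poweR => //; rewrite in_itv/= ?leey ?andbT.
Qed.

Lemma Lpn_int_ge0 (f : X -> R) : (0 <= \int[m]_z (f z `^ p)%:E)%E.
Proof. by apply: integral_ge0 => z _; rewrite lee_fin powR_ge0. Qed.

Lemma Lpn_le (f g : X -> R) : measurable_fun setT f -> measurable_fun setT g ->
  (forall z, 0 <= f z) -> {ae m, forall z, f z <= g z} -> (Lpn f <= Lpn g)%E.
Proof.
move=> mf mg f0 fg; apply: poweR_le; rewrite ?invr_ge0 ?(ltW p0)//.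
  exact: Lpn_int_ge0.
apply: ae_ge0_le_integral => //; try by (move=> z _; rewrite lee_fin powR_ge0).
- exact: measurable_powR_EFin.
- exact: measurable_powR_EFin.
apply: filterS fg => z fgz _; rewrite lee_fin ge0_ler_powR ?(ltW p0)// nnegrE//.
exact: le_trans fgz.
Qed.

Lemma Lpn_cst (c : R) : 0 <= c -> m setT = 1%E -> Lpn (cst c) = c%:E.
Proof.
move=> c0 m1; rewrite /Lpn /cst/= integral_cst// m1 mule1 poweR_EFin -powRrM.
by rewrite divff ?gt_eqF// powRr1.
Qed.

End Lp_norm_of_nonnegative_functions.

Lemma Lpn_image d1 d2 (X : measurableType d1) (Y : measurableType d2) (R : realType)
    (P : {measure set X -> \bar R}) (Q : {measure set Y -> \bar R}) (phi : X -> Y) :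
  (forall g : Y -> \bar R, measurable_fun setT g -> (forall y, (0 <= g y)%E) ->
     (\int[Q]_y g y = \int[P]_x g (phi x))%E) ->
  forall (p : R) (f : Y -> R), measurable_fun setT f ->
    Lpn Q p f = Lpn P p (fun x => f (phi x)).
Proof.
move=> QP p f mf; rewrite /Lpn QP//; last by move=> z; rewrite lee_fin powR_ge0.
exact: measurable_powR_EFin.
Qed.

Lemma Lpn_measure d1 (X : measurableType d1) (R : realType)
    (P Q : {measure set X -> \bar R}) (p : R) (f : X -> R) :
  (forall A, measurable A -> P A = Q A) -> Lpn P p f = Lpn Q p f.
Proof. by move=> PQ; rewrite /Lpn (eq_measure_integral Q)// => A mA _; exact: PQ. Qed.

Section wasserstein.
Context {R : realType} {d : nat}.
Local Notation E := 'rV[R]_d.+1.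
Local Notation P := (probability E R).
Variables (D : domain R d) (p : R).
Hypothesis p1 : 1 <= p.

Let p0 : 0 < p. Proof. exact: lt_le_trans p1. Qed.
Let dd (z : E * E) : R := ddist D z.1 z.2.

Let dd0 z : 0 <= dd z. Proof. exact: ddist_ge0. Qed.
Let mdd : measurable_fun setT dd. Proof. exact: measurable_ddist. Qed.

Lemma Wp_ge0 (mu nu : P) : (0 <= Wp D p mu nu)%E.
Proof. exact: poweR_ge0. Qed.

Lemma Wp_le_coupling (mu nu : P) (pi : probability (E * E)%type R) :
  coupling mu nu pi -> (Wp D p mu nu <= Lpn pi p dd)%E.
Proof.
move=> cpi; apply: poweR_le; rewrite ?invr_ge0 ?(ltW p0)//.
  by apply: le_ereal_inf_tmp => _ [pi' _ <-]; exact: (Lpn_int_ge0 pi' p dd).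
by apply: ereal_inf_lbound; exists pi.
Qed.

Lemma Wp_coupling (mu nu : P) (e : R) : (Wp D p mu nu < +oo)%E -> 0 < e ->
  exists2 pi : probability (E * E)%type R, coupling mu nu pi &
    (Lpn pi p dd <= Wp D p mu nu + e%:E)%E.
Proof.
move=> Wfin e0; have W0 := Wp_ge0 mu nu.
set I := ereal_inf [set \int[pi]_z (ddist D z.1 z.2 `^ p)%:E | pi in coupling mu nu]%E.
have I0 : (0 <= I)%E.
  by apply: le_ereal_inf_tmp => _ [pi' _ <-]; exact: (Lpn_int_ge0 pi' p dd).
have IW : I = (Wp D p mu nu `^ p)%E.
  by rewrite /Wp -/I -poweRrM mulVf ?gt_eqF// poweRe1.
have Wf : Wp D p mu nu \is a fin_num by rewrite ge0_fin_numE.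
have : (I < ((fine (Wp D p mu nu) + e) `^ p)%:E)%E.
  rewrite IW -{1}(fineK Wf) poweR_EFin lte_fin gt0_ltr_powR// ?nnegrE ?ltrDl//.
    by rewrite fine_ge0.
  by rewrite addr_ge0 ?fine_ge0// ltW.
move=> /ereal_inf_lt[_ [pi cpi <-] hpi]; exists pi => //.
apply: (@le_trans _ _ ((((fine (Wp D p mu nu) + e) `^ p)%:E) `^ p^-1)%E).
  apply: poweR_le; rewrite ?invr_ge0 ?(ltW p0)//; last exact: ltW.
  exact: (Lpn_int_ge0 pi p dd).
rewrite poweR_EFin -powRrM divff ?gt_eqF// powRr1 ?addr_ge0 ?fine_ge0 ?(ltW e0)//.
by rewrite EFinD fineK.
Qed.

Lemma Wpxx (mu : P) : Wp D p mu mu = 0%E.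
Proof.
apply/eqP; rewrite eq_le Wp_ge0 andbT.
have mdiag : measurable_fun setT (fun x : E => (x, x)).
  by apply/measurable_fun_pairP; split; exact: measurable_id.
have [Q [QE Qint]] := ex_image_probability mu mdiag.
apply: (@le_trans _ _ (Lpn Q p dd)).
  apply: Wp_le_coupling => A mA; rewrite !QE; split; congr (mu _); apply/seteqP; split => x /=; tauto.
rewrite /Lpn Qint; last by move=> z; rewrite lee_fin powR_ge0.
  rewrite integral0_eq ?poweR0r ?invr_eq0 ?gt_eqF// => x _.
  by rewrite /dd/= ddistxx powR0 ?gt_eqF.
exact: measurable_powR_EFin.
Qed.

Lemma Wp_sym_le (mu nu : P) : (Wp D p mu nu <= Wp D p nu mu)%E.
Proof.
have [->|] := eqVneq (Wp D p nu mu) +oo%E; first exact: leey.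
rewrite -ltey => fin; apply/lee_addgt0Pr => e e0.
have [pi cpi hpi] := Wp_coupling fin e0; apply: le_trans hpi.
have mswap : measurable_fun setT (fun z : E * E => (z.2, z.1)).
  by apply/measurable_fun_pairP; split; [exact: measurable_snd|exact: measurable_fst].
have [Q [QE Qint]] := ex_image_probability pi mswap.
apply: (@le_trans _ _ (Lpn Q p dd)).
  apply: Wp_le_coupling => A mA; rewrite !QE; have [h1 h2] := cpi _ mA.
  rewrite -h1 -h2; split; congr (pi _); apply/seteqP; split => -[x y] /=; tauto.
rewrite (Lpn_image Qint p mdd).
have H : forall z : E * E, dd (z.2, z.1) = dd z by move=> z; exact: ddistC.
by rewrite (Lpn_congr pi p H).
Qed.

Lemma WpC (mu nu : P) : Wp D p mu nu = Wp D p nu mu.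
Proof. by apply/eqP; rewrite eq_le !Wp_sym_le. Qed.

(* Approximate gluing: the kernels of the two plans are only matched up to a
   partition of the middle space into cells of diameter at most [r], which
   replaces disintegration by a countable sum of product measures. *)
Section gluing.
Variables (mu1 mu2 mu3 : P) (pi rho : probability (E * E)%type R) (r : R).
Hypothesis cpi : coupling mu1 mu2 pi.
Hypothesis crho : coupling mu2 mu3 rho.
Hypothesis r0 : 0 < r.

Let cell (x : E) : 'rV[int]_d.+1 := \row_i Num.floor (x ord0 i / r).
Let Q (k : nat) : set E := [set x | pickle (cell x) = k].

Let mQ k : measurable (Q k).
Proof.
rewrite [X in measurable X](_ : _ = \bigcup_(v in [set v : 'rV[int]_d.+1 | pickle v = k])
   [set x : E | forall i, [set s : R | Num.floor (s / r) = v ord0 i] (x ord0 i)]).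
  apply: countType_bigcup_measurable => v _.
  apply: (@measurable_rV_box R _ (fun i => [set s : R | Num.floor (s / r) = v ord0 i])) => i.
  rewrite [X in measurable X](_ : _ = `[r * (v ord0 i)%:~R, r * (v ord0 i + 1)%:~R[%classic).
    exact: measurable_itv.
  apply/seteqP; split => s /=; rewrite in_itv/=.
    move=> <-; rewrite ![r * _]mulrC -ler_pdivlMr// -ltr_pdivrMr//.
    by rewrite floor_le_tmp floorD1_gt.
  rewrite ![r * _]mulrC -ler_pdivlMr// -ltr_pdivrMr// => h.
  exact/floor_def.
apply/seteqP; split => x /= => [xk|[v vk hv]].
  by exists (cell x) => // i; rewrite mxE.
rewrite /Q/= -vk; congr pickle; apply/rowP => i; rewrite mxE; exact: hv.
Qed.

Let Q_close k x y : Q k x -> Q k y -> enorm (x - y) <= d.+1%:R * r.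
Proof.
move=> Qx Qy; apply: le_trans (enorm_le_norm _) _; rewrite ler_wpM2l//.
apply: norm_le_coord => i; rewrite !mxE.
have : cell x = cell y by apply: (pcan_inj pickleK); rewrite Qx Qy.
move=> /rowP/(_ i); rewrite !mxE => xy.
have hx := floor_itv (x ord0 i / r); have hy := floor_itv (y ord0 i / r).
move: hx hy; rewrite xy intrD => /andP[a b] /andP[a' b'].
have : `|x ord0 i / r - y ord0 i / r| <= 1.
  by rewrite ler_norml; apply/andP; split; lra.
by rewrite -mulrBl normrM normfV (gtr0_norm r0) ler_pdivrMr// mul1r.
Qed.

Let trivQ : trivIset setT Q.
Proof. apply/trivIsetP => i j _ _ ij; apply/seteqP; split => // x [h1 h2].
by move: ij; rewrite -(h1 : pickle (cell x) = i) -(h2 : pickle (cell x) = j) eqxx. Qed.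

Let coverQ : \bigcup_k Q k = setT.
Proof. by apply/seteqP; split => // x _; exists (pickle (cell x)). Qed.

Let U k : set (E * E) := setT `*` Q k.
Let V k : set (E * E) := Q k `*` setT.
Let mU k : measurable (U k). Proof. by apply: measurableX. Qed.
Let mV k : measurable (V k). Proof. by apply: measurableX. Qed.

Let piU k : pi (U k) = mu2 (Q k). Proof. by case: (cpi (mQ k)). Qed.
Let rhoV k : rho (V k) = mu2 (Q k). Proof. by case: (crho (mQ k)). Qed.

Let wt_ge0 k : 0 <= (fine (mu2 (Q k)))^-1 :> R.
Proof. by rewrite invr_ge0 fine_ge0. Qed.
(** Normalises the mass of cell [k]. On a null cell it is [0^-1 = 0], and neither plan charges that
    cell. *)
Let wt k : {nonneg R} := NngNum (wt_ge0 k).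

Let pr k := (mrestr pi (mU k) \x mrestr rho (mV k))%E.
(** The middle point is doubled: once its cell is drawn, the first pair follows [pi] and the second
    pair follows [rho], independently within the cell. *)
Definition glue := mseries (fun k => [the {measure set _ -> \bar R} of mscale (wt k) [the {measure set _ -> \bar R} of pr k]]) 0.
HB.instance Definition _ := Measure.on glue.

Let glue_box A B : measurable A -> measurable B ->
  glue (A `*` B) = (\sum_(k <oo) (wt k)%:num%:E * (pi (A `&` U k) * rho (B `&` V k)))%E.
Proof.
move=> mA mB; rewrite /glue /mseries; apply: eq_eseriesr => k _.
transitivity ((wt k)%:num%:E * (mrestr pi (mU k) \x mrestr rho (mV k)) (A `*` B))%E => //.
by rewrite product_measure1E.
Qed.

Lemma glueT1 A : measurable A -> glue (A `*` setT) = pi A.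
Proof.
move=> mA; rewrite glue_box//.
transitivity (\sum_(k <oo) pi (A `&` U k))%E.
  apply: eq_eseriesr => k _; rewrite setTI rhoV.
  have [z|nz] := eqVneq (mu2 (Q k)) 0%E.
    rewrite z mule0 mule0; apply/esym/eqP; rewrite eq_le measure_ge0 andbT -z -piU.
    by apply: le_measure; rewrite ?inE; [exact: measurableI|exact: mU|exact: subIsetr].
  have fm : mu2 (Q k) \is a fin_num by exact: fin_num_measure.
  by rewrite muleCA -(fineK fm) -EFinM/= mulVf ?mule1// fine_eq0.
rewrite [in RHS](_ : A = \bigcup_k (A `&` U k)); last first.
  by rewrite -setI_bigcupr /U -setX_bigcupr coverQ setXTT setIT.
rewrite measure_bigcup//=.
- by apply: eq_eseriesl => k; rewrite in_setT.
- by move=> k _; exact: measurableI.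
- apply/trivIsetP => i j _ _ ij; rewrite setIACA -setXI.
  by move/trivIsetP : trivQ => /(_ _ _ I I ij) ->; rewrite setX0 setI0.
Qed.

Lemma glueT2 B : measurable B -> glue (setT `*` B) = rho B.
Proof.
move=> mB; rewrite glue_box//.
transitivity (\sum_(k <oo) rho (B `&` V k))%E.
  apply: eq_eseriesr => k _; rewrite setTI piU.
  have [z|nz] := eqVneq (mu2 (Q k)) 0%E.
    rewrite z mul0e mule0; apply/esym/eqP; rewrite eq_le measure_ge0 andbT -z -rhoV.
    by apply: le_measure; rewrite ?inE; [exact: measurableI|exact: mV|exact: subIsetr].
  have fm : mu2 (Q k) \is a fin_num by exact: fin_num_measure.
  by rewrite muleA -(fineK fm) -EFinM/= mulVf ?mul1e// fine_eq0.
rewrite [in RHS](_ : B = \bigcup_k (B `&` V k)); last first.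
  by rewrite -setI_bigcupr /V -setX_bigcupl coverQ setXTT setIT.
rewrite measure_bigcup//=.
- by apply: eq_eseriesl => k; rewrite in_setT.
- by move=> k _; exact: measurableI.
- apply/trivIsetP => i j _ _ ij; rewrite setIACA -setXI.
  by move/trivIsetP : trivQ => /(_ _ _ I I ij) ->; rewrite set0X setI0.
Qed.

Lemma glueT : glue setT = 1%E.
Proof. by rewrite -setXTT glueT1// probability_setT. Qed.

HB.instance Definition _ := Measure_isProbability.Build _ _ _ glue glueT.

(** Each term of the series is carried by the quadruples whose two middle points lie in one and the
    same cell. *)
Lemma glue_close : {ae glue, forall w, ddist D w.1.2 w.2.1 <= d.+1%:R * r}.
Proof.
pose N := \bigcap_k ~` (U k `*` V k).
exists N; split.
- by apply: bigcap_measurable => // k _; apply: measurableC; apply: measurableX.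
- rewrite /= /glue /mseries eseries0// => k _ _.
  rewrite /= /mscale/=; apply/eqP; rewrite mule_eq0; apply/orP; right.
  have mW : measurable (U k `*` V k) by exact: measurableX.
  have mN : measurable N.
    by apply: bigcap_measurable => // j _; apply: measurableC; apply: measurableX.
  have prU : pr k setT = pr k (U k `*` V k).
    rewrite -setXTT /pr !product_measure1E//.
    by rewrite /= /mrestr !setTI !setIid.
  have fW : pr k (U k `*` V k) \is a fin_num.
    rewrite /pr product_measure1E//= /mrestr !setIid fin_numM// fin_num_measure//.
  have : (pr k (U k `*` V k) + pr k N <= pr k (U k `*` V k))%E.
    rewrite -measureU//; last first.
      by apply/seteqP; split => // z [UV /(_ k I)].
    by rewrite -[leRHS]prU; apply: le_measure; rewrite ?inE//; exact: measurableU.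
  rewrite -leeBrDl// subee// => h.
  by rewrite eq_le h measure_ge0.
move=> w /= nw k _ [[_ hU] [hV _]]; apply: nw.
by apply: le_trans (ddist_le _ _ _) _; exact: Q_close hU hV.
Qed.

(** The triangle inequality is taken through both copies of the middle point, then Minkowski's
    inequality; the marginals of [glue] turn the outer terms into the costs of [pi] and [rho]. *)
Lemma glue_cost : (Wp D p mu1 mu3 <= Lpn pi p dd + (d.+1%:R * r)%:E + Lpn rho p dd)%E.
Proof.
have mw : measurable_fun setT (fun w : (E * E) * (E * E) => (w.1.1, w.2.2)).
  apply/measurable_fun_pairP; split.
    exact: (measurableT_comp measurable_fst measurable_fst).
  exact: (measurableT_comp measurable_snd measurable_snd).
have [S [SE Sint]] := @ex_image_probability _ _ _ _ R glue _ mw.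
apply: (@le_trans _ _ (Lpn S p dd)).
  apply: Wp_le_coupling => A mA; rewrite !SE; split.
    rewrite (_ : _ @^-1` _ = (A `*` setT) `*` setT); last first.
      by apply/seteqP; split => -[[a b] [c e]] /=; tauto.
    by rewrite -(cpi mA).1; exact: (glueT1 (measurableX mA measurableT)).
  rewrite (_ : _ @^-1` _ = setT `*` (setT `*` A)); last first.
    by apply/seteqP; split => -[[a b] [c e]] /=; tauto.
  by rewrite -(crho mA).2; exact: (glueT2 (measurableX measurableT mA)).
have m1 : measurable_fun setT (fun w : (E * E) * (E * E) => dd w.1).
  exact: (measurableT_comp mdd measurable_fst).
have m2 : measurable_fun setT (fun w : (E * E) * (E * E) => dd w.2).
  exact: (measurableT_comp mdd measurable_snd).
have mfst : measurable_fun setT (fun w : (E * E) * (E * E) => w.1) by exact: measurable_fst.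
have msnd : measurable_fun setT (fun w : (E * E) * (E * E) => w.2) by exact: measurable_snd.
have rr0 : 0 <= d.+1%:R * r by rewrite mulr_ge0// ltW.
rewrite (Lpn_image Sint p mdd).
apply: (@le_trans _ _ (Lpn glue p (fun w => dd w.1 + d.+1%:R * r + dd w.2))).
  apply: Lpn_le => //.
  - exact: (measurableT_comp mdd mw).
  - by apply: measurable_funD => //; exact: measurable_funD.
  apply: filterS glue_close => w hw; rewrite /dd/=.
  apply: le_trans (ddist_triangle D w.1.2 _ _) _; rewrite -addrA lerD2l.
  by apply: le_trans (ddist_triangle D w.2.1 _ _) _; rewrite lerD2r.
apply: le_trans (LpnD _ p1 _ _ _ _) _ => //.
  - exact: measurable_funD.
  - by move=> w; rewrite addr_ge0.
apply: leeD.
  apply: le_trans (LpnD _ p1 _ _ _ _) _ => //.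
  rewrite Lpn_cst//; last exact: glueT.
  have [S1 [S1E S1int]] := @ex_image_probability _ _ _ _ R glue _ mfst.
  rewrite leeD2r// -(Lpn_image S1int p mdd) (@Lpn_measure _ _ _ _ pi)// => A mA.
  transitivity (glue (A `*` setT)); last exact: glueT1.
  have -> : A `*` setT = (fun w : (E * E) * (E * E) => w.1) @^-1` A.
    by apply/seteqP; split => -[a b] /=; tauto.
  exact: S1E.
have [S1 [S1E S1int]] := @ex_image_probability _ _ _ _ R glue _ msnd.
rewrite -(Lpn_image S1int p mdd) (@Lpn_measure _ _ _ _ rho)// => A mA.
transitivity (glue (setT `*` A)); last exact: glueT2.
have -> : setT `*` A = (fun w : (E * E) * (E * E) => w.2) @^-1` A.
  by apply/seteqP; split => -[a b] /=; tauto.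
exact: S1E.
Qed.

End gluing.

Lemma Wp_triangle (mu2 mu1 mu3 : P) :
  (Wp D p mu1 mu3 <= Wp D p mu1 mu2 + Wp D p mu2 mu3)%E.
Proof.
have [->|] := eqVneq (Wp D p mu1 mu2) +oo%E; first by rewrite addye ?leey// gt_eqF// (lt_le_trans _ (Wp_ge0 _ _)).
rewrite -ltey => f12.
have [->|] := eqVneq (Wp D p mu2 mu3) +oo%E; first by rewrite addey ?leey// gt_eqF// (lt_le_trans _ (Wp_ge0 _ _)).
rewrite -ltey => f23; apply/lee_addgt0Pr => e e0.
have e30 : 0 < e / 3 by rewrite divr_gt0.
have [pi cpi hpi] := Wp_coupling f12 e30.
have [rho crho hrho] := Wp_coupling f23 e30.
(* With this mesh the two copies of the middle point are at most [e / 3] apart; the two nearly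
   optimal plans use up the other two thirds. *)
have r0 : 0 < e / 3 / d.+1%:R by rewrite divr_gt0.
apply: le_trans (glue_cost cpi crho r0) _.
rewrite mulrC divfK//.
apply: (@le_trans _ _ (Wp D p mu1 mu2 + (e / 3)%:E + (e / 3)%:E + (Wp D p mu2 mu3 + (e / 3)%:E))%E).
  by rewrite leeD// leeD2r.
rewrite (_ : e%:E = ((e / 3)%:E + (e / 3)%:E + (e / 3)%:E)%E); last first.
  by rewrite -!EFinD; congr EFin; lra.
by rewrite addeACA -!addeA; rewrite (addeCA (e / 3)%:E (Wp D p mu2 mu3)).
Qed.

End wasserstein.

(** * Mollification *)

(** A quadratic remainder near the point is the form of differentiability used for affine maps, with
    [C = 0], and for the functions [flat P] at [0]. *)
Lemma is_derive_quadratic (R : realType) (V : normedModType R) (f : V -> R)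
    (x v : V) (l C : R) :
  (forall h : R, `|h| <= 1 -> `|f (h *: v + x) - f x - h * l| <= C * h ^+ 2) ->
  is_derive x v f l.
Proof.
move=> fC; have C0 : 0 <= C.
  by have := fC 1; rewrite normr1 expr1n mulr1 => /(_ (lexx _)); apply: le_trans.
have key : (fun h : R => h^-1 *: ((f \o shift x) (h *: v) - f x)) @ 0^' --> l.
  apply/cvgrPdist_le => e e0; near=> h.
  have h0 : h != 0 by near: h; exact: nbhs_dnbhs_neq.
  have h1 : `|h| <= Num.min 1 (e / (C + 1)).
    near: h; apply: dnbhs0_le; rewrite lt_min ltr01/= divr_gt0// ltr_wpDl//.
  move: h1; rewrite le_min => /andP[h1 he].
  have -> : l - h^-1 *: ((f \o shift x) (h *: v) - f x) =
      - (h^-1 * (f (h *: v + x) - f x - h * l)).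
    by rewrite /= scalerBr /GRing.scale/= !mulrBr mulKf//; ring.
  rewrite normrN normrM normfV ler_pdivrMl ?normr_gt0//.
  apply: le_trans (fC h h1) _; rewrite -(real_normK (num_real h)) expr2 mulrA mulrC.
  rewrite ler_wpM2l//; move: he; rewrite ler_pdivlMr ?ltr_wpDl//; apply: le_trans.
  by rewrite mulrC ler_wpM2l// lerDl.
apply: DeriveDef; first by apply: cvgP key.
exact: cvg_lim key.
Unshelve. all: by end_near. Qed.

(** * Smooth bump functions of one variable *)

Section smooth_functions_of_one_variable.
Context {R : realType}.
Implicit Types (f g : R -> R) (k : nat).

Fixpoint derivable_upto k f : Prop :=
  if k is k'.+1 then (forall x, derivable f x 1) /\ derivable_upto k' (derive1 f)
  else True.

Definition smooth1 f := forall k, derivable_upto k f.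

Lemma smooth1_derivable f x : smooth1 f -> derivable f x 1.
Proof. by move=> /(_ 1%N)[]. Qed.

Lemma smooth1_derive f : smooth1 f -> smooth1 (derive1 f).
Proof. by move=> sf k; case: (sf k.+1). Qed.

Lemma derivable_upto_pred k f : derivable_upto k.+1 f -> derivable_upto k f.
Proof. by elim: k f => //= k ih f [df h]; split => //; apply: ih. Qed.

Lemma derivable_uptoD k f g :
  derivable_upto k f -> derivable_upto k g -> derivable_upto k (f \+ g).
Proof.
elim: k f g => //= k ih f g [df hf] [dg hg]; split.
  by move=> x; exact: derivableD.
rewrite (_ : (derive1 (f \+ g)) = (derive1 f) \+ (derive1 g)); first exact: ih.
by apply/funext => x /=; rewrite !derive1E deriveD.
Qed.

Lemma derivable_uptoM k f g :
  derivable_upto k f -> derivable_upto k g -> derivable_upto k (f \* g).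
Proof.
elim: k f g => // k ih f g hf hg.
have := derivable_upto_pred hf; have := derivable_upto_pred hg.
case: hf hg => [df hf] [dg hg] hg' hf'; split.
  by move=> x; exact: derivableM.
rewrite (_ : (derive1 (f \* g)) = (f \* (derive1 g)) \+ (g \* (derive1 f))).
  by apply: derivable_uptoD; exact: ih.
by apply/funext => x /=; rewrite !derive1E deriveM.
Qed.

Lemma derivable_upto_cst k (c : R) : derivable_upto k (cst c).
Proof.
elim: k c => //= k ih c; split => [x|]; first exact: derivable_cst.
rewrite (_ : (derive1 (cst c)) = cst 0); first exact: ih.
by apply/funext => x; rewrite derive1_cst.
Qed.

Lemma is_derive_comp_affine f (a b x : R) : derivable f (a * x + b) 1 ->
  is_derive x 1 (fun x : R => f (a * x + b)) (a * (derive1 f) (a * x + b)).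
Proof.
move=> df; have h1 : is_derive (a * x + b) 1 f ((derive1 f) (a * x + b)).
  by rewrite derive1E; exact/derivableP.
have h2 : is_derive x 1 (fun x => a * x + b : R) a.
  apply: (@is_derive_quadratic R R (fun x : R => a * x + b) x 1 a 0) => h _.
  by rewrite [h *: 1]mulr1 mul0r normr_le0; apply/eqP; ring.
by rewrite mulrC; exact: (@is_derive1_comp R f (fun x => a * x + b) x _ _ h1 h2).
Qed.

Lemma derivable_upto_affine k f (a b : R) :
  derivable_upto k f -> derivable_upto k (fun x => f (a * x + b)).
Proof.
elim: k f => //= k ih f [df hf].
have H x := is_derive_comp_affine (df (a * x + b)).
split => [x|]; first exact: ex_derive.
rewrite (_ : (derive1 _) = cst a \* (fun x => (derive1 f) (a * x + b))).
  by apply: derivable_uptoM; [exact: derivable_upto_cst|exact: ih].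
by apply/funext => x; rewrite derive1E derive_val.
Qed.

Lemma smooth1_affine f (a b : R) : smooth1 f -> smooth1 (fun x => f (a * x + b)).
Proof. by move=> sf k; exact: derivable_upto_affine. Qed.

Lemma smooth1M f g : smooth1 f -> smooth1 g -> smooth1 (f \* g).
Proof. by move=> sf sg k; exact: derivable_uptoM. Qed.

(** Polynomials in [1 / s] times [exp(- 1 / s)], extended by [0]: a family that is stable under
    differentiation, from which smoothness follows by induction. *)
Definition flat (P : {poly R}) (s : R) : R :=
  if 0 < s then P.[s^-1] * expR (- s^-1) else 0.

Lemma pow_le_expR (m : nat) (y : R) : (0 < m)%N -> 0 <= y ->
  y ^+ m <= m%:R ^+ m * expR y.
Proof.
move=> m0 y0; have mR : 0 < m%:R :> R by rewrite ltr0n.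
have -> : expR y = expR (y / m%:R) ^+ m.
  by rewrite -expRM_natl mulrC divfK// gt_eqF.
rewrite -exprMn lerXn2r ?nnegrE ?mulr_ge0 ?expR_ge0 ?(ltW mR)//.
rewrite mulrC -ler_pdivrMr//; apply: le_trans (expR_ge1Dx _).
by rewrite lerDr.
Qed.

(** With [y = h^-1 >= 1], the polynomial is at most [S * y ^ size P] in absolute value, and the
    exponential dominates the power [2 + size P]; the two extra powers give [h ^+ 2]. *)
Lemma flat_quadratic (P : {poly R}) : exists C : R,
  forall h : R, `|h| <= 1 -> `|flat P h| <= C * h ^+ 2.
Proof.
set S := \sum_(i < size P) `|P`_i|.
have S0 : 0 <= S by exact: sumr_ge0.
have [c hc] : exists c : R, forall y : R, 0 <= y -> y ^+ (2 + size P) <= c * expR y.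
  by exists ((2 + size P)%:R ^+ (2 + size P)) => y; exact: pow_le_expR.
have c0 : 0 <= c by have := hc 0 (lexx _); rewrite expr0n/= expR0 mulr1.
exists (S * c) => h h1; rewrite /flat; case: ifPn => h0; last first.
  by rewrite normr0; apply: mulr_ge0; [exact: mulr_ge0|exact: sqr_ge0].
have y1 : 1 <= h^-1 by rewrite -invr1 lef_pV2 ?posrE// -(gtr0_norm h0).
have y0 : 0 < h^-1 by rewrite invr_gt0.
rewrite normrM (ger0_norm (expR_ge0 _)) expRN ler_pdivrMr ?expR_gt0//.
apply: (@le_trans _ _ (S * h^-1 ^+ size P)).
  rewrite horner_coef mulr_suml; apply: le_trans (ler_norm_sum _ _ _) _.
  apply: ler_sum => i _; rewrite normrM ler_wpM2l// normrX (gtr0_norm y0).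
  by rewrite ler_weXn2l// ltnW.
set y := h^-1 in y0 *; have -> : h ^+ 2 = (y ^+ 2)^-1 by rewrite /y exprVn invrK.
rewrite -!mulrA; apply: ler_wpM2l => //.
by rewrite mulrCA ler_pdivlMl ?exprn_gt0// -exprD; apply: hc; exact: ltW.
Qed.

(** For [s > 0] the chain rule gives [(P - P')(1 / s) * s^-2 * exp(- 1 / s)], again of the family;
    at [0] the quadratic bound gives the derivative [0]. *)
Lemma is_derive_flat (P : {poly R}) (s : R) :
  is_derive s 1 (flat P) (flat ('X ^+ 2 * (P - P^`())) s).
Proof.
have [s0|s0|->] := ltgtP s 0.
- rewrite {2}/flat ltNge (ltW s0)/=.
  apply: (@near_eq_is_derive R R R (cst 0)) => //.
    near=> t; rewrite /flat ltNge (_ : t <= 0)//=; near: t.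
    by apply: filterS (lt_nbhsl s0) => t /ltW.
- rewrite {2}/flat s0.
  apply: (@near_eq_is_derive R R R (fun s : R => P.[s^-1] * expR (- s^-1))) => //.
    near=> t; rewrite /flat ifT//; near: t; exact: lt_nbhsr.
  have sn0 : s != 0 by rewrite gt_eqF.
  have hV : is_derive s 1 (fun x : R => x^-1) (- s ^- 2 *: 1).
    by apply: is_deriveV.
  have h1 : is_derive s 1 (fun s => P.[s^-1]) (P^`().[s^-1] * (- s ^- 2 *: 1)).
    exact: (@is_derive1_comp R (horner P) (fun x => x^-1) s _ _ (is_derive_poly P s^-1) hV).
  have hN : is_derive s 1 (fun x : R => - x^-1) (- (- s ^- 2 *: 1)).
    exact: is_deriveN.
  have h2 : is_derive s 1 (fun s => expR (- s^-1)) (expR (- s^-1) * (- (- s ^- 2 *: 1))).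
    exact: (@is_derive1_comp R expR (fun x => - x^-1) s _ _ (is_derive_expR _) hN).
  have hM := @is_deriveM R R (fun s => P.[s^-1]) (fun s => expR (- s^-1)) s 1 _ _ h1 h2.
  suff -> : ('X ^+ 2 * (P - P^`())).[s^-1] * expR (- s^-1) =
    P.[s^-1] *: (expR (- s^-1) * - (- s ^- 2)%:A) +
    expR (- s^-1) *: (P^`().[s^-1] * (- s ^- 2)%:A) by exact: hM.
  have E : (- s ^- 2)%:A = - s^-1 ^+ 2 :> R by rewrite exprVn; exact: mulr1.
  rewrite E; transitivity (P.[s^-1] * (expR (- s^-1) * - - s^-1 ^+ 2) +
    expR (- s^-1) * (P^`().[s^-1] * - s^-1 ^+ 2)) => //.
  by rewrite hornerM hornerXn hornerD hornerN; ring.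
- rewrite {2}/flat ltxx; have [C hC] := flat_quadratic P.
  apply: (@is_derive_quadratic _ _ _ _ _ _ C) => h h1.
  have f0 : flat P 0 = 0 by rewrite /flat ltxx.
  by rewrite addr0 f0 subr0 mulr0 subr0 [_ *: _]mulr1; exact: hC.
Unshelve. all: by end_near. Qed.

Lemma smooth1_flat (P : {poly R}) : smooth1 (flat P).
Proof.
move=> k; elim: k P => // k ih P; split => [x|].
  by have := is_derive_flat P x; case.
rewrite (_ : derive1 _ = flat ('X ^+ 2 * (P - P^`()))); first exact: ih.
by apply/funext => x; rewrite derive1E; have := is_derive_flat P x; case.
Qed.

(** Two copies of [exp(- 1 / s)], one vanishing below [- a] and the other above [a]. *)
Definition bump1 (a : R) (r : R) : R := flat 1 (a^-1 * r + 1) * flat 1 (- a^-1 * r + 1).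

Lemma smooth1_bump1 (a : R) : smooth1 (bump1 a).
Proof. by apply: smooth1M; apply: smooth1_affine; exact: smooth1_flat. Qed.

Lemma bump1_ge0 (a r : R) : 0 <= bump1 a r.
Proof.
by rewrite /bump1 /flat; do 2 case: ifP => _; rewrite ?mulr0 ?mul0r// !hornerC !mul1r mulr_ge0 ?expR_ge0.
Qed.

Lemma bump1_supp (a r : R) : 0 < a -> a <= `|r| -> bump1 a r = 0.
Proof.
move=> a0; rewrite /bump1 /flat ler_normr => /orP[h|h].
- rewrite [X in _ * X]ifF ?mulr0//; apply/negbTE; rewrite -leNgt mulNr addrC subr_le0.
  by rewrite mulrC ler_pdivlMr// mul1r.
- rewrite [X in X * _]ifF ?mul0r//; apply/negbTE; rewrite -leNgt -lerBrDr sub0r.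
  by rewrite mulrC ler_pdivrMr// mulN1r lerNr.
Qed.

Lemma bump1_gt0 (a r : R) : 0 < a -> `|r| < a -> 0 < bump1 a r.
Proof.
move=> a0; rewrite ltr_norml => /andP[h1 h2]; rewrite /bump1 /flat !ifT.
- by rewrite !hornerC !mul1r mulr_gt0// expR_gt0.
- by rewrite mulNr addrC subr_gt0 mulrC ltr_pdivrMr// mul1r.
- by rewrite -ltrBlDr sub0r mulrC ltr_pdivlMr// mulN1r.
Qed.

End smooth_functions_of_one_variable.

(** * Boxes as a generating class, and translation invariance of the Lebesgue measure *)

Section measures_on_boxes.
Context {R : realType} {d : nat}.
Local Notation E := 'rV[R]_d.+1.

Lemma boxI (l u l' u' : E) : box l u `&` box l' u' =
  box (\row_i Num.max (l ord0 i) (l' ord0 i)) (\row_i Num.min (u ord0 i) (u' ord0 i)).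
Proof.
apply/seteqP; split => x.
  move=> [/in_box h /in_box h']; apply/in_box => i; rewrite !mxE.
  by have /andP[? ?] := h i; have /andP[? ?] := h' i; rewrite gt_max le_min; apply/andP; split; apply/andP.
move=> /in_box h; split; apply/in_box => i; have := h i; rewrite !mxE gt_max le_min;
  by move=> /andP[/andP[? ?] /andP[? ?]]; apply/andP.
Qed.

Definition boxes : set (set E) := [set A | exists l u, A = box l u].

Lemma cubes_cover : \bigcup_k box (const_mx (- k%:R) : E) (const_mx k%:R) = setT.
Proof.
apply/seteqP; split => // x _; exists (Num.bound (`|x| + 1)) => //.
apply/in_box => i; rewrite !mxE -ltrNl.
have := archi_boundP (_ : 0 <= `|x| + 1); rewrite ?addr_ge0// => /(_ isT) h.
have := coord_le_norm x i; rewrite ler_norml => /andP[? ?]; apply/andP; split; lra.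
Qed.

(** A slab between two values of one coordinate is a countable union of boxes, so boxes generate
    what the coordinates generate. *)
Lemma measurable_boxes : (measurable : set (set E)) = <<s boxes >>.
Proof.
apply/seteqP; split; last first.
  apply: smallest_sub; first exact: sigma_algebra_measurable.
  by move=> _ [l [u ->]]; exact: measurable_box.
apply: smallest_sub; first exact: (@sigma_algebra_measurable _ (g_sigma_algebraType boxes)).
rewrite -bigcup_seq; apply: bigcup_sub => i _ A [B mB <-].
suff mc : measurable_fun (setT : set (g_sigma_algebraType boxes)) (fun x : E => x ord0 i).
  exact: mc.
apply: (measurability (@ocitv R)) => // _ [_ [[a b] _ <-] <-].
rewrite setTI (_ : _ @^-1` _ = \bigcup_k box (\row_j if j == i then a else - k%:R)
    (\row_j if j == i then b else k%:R)).
  by apply: bigcup_measurable => k _; apply: sub_sigma_algebra; eexists; eexists; reflexivity.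
apply/seteqP; split => x /=; rewrite in_itv/=.
  move=> xi; have : setT x by []. rewrite -cubes_cover => -[k _ /in_box xk].
  exists k => //; apply/in_box => j; have := xk j; rewrite !mxE.
  by case: eqP => // ->.
by move=> [k _ /in_box/(_ i)]; rewrite !mxE eqxx.
Qed.

Lemma box_measure_unique (m1 m2 : {measure set E -> \bar R}) :
  (forall l u, m1 (box l u) = m2 (box l u)) ->
  (forall l u, (m1 (box l u) < +oo)%E) ->
  forall A, measurable A -> m1 A = m2 A.
Proof.
move=> m12 m1fin; apply: (@measure_unique _ _ _ boxes
  (fun k => box (const_mx (- k%:R)) (const_mx k%:R))).
- exact: measurable_boxes.
- by move=> _ _ [l [u ->]] [l' [u' ->]]; rewrite boxI; eexists; eexists; reflexivity.
- by move=> k; eexists; eexists; reflexivity.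
- exact: cubes_cover.
- by move=> _ [l [u ->]].
- by move=> k.
Qed.

Lemma lebesgue_boxE (l u : E) : lebesgue_rV R d.+1 (box l u) =
  (\prod_i Num.max 0 (u ord0 i - l ord0 i))%:E.
Proof.
rewrite (@lebesgue_rV_box R _ (fun i => `]l ord0 i, u ord0 i]%classic)) => [|i];
  last exact: measurable_itv.
rewrite -prodEFin; apply: eq_bigr => i _.
rewrite lebesgue_measure_itv/= lte_fin; case: ltP => h.
  by rewrite -EFinB (max_idPr _)// subr_ge0 ltW.
by rewrite (max_idPl _)// subr_le0.
Qed.

Lemma lebesgue_box_lty (l u : E) : (lebesgue_rV R d.+1 (box l u) < +oo)%E.
Proof. by rewrite lebesgue_boxE ltry. Qed.

Lemma ex_image_measure d1 d2 (X : measurableType d1) (Y : measurableType d2)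
    (m : {measure set X -> \bar R}) (f : X -> Y) : measurable_fun setT f ->
  exists Q : {measure set Y -> \bar R}, (forall A, Q A = m (f @^-1` A)) /\
  (forall g : Y -> R, Q.-integrable setT (EFin \o g) -> m.-integrable setT (EFin \o (g \o f)) ->
     (\int[Q]_y g y = \int[m]_x g (f x))).
Proof.
move=> mf; pose Q : {measure set Y -> \bar R} := pushforward m f.
exists (Q mf); split => // g ig im; rewrite /Rintegral; congr fine.
have mg : measurable_fun setT (EFin \o g) by move/integrableP : ig => [].
exact: (integral_pushforward mf mg im measurableT).
Qed.

Lemma lebesgue_translation (x : E) (A : set E) : measurable A ->
  lebesgue_rV R d.+1 ((fun z => z + x) @^-1` A) = lebesgue_rV R d.+1 A.
Proof.
move=> mA; have mt : measurable_fun setT (fun z : E => z + x).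
  by apply: measurable_rVD => //; exact: measurable_id.
have [Q [QE _]] := ex_image_measure (lebesgue_rV R d.+1) mt.
rewrite -QE; apply/esym; apply: box_measure_unique mA => l u; last exact: lebesgue_box_lty.
rewrite QE (_ : _ @^-1` _ = box (l - x) (u - x)).
  etransitivity; first exact: lebesgue_boxE.
  etransitivity; last by apply/esym; exact: lebesgue_boxE.
  congr EFin; apply: eq_bigr => i _; rewrite !mxE.
  by congr Num.max; ring.
by apply/seteqP; split => z /in_box h; apply/in_box => i; have := h i; rewrite !mxE => /andP[? ?];
  apply/andP; split; lra.
Qed.

Lemma bounded_box_integrable (f : E -> R) (B : R) (l u : E) :
  measurable_fun setT f -> (forall x, `|f x| <= B) ->
  (forall x, ~ box l u x -> f x = 0) ->
  (lebesgue_rV R d.+1).-integrable setT (EFin \o f).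
Proof.
move=> mf fB f0.
have mb := measurable_box l u.
have -> : EFin \o f = (EFin \o f) \_ (box l u).
  apply/funext => x; rewrite patchE; case: ifPn => // xb.
  by rewrite /= f0// => /mem_set h; rewrite h in xb.
apply/integrable_restrict => //; rewrite setTI; apply: measurable_bounded_integrable => //.
- exact: lebesgue_box_lty.
- exact: measurable_funTS.
- exists B; split; first exact: num_real.
  by move=> M BM x _; exact: le_trans (fB x) (ltW BM).
Qed.

Lemma Rintegral_translation (g : E -> R) (x : E) :
  (lebesgue_rV R d.+1).-integrable setT (EFin \o g) ->
  (lebesgue_rV R d.+1).-integrable setT (EFin \o (fun z => g (z + x))) ->
  \int[lebesgue_rV R d.+1]_y g y = \int[lebesgue_rV R d.+1]_z g (z + x).
Proof.
move=> ig ig'; have mt : measurable_fun setT (fun z : E => z + x).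
  by apply: measurable_rVD => //; exact: measurable_id.
have [Q [QE Qint]] := ex_image_measure (lebesgue_rV R d.+1) mt.
have QL A : measurable A -> Q A = lebesgue_rV R d.+1 A.
  by move=> mA; etransitivity; [exact: QE|exact: lebesgue_translation].
have iQ : Q.-integrable setT (EFin \o g).
  move/integrableP : ig => [mg fg]; apply/integrableP; split => //.
  by rewrite (eq_measure_integral (lebesgue_rV R d.+1))// => A mA _; exact: QL.
rewrite -(Qint g iQ ig') /Rintegral; congr fine.
by apply: eq_measure_integral => A mA _; rewrite QL.
Qed.

End measures_on_boxes.

(** * Tensor-product kernels and convolution *)

Section kernels.
Context {R : realType} {d : nat}.
Local Notation E := 'rV[R]_d.+1.
Local Notation lebE := (lebesgue_rV R d.+1).
Variable a : R.
Hypothesis a0 : 0 < a.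

Definition bumpy (f : R -> R) := smooth1 f /\ forall r, a < `|r| -> f r = 0.

Lemma bumpy_continuous (f : R -> R) : bumpy f -> continuous f.
Proof.
move=> [sf _] x; apply: differentiable_continuous; apply/derivable1_diffP.
exact: smooth1_derivable.
Qed.

Lemma bumpy_bounded (f : R -> R) : bumpy f -> exists2 B : R, 0 < B & forall r, `|f r| <= B.
Proof.
move=> bf; have cf := bumpy_continuous bf.
have aa : - a <= a by apply: (@le_trans _ _ 0); rewrite ?oppr_le0 ltW.
have cn : {within `[- a, a], continuous (fun r => `|f r|)}.
  apply: continuous_subspaceT => r; apply: continuous_comp; first exact: cf.
  exact: norm_continuous.
have [c _ hc] := EVT_max aa cn.
exists (`|f c| + 1); first by rewrite ltr_wpDl.
move=> r; have [ra|ra] := leP `|r| a.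
  apply: (le_trans (hc r _)); last by rewrite lerDl.
  by rewrite in_itv/= -ler_norml.
by rewrite bf.2// normr0 addr_ge0.
Qed.

(** The sign appears because kernels are evaluated at [y - x] and differentiated in [x]. *)
Definition opp_derive (f : R -> R) (r : R) : R := - derive1 f r.

Lemma bumpy_opp_derive (f : R -> R) : bumpy f -> bumpy (opp_derive f).
Proof.
move=> [sf f0]; split.
  rewrite (_ : opp_derive f = cst (-1) \* derive1 f).
    by apply: smooth1M; [move=> k; exact: derivable_upto_cst|exact: smooth1_derive].
  by apply/funext => r; rewrite /opp_derive/= mulN1r.
move=> r ra; rewrite /opp_derive derive1E.
rewrite (@near_eq_derive R R R f (cst 0) r 1); first by rewrite derive_cst oppr0.
near=> s; apply: f0; near: s.
by have /cvgr_gt := @norm_continuous R R r; apply.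
Unshelve. all: by end_near. Qed.

(** Tensor products are stable under partial derivatives, each of which changes a single factor;
    smoothness in several variables is thereby reduced to one variable. *)
Definition prodf (f : 'I_d.+1 -> R -> R) (x : E) : R := \prod_i f i (x ord0 i).

Variable f : 'I_d.+1 -> R -> R.
Hypothesis bf : forall i, bumpy (f i).

Lemma prodf_supp (x : E) : a < `|x| -> prodf f x = 0.
Proof.
move=> ax; have [i hi] : exists i, a < `|x ord0 i|.
  apply/not_existsP => h; move: ax; rewrite ltNge => /negP; apply.
  by apply: norm_le_coord => i; rewrite leNgt; apply/negP; exact: h.
by rewrite /prodf (bigD1 i)//= (bf i).2// mul0r.
Qed.

Lemma prodf_bounded : exists2 B : R, 0 < B & forall x, `|prodf f x| <= B.
Proof.
have /choice[B hB] : forall i, exists B : R, 0 < B /\ forall r, `|f i r| <= B.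
  by move=> i; have [B B0 hB] := bumpy_bounded (bf i); exists B.
exists (\prod_i B i); first by apply: prodr_gt0 => i _; case: (hB i).
move=> x; rewrite normr_prod; apply: ler_prod => i _; rewrite normr_ge0/=.
by case: (hB i).
Qed.

Lemma measurable_prodf : measurable_fun setT (prodf f).
Proof.
rewrite /prodf; apply: measurable_prod => i _.
exact: (measurableT_comp (continuous_measurable_fun (bumpy_continuous (bf i))) (measurable_coord i)).
Qed.

Definition dkernel (i j : 'I_d.+1) : R -> R := if j == i then opp_derive (f j) else f j.

Lemma bumpy_dkernel i j : bumpy (dkernel i j).
Proof. by rewrite /dkernel; case: ifP => _ //; exact: bumpy_opp_derive. Qed.

Lemma prodf_is_derive (i : 'I_d.+1) (x y : E) (r : R) :
  is_derive r 1 (fun r : R => prodf f (y - (r *: delta_mx ord0 i + x)))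
    (prodf (dkernel i) (y - (r *: delta_mx ord0 i + x))).
Proof.
pose c := \prod_(j < d.+1 | j != i) f j (y ord0 j - x ord0 j).
have E1 s : prodf f (y - (s *: delta_mx ord0 i + x)) =
    c * f i (-1 * s + (y ord0 i - x ord0 i)).
  rewrite /prodf (bigD1 i)//= mulrC; congr (_ * f i _); last first.
    by rewrite !mxE !eqxx/= mulr1; ring.
  by apply: eq_bigr => j ji; rewrite !mxE (negbTE ji) andbF mulr0 add0r.
have E2 : prodf (dkernel i) (y - (r *: delta_mx ord0 i + x)) =
    c * (-1 * derive1 (f i) (-1 * r + (y ord0 i - x ord0 i))).
  rewrite /prodf (bigD1 i)//= mulrC /dkernel eqxx; congr (_ * _); last first.
    by rewrite /opp_derive mulN1r; congr (- derive1 _ _); rewrite !mxE !eqxx/= mulr1; ring.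
  apply: eq_bigr => j ji; rewrite (negbTE ji).
  by rewrite !mxE (negbTE ji) andbF mulr0 add0r.
rewrite (_ : (fun r => _) = c \*: (fun s : R => f i (-1 * s + (y ord0 i - x ord0 i)))).
  rewrite E2; apply: is_deriveZ; apply: is_derive_comp_affine.
  exact: smooth1_derivable (bf i).1.
by apply/funext => s; rewrite E1.
Qed.

End kernels.

Section convolution.
Context {R : realType} {d : nat}.
Local Notation E := 'rV[R]_d.+1.
Local Notation lebE := (lebesgue_rV R d.+1).
Variable a : R.
Hypothesis a0 : 0 < a.
Variables (u : E -> R) (Bu L : R).
Hypothesis uB : forall x, `|u x| <= Bu.
Hypothesis uL : forall x y, `|u x - u y| <= L * `|x - y|.

Let mu : measurable_fun setT u. Proof. exact: lipschitz_measurable_rV uL. Qed.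

Lemma integrable_near (k : E -> R) (B r : R) (x : E) : measurable_fun setT k ->
  (forall z, `|k z| <= B) -> (forall z, r < `|z - x| -> k z = 0) ->
  lebE.-integrable setT (EFin \o k).
Proof.
move=> mk kB k0; apply: (@bounded_box_integrable _ _ _ B (x - const_mx (r + 1)) (x + const_mx (r + 1))) => // z zb.
apply: k0; rewrite ltNge; apply/negP => zr; apply: zb; apply/in_box => i.
have := le_trans (coord_le_norm _ i) zr; rewrite !mxE ler_norml => /andP[? ?].
by apply/andP; split; lra.
Qed.

Definition conv (k : E -> R) (x : E) : R := \int[lebE]_y (u y * k (y - x)).

Section one_kernel.
Variable f : 'I_d.+1 -> R -> R.
Hypothesis bf : forall i, bumpy a (f i).
Let k := prodf f.

Let mk : measurable_fun setT k. Proof. exact: (measurable_prodf bf). Qed.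

Lemma conv_integrable (w : E -> R) (B : R) (x : E) :
  measurable_fun setT w -> (forall z, `|w z| <= B) ->
  lebE.-integrable setT (EFin \o (fun y => w y * k (y - x))).
Proof.
move=> mw wB; have [C C0 hC] := prodf_bounded a0 bf.
apply: (@integrable_near _ (B * C) a x).
- apply: measurable_funM => //; apply: (measurableT_comp mk).
  by apply: measurable_rVB => //; exact: measurable_id.
- by move=> z; rewrite normrM ler_pM.
- by move=> z az; rewrite /k (prodf_supp bf az) mulr0.
Qed.

Lemma conv_integrable0 (w : E -> R) (B : R) (x : E) :
  measurable_fun setT w -> (forall z, `|w z| <= B) ->
  lebE.-integrable setT (EFin \o (fun z => w (z + x) * k z)).
Proof.
move=> mw wB; have mw' : measurable_fun setT (fun z : E => w (z + x)).
  apply: (measurableT_comp mw); apply: measurable_rVD => //; exact: measurable_id.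
have := @conv_integrable (fun z => w (z + x)) B 0 mw' (fun z => wB (z + x)).
by congr (_.-integrable _ _); apply/funext => z /=; rewrite subr0.
Qed.

Lemma convE (x : E) : conv k x = \int[lebE]_z (u (z + x) * k z).
Proof.
rewrite /conv (@Rintegral_translation _ _ (fun y => u y * k (y - x)) x).
- by apply: eq_Rintegral => z _; rewrite addrK.
- exact: conv_integrable mu uB.
- have := conv_integrable0 x mu uB.
  by congr (_.-integrable _ _); apply/funext => z /=; rewrite addrK.
Qed.

Lemma kernel_integrable : lebE.-integrable setT (EFin \o k).
Proof.
have [C C0 hC] := prodf_bounded a0 bf.
apply: (@integrable_near _ C a 0) => // z; rewrite subr0 => /(prodf_supp bf).
exact.
Qed.

Lemma conv_lipschitz (x y : E) :
  `|conv k x - conv k y| <= L * (\int[lebE]_z `|k z|) * `|x - y|.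
Proof.
rewrite !convE -RintegralB//; try exact: conv_integrable0 mu uB.
have iB : lebE.-integrable setT (EFin \o (fun z => u (z + x) * k z - u (z + y) * k z)).
  rewrite /comp; under eq_fun do rewrite EFinB.
  by apply: integrableB => //; exact: conv_integrable0 mu uB.
apply: le_trans (le_normr_Rintegral measurableT iB) _.
have ik : lebE.-integrable setT (EFin \o (fun z => `|k z|)).
  exact: integrable_norm kernel_integrable.
rewrite mulrAC -RintegralZl//; apply: le_Rintegral => //.
- exact: integrable_norm iB.
- rewrite /comp; under eq_fun do rewrite EFinM; exact: integrableZl.
move=> z _; rewrite -mulrBl normrM; apply: ler_wpM2r => //.
apply: le_trans (uL _ _) _; rewrite (_ : z + x - (z + y) = x - y)//.
by apply/rowP => i; rewrite !mxE; ring.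
Qed.

(** The function [u] is only Lipschitz, so the derivative is put on the kernel, by differentiation
    under the integral sign along the line [x + r *: e]. *)
Lemma conv_is_derive (i : 'I_d.+1) (x : E) :
  is_derive x (delta_mx ord0 i) (conv k) (conv (prodf (dkernel f i)) x).
Proof.
pose e : E := delta_mx ord0 i.
pose F (r : R) (y : E) := u y * k (y - (r *: e + x)).
have bg := bumpy_dkernel bf i.
have [C C0 hC] := prodf_bounded a0 bg.
have ne (r : R) : `|r *: e| <= `|r|.
  apply: norm_le_coord => j; rewrite !mxE normrM; apply: ler_piMr => //.
  by case: (_ && _); rewrite ?normr0 ?normr1.
(* Contains the supports, of radius [a], of all kernels translated by [r *: e] with [|r| < 1]; a
   constant on [b] then dominates all the derivatives. *)
pose b := box (x - const_mx (a + 2)) (x + const_mx (a + 2)).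
have inb (r : R) (y : E) : `|r| < 1 -> ~ b y -> a < `|y - (r *: e + x)|.
  move=> r1 yb; rewrite ltNge; apply/negP => h; apply: yb; apply/in_box => j.
  have := le_trans (coord_le_norm _ j) h; rewrite !mxE.
  have := le_trans (coord_le_norm _ j) (ne r); rewrite !mxE => h1 h2.
  have {}h1 := le_lt_trans h1 r1.
  move: h1 h2; rewrite ltr_norml ler_norml => /andP[? ?] /andP[? ?].
  by apply/andP; split; lra.
have Bu0 : 0 <= Bu by apply: le_trans (uB 0).
have dF (r : R) (y : E) :
    is_derive r 1 (fun r : R => F r y) (u y * prodf (dkernel f i) (y - (r *: e + x))).
  by apply: is_deriveZ; exact: (prodf_is_derive bf).
have pF (r : R) (y : E) : partial1of2 F r y = u y * prodf (dkernel f i) (y - (r *: e + x)).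
  by rewrite partial1of2E; have [_] := dF r y.
have I0 : `]-1, 1[%classic (0 : R) by rewrite /= in_itv/=; apply/andP; split; lra.
have intF (r : R) : `]-1, 1[%classic r -> lebE.-integrable setT (EFin \o F r).
  by move=> _; exact: conv_integrable mu uB.
have derF (r : R) (y : E) : `]-1, 1[%classic r -> setT y -> derivable (F ^~ y) r 1.
  by move=> _ _; have [] := dF r y.
have G0 (y : E) : 0 <= Bu * C * \1_b y.
  by apply: mulr_ge0 => //; apply: mulr_ge0 => //; exact: ltW.
have intG : lebE.-integrable setT (EFin \o (fun y : E => Bu * C * \1_b y)).
  apply: (@bounded_box_integrable _ _ _ (Bu * C) (x - const_mx (a + 2)) (x + const_mx (a + 2))).
  - by apply: measurable_funM => //; apply: measurable_indic; exact: measurable_box.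
  - move=> y; rewrite ger0_norm//; apply: ler_piMr; first by rewrite mulr_ge0// ltW.
    by rewrite indicE; case: (y \in b).
  - by move=> y yb; rewrite indicE memNset// mulr0.
have domF (r : R) (y : E) : `]-1, 1[%classic r -> setT y ->
    `|partial1of2 F r y| <= Bu * C * \1_b y.
  rewrite /= in_itv/= -ltr_norml => r1 _; rewrite pF indicE.
  have [yb|yb] := pselect (b y); first by rewrite mem_set// mulr1 normrM ler_pM.
  by rewrite (prodf_supp bg) ?mulr0 ?normr0 ?memNset ?mulr0//; exact: inb.
have := cvg_differentiation_under_integral measurableT I0 intF derF G0 intG domF.
rewrite (@eq_Rintegral _ _ _ lebE setT (fun y => u y * prodf (dkernel f i) (y - x)) (partial1of2 F 0)); last first.
  by move=> y _; rewrite pF scale0r add0r.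
rewrite (_ : (fun h : R => _) = (fun h : R => h^-1 *: ((conv k \o shift x) (h *: e) - conv k x))).
  move=> H; apply: DeriveDef; first exact: (cvgP _ H).
  exact: cvg_lim H.
by apply/funext => h; rewrite addr0 /F /conv/= scale0r add0r.
Qed.

End one_kernel.

Lemma conv_partials (f : 'I_d.+1 -> R -> R) (s : seq 'I_d.+1) :
  (forall i, bumpy a (f i)) -> exists2 g : 'I_d.+1 -> R -> R,
    (forall i, bumpy a (g i)) & partials s (conv (prodf f)) = conv (prodf g).
Proof.
elim: s f => [|i s ih] f bf; first by exists f.
have [g bg fg] := ih f bf; exists (dkernel g i); first exact: bumpy_dkernel.
by apply/funext => x /=; rewrite fg; have [_] := conv_is_derive bg i x.
Qed.

Lemma conv_smooth (f : 'I_d.+1 -> R -> R) :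
  (forall i, bumpy a (f i)) -> smooth (conv (prodf f)).
Proof.
move=> bf s; have [g bg ->] := conv_partials s bf; split.
  exact: lipschitz_continuous_rV (conv_lipschitz bg).
by move=> i x; have [] := conv_is_derive bg i x.
Qed.

End convolution.

Section mollification.
Context {R : realType} {d : nat}.
Local Notation E := 'rV[R]_d.+1.
Local Notation lebE := (lebesgue_rV R d.+1).
Variable a : R.
Hypothesis a0 : 0 < a.

(** The normalising constant is carried by one single factor, so that the normalised kernel is still
    a tensor product. *)
Let bump_kernel (c : R) (i : 'I_d.+1) : R -> R :=
  if i == ord0 then cst c \* bump1 a else bump1 a.

Let bumpy_bump_kernel c i : bumpy a (bump_kernel c i).
Proof.
have s0 r : a < `|r| -> bump1 a r = 0 by move=> /ltW; exact: bump1_supp.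
rewrite /bump_kernel; case: ifP => _; split.
- by apply: smooth1M; [move=> k; exact: derivable_upto_cst|exact: smooth1_bump1].
- by move=> r ra; rewrite /= s0// mulr0.
- exact: smooth1_bump1.
- exact: s0.
Qed.

Let bump_kernelE c (x : E) : prodf (bump_kernel c) x = c * \prod_i bump1 a (x ord0 i).
Proof.
rewrite /prodf (bigD1 ord0)//= [in RHS](bigD1 ord0)//= mulrA; congr (_ * _).
by apply: eq_bigr => i i0; rewrite /bump_kernel (negbTE i0).
Qed.

Lemma exists_unit_kernel : exists f : 'I_d.+1 -> R -> R,
  [/\ forall i, bumpy a (f i), forall x, 0 <= prodf f x & \int[lebE]_x prodf f x = 1].
Proof.
pose k := prodf (bump_kernel 1).
have b1 := bumpy_bump_kernel 1.
have kE x : k x = \prod_i bump1 a (x ord0 i) by rewrite /k bump_kernelE mul1r.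
have k0 x : 0 <= k x by rewrite kE; apply: prodr_ge0 => i _; exact: bump1_ge0.
have ik : lebE.-integrable setT (EFin \o k) := kernel_integrable a0 b1.
have mk : measurable_fun setT k := measurable_prodf b1.
(* A nonnegative kernel with zero integral would vanish almost everywhere, but this one is positive
   on a box of positive measure. *)
have I0 : 0 < \int[lebE]_x k x.
  rewrite lt_def Rintegral_ge0 ?andbT//; apply/eqP => I0.
  have : (\int[lebE]_(x in setT) `|(EFin \o k) x| = 0)%E.
    rewrite (eq_integral (EFin \o k)) => [|x _]; last by rewrite /= ger0_norm.
    rewrite -(fineK (integrable_fin_num measurableT ik)); congr EFin; exact: I0.
  have mEk : measurable_fun setT (EFin \o k) by exact/measurable_EFinP.
  move=> /(ae_eq_integral_abs _ measurableT mEk)[N [mN N0 kN]].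
  pose b : set E := box (0 - const_mx (a / 2)) 0.
  have : (lebE b <= lebE N)%E.
    apply: le_measure; rewrite ?inE//; first exact: measurable_box.
    move=> x /in_box xb; apply: kN => /= h; have := h I => -[].
    apply/eqP; rewrite kE gt_eqF// prodr_gt0// => i _.
    by apply: bump1_gt0 => //; have := xb i; rewrite !mxE ltr_norml => /andP[? ?];
      apply/andP; split; lra.
  rewrite N0 leNgt (_ : lebE b = ((a / 2) ^+ d.+1)%:E); last first.
    by apply: lebesgue_half_open_box; rewrite divr_gt0.
  by rewrite lte_fin exprn_gt0// divr_gt0.
exists (bump_kernel (\int[lebE]_x k x)^-1); split => [|x|].
- exact: bumpy_bump_kernel.
- by rewrite bump_kernelE -kE mulr_ge0// invr_ge0 ltW.
- rewrite (@eq_Rintegral _ _ _ _ _ (fun x => (\int[lebE]_x k x)^-1 * k x)) => [|x _].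
    by rewrite RintegralZl// mulVf// gt_eqF.
  by rewrite bump_kernelE -kE.
Qed.

(* The averaging property compares the mollifications of two functions at two
   different points; it is what makes the commutator of [M] with a Lipschitz
   change of variables small. *)
Lemma exists_mollifier : exists (M : (E -> R) -> E -> R) (C : R), 0 <= C /\
  forall (u : E -> R) (B L : R), (forall x, `|u x| <= B) ->
    (forall x y, `|u x - u y| <= L * `|x - y|) ->
  [/\ smooth (M u),
      forall i x y, `|'D_(delta_mx ord0 i) (M u) x - 'D_(delta_mx ord0 i) (M u) y|
        <= C * L * `|x - y| &
      forall (w : E -> R) (B' L' c : R) (x y : E), (forall x, `|w x| <= B') ->
        (forall x y, `|w x - w y| <= L' * `|x - y|) ->
        (forall z, `|z| <= a -> `|u (z + x) - w (z + y)| <= c) ->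
        `|M u x - M w y| <= c] /\
  forall c x, M (cst c) x = c.
Proof.
have [f [bf f0 f1]] := exists_unit_kernel.
pose C := \sum_i \int[lebE]_z `|prodf (dkernel f i) z|.
have Ci0 i : 0 <= \int[lebE]_z `|prodf (dkernel f i) z| by exact: Rintegral_ge0.
have ik : lebE.-integrable setT (EFin \o prodf f) := kernel_integrable a0 bf.
exists (fun u => conv u (prodf f)), C; split; first exact: sumr_ge0.
have cstL (c : R) (x y : E) : `|cst c x - cst c y| <= 0 * `|x - y|.
  by rewrite subrr normr0 mul0r.
move=> u B L uB uL; split; last first.
  move=> c x; rewrite (@convE _ _ _ a0 (cst c) `|c| 0 (fun=> lexx _) (cstL c) f bf).
  by rewrite RintegralZl// f1 mulr1.
split.
- exact: (conv_smooth a0 uB uL bf).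
- move=> i x y.
  have D z : 'D_(delta_mx ord0 i) (conv u (prodf f)) z = conv u (prodf (dkernel f i)) z.
    by have [_] := conv_is_derive a0 uB uL bf i z.
  rewrite !D; apply: le_trans (conv_lipschitz a0 uB uL (bumpy_dkernel bf i) x y) _.
  apply: ler_wpM2r => //; rewrite mulrC; apply: ler_wpM2r.
    have := uL (const_mx 1) 0; move/(le_trans (normr_ge0 _)).
    by rewrite subr0 pmulr_lge0// normr_gt0; apply/eqP => /rowP/(_ ord0); rewrite !mxE; apply/eqP/oner_neq0.
  by rewrite /C (bigD1 i)//= lerDl sumr_ge0.
- move=> w B' L' c x y wB wL uwc.
  have mu : measurable_fun setT u := lipschitz_measurable_rV uL.
  have mw : measurable_fun setT w := lipschitz_measurable_rV wL.
  rewrite (convE a0 uB uL bf) (convE a0 wB wL bf).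
  have iu := conv_integrable0 a0 bf x mu uB.
  have iw := conv_integrable0 a0 bf y mw wB.
  rewrite -RintegralB//.
  have iB : lebE.-integrable setT (EFin \o (fun z => u (z + x) * prodf f z - w (z + y) * prodf f z)).
    rewrite /comp; under eq_fun do rewrite EFinB.
    exact: integrableB.
  apply: le_trans (le_normr_Rintegral measurableT iB) _.
  rewrite -[leRHS]mulr1 -f1 -RintegralZl//; apply: le_Rintegral => //.
  + exact: integrable_norm iB.
  + rewrite /comp; under eq_fun do rewrite EFinM; exact: integrableZl.
  move=> z _; rewrite -mulrBl normrM (ger0_norm (f0 z)).
  have [za|za] := leP `|z| a; first by apply: ler_wpM2r => //; exact: uwc.
  by rewrite (prodf_supp bf)// !mulr0.
Qed.

End mollification.

(** * Transport by a flow *)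

Section probability_integrals.
Context dd (X : measurableType dd) (R : realType) (P : probability X R).

Lemma prob_integrable (f : X -> R) (B : R) : measurable_fun setT f ->
  (forall x, `|f x| <= B) -> P.-integrable setT (EFin \o f).
Proof.
move=> mf fB; apply: measurable_bounded_integrable => //.
- by apply: (@le_lt_trans _ _ 1%E); [exact: probability_le1|exact: ltry].
- by exists B; split; [exact: num_real|move=> M BM x _; exact: le_trans (fB x) (ltW BM)].
Qed.

Lemma prob_Rintegral_cst (c : R) : \int[P]_x (cst c x) = c.
Proof. rewrite Rintegral_cst// -[RHS]mulr1; congr (_ * _).
exact: (congr1 fine (probability_setT P)). Qed.

Lemma prob_Rintegral_norm (f : X -> R) (B : R) : measurable_fun setT f ->
  (forall x, `|f x| <= B) -> `|\int[P]_x f x| <= B.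
Proof.
move=> mf fB; have iF := prob_integrable mf fB.
apply: le_trans (le_normr_Rintegral measurableT iF) _.
rewrite -[leRHS]prob_Rintegral_cst; apply: le_Rintegral => //.
- exact: integrable_norm iF.
- exact: finite_measure_integrable_cst.
Qed.

Lemma prob_Rintegral_dist (f g : X -> R) (B B' c : R) :
  measurable_fun setT f -> measurable_fun setT g ->
  (forall x, `|f x| <= B) -> (forall x, `|g x| <= B') ->
  (forall x, `|f x - g x| <= c) -> `|\int[P]_x f x - \int[P]_x g x| <= c.
Proof.
move=> mf mg fB gB fg; have iF := prob_integrable mf fB; have iG := prob_integrable mg gB.
rewrite -RintegralB//; apply: prob_Rintegral_norm => //; exact: measurable_funB.
Qed.

End probability_integrals.

(** * Time integrals dominated by a square integrable majorant *)

Section interval_integrals.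
Context {R : realType}.
Local Notation leb := (@lebesgue_measure R).

Definition int_oc (f : R -> R) (s t : R) : R := \int[leb]_(r in `]s, t]) f r.

Lemma lebesgue_oc (s t : R) : s <= t -> leb `]s, t]%classic = (t - s)%:E.
Proof.
rewrite le_eqVlt => st; have /= -> := lebesgue_measure_itv `]s, t].
by rewrite lte_fin; case/orP: st => [/eqP ->|->//]; rewrite ltxx subrr.
Qed.

Lemma lebesgue_oc_lty (s t : R) : (leb `]s, t]%classic < +oo)%E.
Proof.
have /= -> := lebesgue_measure_itv `]s, t].
by case: ifP => _; rewrite ?ltry// -EFinB ltry.
Qed.

Lemma real_integrableZ (A : set (measurableTypeR R)) (k : R) (f : R -> R) :
  measurable A -> leb.-integrable A (EFin \o f) ->
  leb.-integrable A (EFin \o (fun r => k * f r)).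
Proof. by move=> mA iF; exact: (@integrableZl _ _ R leb A mA k (EFin \o f) iF). Qed.

Lemma real_integrableD (A : set (measurableTypeR R)) (f g : R -> R) :
  measurable A -> leb.-integrable A (EFin \o f) -> leb.-integrable A (EFin \o g) ->
  leb.-integrable A (EFin \o (fun r => f r + g r)).
Proof. by move=> mA iF iG; exact: (@integrableD _ _ R leb A mA (EFin \o f) (EFin \o g) iF iG). Qed.

Variables (H : R) (l : R -> R).
Hypothesis ml : measurable_fun [set: measurableTypeR R] l.
Hypothesis l0 : forall t, 0 <= l t.
Hypothesis l2 : (\int[leb]_(t in `[0%R, H]) ((l t) ^+ 2)%:E < +oo)%E.

Let msub (s t : R) : measurable (`]s, t]%classic : set (measurableTypeR R)).
Proof. exact: measurable_itv. Qed.

Let sub0 (s t : R) : 0 <= s -> t <= H -> `]s, t]%classic `<=` `[0, H]%classic.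
Proof.
by move=> s0 tH r /=; rewrite !in_itv/= => /andP[? ?]; apply/andP; split; lra.
Qed.

Lemma integrable_sq (s t : R) : 0 <= s -> t <= H ->
  leb.-integrable `]s, t] (EFin \o (fun r => l r ^+ 2)).
Proof.
move=> s0 tH.
have h : leb.-integrable `[0, H] (EFin \o (fun r => l r ^+ 2)).
  apply/integrableP; split.
    by apply/measurable_EFinP; apply: measurable_funTS; exact: measurable_funX.
  under eq_integral => r _ do rewrite /= ger0_norm ?sqr_ge0//.
  exact: l2.
by apply: (integrableS _ _ _ h); [exact: measurable_itv|exact: msub|exact: sub0].
Qed.

Lemma integrable_majorant (s t : R) : 0 <= s -> t <= H ->
  leb.-integrable `]s, t] (EFin \o l).
Proof.
move=> s0 tH.
have i1 : leb.-integrable `]s, t] (EFin \o (fun r => 1 + l r ^+ 2)).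
  apply: real_integrableD; [exact: msub| |exact: integrable_sq].
  apply: measurable_bounded_integrable; [exact: msub| |exact: measurable_cst|].
    exact: lebesgue_oc_lty.
  by exists 1; split; [exact: num_real|move=> M M1 x _ /=; rewrite normr1 ltW].
apply: le_integrable i1; [exact: msub| |].
  by apply/measurable_EFinP; exact: measurable_funTS.
move=> r _ /=; rewrite lee_fin [leRHS]ger0_norm; last by rewrite addr_ge0// sqr_ge0.
rewrite ger0_norm//; have := sqr_ge0 (l r - 1); rewrite sqrrB1.
have := l0 r; have := sqr_ge0 (l r); lra.
Qed.

Lemma dominated_integrable (f : R -> R) (c s t : R) :
  measurable_fun [set: measurableTypeR R] f -> (forall r, s < r <= t -> `|f r| <= c * l r) ->
  0 <= s -> t <= H -> leb.-integrable `]s, t] (EFin \o f).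
Proof.
move=> mf fc s0 tH.
have i1 : leb.-integrable `]s, t] (EFin \o (fun r => c * l r)).
  by apply: real_integrableZ; [exact: msub|exact: integrable_majorant].
apply: le_integrable i1; [exact: msub| |].
  by apply/measurable_EFinP; exact: measurable_funTS.
by move=> r /=; rewrite in_itv/= lee_fin => rst; apply: le_trans (fc r rst) (ler_norm _).
Qed.

Lemma int_oc_add (f : R -> R) (s t u : R) : leb.-integrable `]s, u] (EFin \o f) ->
  s <= t -> t <= u -> int_oc f s u = int_oc f s t + int_oc f t u.
Proof.
move=> iF st tu; have := @Rintegral_itvB R f (BRight s) (BRight u) t iF.
by rewrite !bnd_simp => /(_ st tu) E; rewrite /int_oc -E addrC subrK.
Qed.

Lemma int_oc_norm (f : R -> R) (c s t : R) :
  measurable_fun [set: measurableTypeR R] f -> (forall r, s < r <= t -> `|f r| <= c * l r) ->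
  0 <= s -> t <= H -> `|int_oc f s t| <= c * int_oc l s t.
Proof.
move=> mf fc s0 tH; have iF := dominated_integrable mf fc s0 tH.
rewrite /int_oc; apply: le_trans (le_normr_Rintegral (msub s t) iF) _.
rewrite -RintegralZl; [|exact: msub|exact: integrable_majorant].
apply: le_Rintegral; [exact: msub|exact: integrable_norm iF| |by move=> r /=; rewrite in_itv; exact: fc].
by apply: real_integrableZ; [exact: msub|exact: integrable_majorant].
Qed.

Lemma int_ocB (f g : R -> R) (c c' s t : R) :
  measurable_fun [set: measurableTypeR R] f -> (forall r, s < r <= t -> `|f r| <= c * l r) ->
  measurable_fun [set: measurableTypeR R] g -> (forall r, s < r <= t -> `|g r| <= c' * l r) ->
  0 <= s -> t <= H -> int_oc f s t - int_oc g s t = int_oc (fun r => f r - g r) s t.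
Proof.
move=> mf fc mg gc s0 tH; rewrite /int_oc RintegralB//.
- exact: dominated_integrable mf fc s0 tH.
- exact: dominated_integrable mg gc s0 tH.
Qed.

Lemma int_oc_ge0 (f : R -> R) (s t : R) : (forall r, 0 <= f r) -> 0 <= int_oc f s t.
Proof. by move=> f0; exact: Rintegral_ge0. Qed.

(* Cauchy-Schwarz, from [2 w l <= w^2 / (t - s) + (t - s) l^2] with [w] the
   integral of [l]. *)
Lemma int_oc_sq (s t : R) : 0 <= s -> s < t -> t <= H ->
  (int_oc l s t) ^+ 2 <= (t - s) * int_oc (fun r => l r ^+ 2) s t.
Proof.
move=> s0 st tH; set w := int_oc l s t; set q := int_oc _ s t.
have h0 : 0 < t - s by rewrite subr_gt0.
have il := integrable_majorant s0 tH; have iq := integrable_sq s0 tH.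
suff : 2 * w * w <= w ^+ 2 + (t - s) * q by rewrite expr2; lra.
have E1 : 2 * w * w = \int[leb]_(r in `]s, t]) (2 * w * l r).
  by rewrite RintegralZl.
have ic : leb.-integrable `]s, t] (EFin \o cst (w ^+ 2 / (t - s))).
  apply: measurable_bounded_integrable; [exact: msub| |exact: measurable_cst|].
    exact: lebesgue_oc_lty.
  by apply: bounded_cst.
have iz : leb.-integrable `]s, t] (EFin \o (fun r => (t - s) * l r ^+ 2)).
  by apply: real_integrableZ; [exact: msub|].
have E2 : w ^+ 2 + (t - s) * q =
    \int[leb]_(r in `]s, t]) (w ^+ 2 / (t - s) + (t - s) * l r ^+ 2).
  rewrite RintegralD; [|exact: msub|exact: ic|exact: iz].
  have -> : \int[leb]_(r in `]s, t]) ((t - s) * l r ^+ 2) = (t - s) * q.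
    by rewrite RintegralZl; [|exact: msub|exact: iq].
  congr (_ + _).
  rewrite Rintegral_cst; last exact: msub.
  have -> : fine (leb `]s, t]%classic) = t - s by rewrite lebesgue_oc// ltW.
  by rewrite divfK// gt_eqF.
rewrite E1 E2; apply: le_Rintegral; [exact: msub| | |].
- by apply: real_integrableZ; [exact: msub|].
- by apply: real_integrableD; [exact: msub|exact: ic|exact: iz].
move=> r _; rewrite -subr_ge0.
rewrite (_ : _ - _ = (w - (t - s) * l r) ^+ 2 / (t - s)).
  by rewrite divr_ge0 ?sqr_ge0// ltW.
by field; rewrite gt_eqF.
Qed.

End interval_integrals.

(** * First-order expansion with Lipschitz partial derivatives *)

Section taylor.
Context {R : realType} {d : nat}.
Local Notation E := 'rV[R]_d.+1.

Lemma is_derive_line (v : E -> R) (e y : E) (r : R) :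
  derivable v (r *: e + y) e ->
  is_derive r 1 (fun r : R => v (r *: e + y)) ('D_e v (r *: e + y)).
Proof.
move=> dv.
have E1 : (fun h : R => h^-1 *: (((fun r : R => v (r *: e + y)) \o shift r) (h *: 1) - v (r *: e + y))) =
    (fun h : R => h^-1 *: ((v \o shift (r *: e + y)) (h *: e) - v (r *: e + y))).
  apply/funext => h /=; congr (_ *: (v _ - _)).
  by rewrite [h *: 1]mulr1 scalerDl addrA.
by apply: DeriveDef; rewrite /derivable /derive E1.
Qed.

Lemma line_growth (v : E -> R) (e y : E) (b m c : R) :
  (forall x, derivable v x e) ->
  (forall r, `|r| <= `|b| -> `|'D_e v (r *: e + y) - m| <= c) ->
  `|v (b *: e + y) - v y - b * m| <= c * `|b|.
Proof.
move=> dv vc; pose g r := v (r *: e + y).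
have dg (r : R) : is_derive r 1 g ('D_e v (r *: e + y)) by exact: is_derive_line.
have cg : continuous g.
  move=> r; apply: differentiable_continuous; apply/derivable1_diffP.
  by have [] := dg r.
have g0 : g 0 = v y by rewrite /g scale0r add0r.
have [b0|b0] := leP 0 b.
  have [x xb gE] := MVT_segment b0 (fun r _ => dg r) (continuous_subspaceT cg).
  rewrite -g0 -/(g b) gE subr0 mulrC -mulrBr normrM mulrC; apply: ler_wpM2r => //.
  by apply: vc; move: xb; rewrite in_itv/= => /andP[x0 xb]; rewrite !ger0_norm.
have [x xb gE] := MVT_segment (ltW b0) (fun r _ => dg r) (continuous_subspaceT cg).
rewrite -g0 -/(g b) -[g b - g 0]opprB gE sub0r mulrN opprK mulrC -mulrBr normrM mulrC.
apply: ler_wpM2r => //; apply: vc; move: xb; rewrite in_itv/= => /andP[bx x0].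
by rewrite !ler0_norm ?(ltW b0)// lerN2.
Qed.

(** Only the partial derivatives are controlled, so [x] is moved to [x + A] one coordinate at a
    time. Each of the [d.+1] moves is a mean value estimate in which the partial derivative differs
    from its value at [x] by at most [K * |A|]. *)
Lemma taylor1 (v : E -> R) (K : R) : 0 <= K ->
  (forall i x, derivable v x (delta_mx ord0 i)) ->
  (forall i x y, `|'D_(delta_mx ord0 i) v x - 'D_(delta_mx ord0 i) v y| <= K * `|x - y|) ->
  forall x A : E, `|v (x + A) - v x - dotv A (grad v x)| <= d.+1%:R * (K * `|A| ^+ 2).
Proof.
move=> K0 dv KL x A.
pose p (k : nat) : E := \row_i (if (i < k)%N then A ord0 i else 0).
have pS (k : 'I_d.+1) : p k.+1 = A ord0 k *: delta_mx ord0 k + p k.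
  apply/rowP => i; rewrite !mxE eqxx/= ltnS leq_eqVlt.
  have [->|ik] := eqVneq i k; first by rewrite eqxx ltnn mulr1 addr0.
  by rewrite -[(i == k :> nat)]/(i == k) (negbTE ik) mulr0 add0r.
have step (k : 'I_d.+1) :
    `|v (x + p k.+1) - v (x + p k) - A ord0 k * grad v x ord0 k| <= K * `|A| ^+ 2.
  rewrite pS addrCA mxE.
  apply: le_trans (line_growth (c := K * `|A|) (dv k) _) _; last first.
    by rewrite expr2 mulrA; apply: ler_wpM2l; [exact: mulr_ge0|exact: coord_le_norm].
  move=> r rA; apply: le_trans (KL k _ _) _; apply: ler_wpM2l => //.
  apply: norm_le_coord => i; rewrite !mxE eqxx/=.
  have [->|ik] := eqVneq i k.
    rewrite ltnn mulr1 addr0 addrK; apply: le_trans rA _; exact: coord_le_norm.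
  rewrite mulr0 add0r addrAC subrr add0r; case: ifP => _; last by rewrite normr0.
  exact: coord_le_norm.
have p0 : x + p 0%N = x by apply/rowP => i; rewrite !mxE ltn0 addr0.
have pn : x + p d.+1 = x + A by apply/rowP => i; rewrite !mxE ltn_ord.
have -> : v (x + A) - v x - dotv A (grad v x) =
    \sum_(k < d.+1) (v (x + p k.+1) - v (x + p k) - A ord0 k * grad v x ord0 k).
  rewrite sumrB; congr (_ - _).
  by rewrite -(big_mkord xpredT (fun k => v (x + p k.+1) - v (x + p k))) telescope_sumr// p0 pn.
apply: le_trans (ler_norm_sum _ _ _) _.
rewrite mulr_natl -[X in _ *+ X](card_ord d.+1) -sumr_const.
exact: ler_sum.
Qed.

Lemma derive_lipschitz (v : E -> R) (L : R) (i : 'I_d.+1) (x : E) :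
  derivable v x (delta_mx ord0 i) -> (forall x y, `|v x - v y| <= L * `|x - y|) ->
  `|'D_(delta_mx ord0 i) v x| <= L.
Proof.
move=> dv vL; apply/ler_addgt0Pr => e e0; have {}e0 : 0 < (e : R) by [].
have := dv; move=> /cvgrPdist_lt/(_ e e0) H.
have {H} : \forall h \near (0 : R)^', `|'D_(delta_mx ord0 i) v x| <= L + e.
  near=> h; have h0 : h != 0 by near: h; exact: nbhs_dnbhs_neq.
  have : `|'D_(delta_mx ord0 i) v x -
    h^-1 *: ((v \o shift x) (h *: delta_mx ord0 i) - v x)| < e by near: h; exact: H.
  set q := _ *: _ => h1.
  have hq : `|q| <= L.
    rewrite /q /= normrM normfV ler_pdivrMl ?normr_gt0// mulrC.
    apply: le_trans (vL _ _) _; rewrite addrK.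
    have L0 : 0 <= L.
      have := vL (const_mx 1) 0; move/(le_trans (normr_ge0 _)).
      by rewrite subr0 pmulr_lge0// normr_gt0; apply/eqP => /rowP/(_ ord0); rewrite !mxE; apply/eqP/oner_neq0.
    apply: ler_wpM2l => //; apply: norm_le_coord => j; rewrite !mxE normrM.
    by apply: ler_piMr => //; case: (_ && _); rewrite ?normr0 ?normr1.
  have := ler_normB ('D_(delta_mx ord0 i) v x) ('D_(delta_mx ord0 i) v x - q).
  rewrite subKr; have := ler_normD ('D_(delta_mx ord0 i) v x - q) q; rewrite subrK; lra.
move=> H; near (0 : R)^' => h; exact: (near H h).
Unshelve. all: by end_near. Qed.

Lemma dotv_norm_le (x y : E) (b : R) : (forall i, `|y ord0 i| <= b) ->
  `|dotv x y| <= d.+1%:R * (`|x| * b).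
Proof.
move=> yb; apply: le_trans (ler_norm_sum _ _ _) _.
rewrite mulr_natl -[X in _ *+ X](card_ord d.+1) -sumr_const.
apply: ler_sum => i _; rewrite normrM; apply: ler_pM => //; exact: coord_le_norm.
Qed.

End taylor.

(** * Integrals against a measurable curve of probability measures *)

Section kernels.
Context {R : realType} {d : nat}.
Local Notation E := 'rV[R]_d.+1.
Local Notation leb := (@lebesgue_measure R).
Variable mu : measurableTypeR R -> probability E R.
Hypothesis mmu : forall A, measurable A -> measurable_fun setT (fun t => mu t A).

Let kmu (t : measurableTypeR R) : {measure set E -> \bar R} := mu t.

Let kmu_measurable : forall U, measurable U -> measurable_fun setT (kmu ^~ U).
Proof. exact: mmu. Qed.

HB.instance Definition _ := isKernel.Build _ _ _ _ R kmu kmu_measurable.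

Let kmu_prob t : kmu t setT = 1%E.
Proof. exact: probability_setT. Qed.

HB.instance Definition _ := Kernel_isProbability.Build _ _ _ _ R kmu kmu_prob.

(** Viewed as a probability kernel, the curve integrates nonnegative jointly measurable functions
    measurably in time; this is applied to the positive and negative parts. *)
Lemma measurable_Rintegral_kernel (f : R -> E -> R) :
  measurable_fun setT (fun z : measurableTypeR R * E => f z.1 z.2) ->
  measurable_fun [set: measurableTypeR R] (fun t => \int[mu t]_x f t x).
Proof.
move=> mf; pose k (z : measurableTypeR R * E) := (f z.1 z.2)%:E.
have mk : measurable_fun setT k by exact/measurable_EFinP.
have mp := measurable_fun_integral_finite_kernel (k^\+%E) kmu
  (funepos_ge0 k) (measurable_funepos mk).
have mn := measurable_fun_integral_finite_kernel (k^\-%E) kmu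
  (funeneg_ge0 k) (measurable_funeneg mk).
have -> : (fun t => \int[mu t]_x f t x) =
    (fun t => fine (\int[kmu t]_y k^\+%E (t, y) - \int[kmu t]_y k^\-%E (t, y))%E).
  apply/funext => t; rewrite /Rintegral integralE.
  by congr (fine (_ - _)%E); apply: eq_integral => x _; rewrite ?funeposE ?funenegE.
apply: measurableT_comp; last exact: emeasurable_funB.
exact: fine_measurable.
Qed.

End kernels.

Section fubini.
Context {R : realType} {d : nat}.
Local Notation E := 'rV[R]_d.+1.
Local Notation leb := (@lebesgue_measure R).
Variables (H : R) (l : R -> R).
Hypothesis ml : measurable_fun [set: measurableTypeR R] l.
Hypothesis l0 : forall t, 0 <= l t.
Hypothesis l2 : (\int[leb]_(t in `[0%R, H]) ((l t) ^+ 2)%:E < +oo)%E.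
Variables (P : probability E R) (f : R -> E -> R) (c : R).
Hypothesis mf : measurable_fun setT (fun z : measurableTypeR R * E => f z.1 z.2).
Hypothesis fc : forall r x, `|f r x| <= c * l r.
Variables (s t : R).
Hypotheses (s0 : 0 <= s) (tH : t <= H).

Let mst : measurable (`]s, t]%classic : set (measurableTypeR R)).
Proof. exact: measurable_itv. Qed.

Let mfr r : measurable_fun setT (f r).
Proof. exact: (measurableT_comp mf (pair1_measurable (r : measurableTypeR R))). Qed.

Let mfx x : measurable_fun [set: measurableTypeR R] (f ^~ x).
Proof. exact: (measurableT_comp mf (pair2_measurable x)). Qed.

(** Fubini's theorem on the full product, with the time interval written as an indicator inside the
    integrand; the majorant [c * l] supplies the integrability. *)
Lemma int_oc_prob : int_oc (fun r => \int[P]_x f r x) s t = \int[P]_x int_oc (f ^~ x) s t.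
Proof.
pose g (z : measurableTypeR R * E) := (\1_(`]s, t]%classic) z.1 * f z.1 z.2)%:E.
have mg : measurable_fun setT g.
  apply/measurable_EFinP; apply: measurable_funM => //.
  by apply: measurableT_comp measurable_fst; exact: measurable_indic.
have gE1 r : (\int[P]_x g (r, x) = ((fun r => (\int[P]_x f r x)%:E) \_ `]s, t]%classic) r)%E.
  rewrite patchE /g /=; case: ifPn => rst.
    rewrite indicE rst; under eq_integral do rewrite mul1r.
    rewrite /Rintegral fineK//; apply: integrable_fin_num => //.
    exact: (@prob_integrable _ _ _ P (f r) _ (mfr r) (fc r)).
  by rewrite indicE (negbTE rst); under eq_integral do rewrite mul0r; rewrite integral0.
have gE2 x : (\int[leb]_r g (r, x) = (int_oc (f ^~ x) s t)%:E)%E.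
  rewrite /int_oc /Rintegral fineK.
    rewrite [RHS]integral_mkcond; apply: eq_integral => r _.
    by rewrite patchE /g /= indicE; case: ifPn => rst; rewrite ?rst ?mul1r ?(negbTE rst) ?mul0r.
  apply: integrable_fin_num => //.
  exact: (dominated_integrable ml l0 l2 (mfx x) (c := c)).
have ig : (leb \x P)%E.-integrable setT g.
  apply/integrable12ltyP => //.
  apply: (@le_lt_trans _ _ (\int[leb]_(r in `]s, t]) (c * l r)%:E)%E).
    rewrite [leRHS]integral_mkcond; apply: ge0_le_integral => //.
    - by move=> r _; exact: integral_ge0.
    - apply: (@measurable_fun_fubini_tonelli_F _ _ _ _ _ P (fun z => `|g z|%E)).
        by apply: measurableT_comp mg; exact: abse_measurable.
      by move=> z; exact: abse_ge0.
    - have h : measurable_fun `]s, t]%classic (fun r : measurableTypeR R => (c * l r)%:E).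
        apply/measurable_EFinP; apply: measurable_funTS.
        by apply: measurable_funM => //; exact: measurable_cst.
      exact: (measurable_restrictT _ mst).1 h.
    move=> r _; rewrite patchE; case: ifPn => rst.
      under eq_integral do rewrite /g /= indicE rst mul1r.
      apply: (@le_trans _ _ (\int[P]_x (cst (c * l r)%:E x))%E).
        apply: ge0_le_integral => //.
        - by apply/measurable_EFinP; apply: measurableT_comp => //; exact: mfr.
        - by move=> x _; rewrite lee_fin; exact: fc.
      rewrite integral_cst// -[leRHS]mule1.
      by apply: lee_wpmul2l; [rewrite lee_fin (le_trans _ (fc r 0))|exact: probability_le1].
    by under eq_integral do rewrite /g /= indicE (negbTE rst) mul0r normr0; rewrite integral0.
  apply: integrable_lty => //; apply: (dominated_integrable ml l0 l2 (c := c)) => //.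
    by apply: measurable_funM => //; exact: measurable_cst.
  by move=> r _; rewrite ger0_norm// (le_trans _ (fc r 0)).
have := Fubini ig.
under eq_integral do rewrite gE1.
under [RHS]eq_integral do rewrite gE2.
by rewrite -integral_mkcond /int_oc /Rintegral => ->.
Qed.

End fubini.

(** * Euler steps and dyadic Euler schemes *)

Section euler.
Context {R : realType} {d : nat}.
Local Notation E := 'rV[R]_d.+1.
Local Notation leb := (@lebesgue_measure R).
Variables (H : R) (l : R -> R) (a : R -> E -> E).
Hypothesis H0 : 0 < H.
Hypothesis ml : measurable_fun [set: measurableTypeR R] l.
Hypothesis l0 : forall t, 0 <= l t.
Hypothesis l2 : (\int[leb]_(t in `[0%R, H]) ((l t) ^+ 2)%:E < +oo)%E.
Hypothesis ma : measurable_fun setT (fun z : measurableTypeR R * E => a z.1 z.2).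
Hypothesis ab : forall t x, `|a t x| <= l t.
Hypothesis al : forall t x y, `|a t x - a t y| <= l t * `|x - y|.

Let mai x i : measurable_fun [set: measurableTypeR R] (fun r => a r x ord0 i).
Proof.
have h := measurableT_comp ma (pair2_measurable x).
exact: (measurableT_comp (measurable_coord i) h).
Qed.

Let abi t x i : `|a t x ord0 i| <= 1 * l t.
Proof. by rewrite mul1r; apply: le_trans (coord_le_norm _ _) (ab t x). Qed.

Let ali t x y i : `|a t x ord0 i - a t y ord0 i| <= `|x - y| * l t.
Proof.
apply: le_trans (_ : `|a t x - a t y| <= _); last by rewrite mulrC.
by have := coord_le_norm (a t x - a t y) i; rewrite !mxE.
Qed.

(** The field is integrated in time at a fixed point: the increment of one Euler step, not of a
    trajectory. *)
Definition displacement (s t : R) (x : E) : E := \row_i int_oc (fun r => a r x ord0 i) s t.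

Local Notation om := (int_oc l).

Lemma om_ge0 (s t : R) : 0 <= om s t.
Proof. exact: int_oc_ge0. Qed.

Lemma om_add (s t u : R) : 0 <= s -> s <= t -> t <= u -> u <= H -> om s u = om s t + om t u.
Proof. by move=> s0 st tu uH; apply: int_oc_add => //; exact: (integrable_majorant ml l0 l2 s0 uH). Qed.

Lemma displacement_norm (s t : R) x : 0 <= s -> t <= H -> `|displacement s t x| <= om s t.
Proof.
move=> s0 tH; apply: norm_le_coord => i; rewrite mxE -[leRHS]mul1r.
by apply: (int_oc_norm ml l0 l2) => // r _; exact: abi.
Qed.

Lemma displacement_lipschitz (s t : R) x y : 0 <= s -> t <= H ->
  `|displacement s t x - displacement s t y| <= om s t * `|x - y|.
Proof.
move=> s0 tH; apply: norm_le_coord => i; rewrite !mxE mulrC.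
rewrite (int_ocB ml l0 l2 (c := 1) (c' := 1))//.
by apply: (int_oc_norm ml l0 l2) => //;
  first [by apply: measurable_funB; exact: mai|by move=> r _; exact: ali].
Qed.

Lemma displacement_add (s t u : R) x : 0 <= s -> s <= t -> t <= u -> u <= H ->
  displacement s u x = displacement s t x + displacement t u x.
Proof.
move=> s0 st tu uH; apply/rowP => i; rewrite !mxE; apply: int_oc_add => //.
by apply: (dominated_integrable ml l0 l2 (c := 1)) => // r _; exact: abi.
Qed.

End euler.

Lemma exists_div_exp2_lt (R : realType) (C e : R) : 0 < e -> exists m, C / 2 ^+ m < e.
Proof.
move=> e0; exists (Num.bound (`|C| / e)).
have h : `|C| / e < (Num.bound (`|C| / e))%:R by apply: archi_boundP; rewrite divr_ge0// ltW.
set m := Num.bound _ in h *.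
have m2 : (m%:R : R) <= 2 ^+ m by rewrite -natrX ler_nat ltnW// ltn_expl.
rewrite ltr_pdivrMr ?exprn_gt0// mulrC -ltr_pdivrMr//.
apply: le_lt_trans (lt_le_trans h m2).
by rewrite ler_pM2r ?invr_gt0// ler_norm.
Qed.

(** With [w m] the tail of the geometric series, the intervals of centre [u m] and radius [w m] are
    nested; [v] is the supremum of their left ends. *)
Lemma geometric_limit (R : realType) (u : nat -> R) (K : R) :
  (forall m, `|u m.+1 - u m| <= K / 2 ^+ m) ->
  exists v, forall m, `|u m - v| <= 2 * K / 2 ^+ m.
Proof.
move=> uK; pose w m := 2 * K / 2 ^+ m.
have wS m : w m.+1 + K / 2 ^+ m = w m.
  by rewrite /w exprS; field; rewrite expf_neq0.
have lo m n : (m <= n)%N -> u m - w m <= u n - w n.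
  elim: n => [|n ih]; first by rewrite leqn0 => /eqP ->.
  rewrite leq_eqVlt => /predU1P[->//|/ih{}ih].
  by have := uK n; rewrite ler_norml => /andP[? _]; have := wS n; lra.
have hi m n : (m <= n)%N -> u n + w n <= u m + w m.
  elim: n => [|n ih]; first by rewrite leqn0 => /eqP ->.
  rewrite leq_eqVlt => /predU1P[->//|/ih{}ih].
  by have := uK n; rewrite ler_norml => /andP[_ ?]; have := wS n; lra.
have K0 : 0 <= K by have := le_trans (normr_ge0 _) (uK 0%N); rewrite expr0 divr1.
have w0 m : 0 <= w m by rewrite /w divr_ge0 ?mulr_ge0 ?exprn_ge0.
have lh m n : u n - w n <= u m + w m.
  have := lo n (maxn m n) (leq_maxr _ _); have := hi m (maxn m n) (leq_maxl _ _).
  by have := w0 (maxn m n); lra.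
pose S := [set u n - w n | n in [set: nat]].
have hS : has_sup S.
  split; first by exists (u 0%N - w 0%N), 0%N.
  by exists (u 0%N + w 0%N) => _ [n _ <-].
exists (sup S) => m; rewrite -/(w m).
have h1 : u m - w m <= sup S by apply: ub_le_sup; [case: hS|exists m].
have h2 : sup S <= u m + w m by apply: ge_sup; [case: hS|move=> _ [n _ <-]].
by rewrite ler_norml; apply/andP; split; lra.
Qed.

Section euler_scheme.
Context {R : realType} {d : nat}.
Local Notation E := 'rV[R]_d.+1.
Variables (H : R) (A : R -> R -> E -> E) (om q : R -> R -> R).
Hypothesis H0 : 0 < H.
Hypothesis om0 : forall (s t : R), 0 <= om s t.
Hypothesis omD : forall (s t u : R), 0 <= s -> s <= t -> t <= u -> u <= H ->
  om s u = om s t + om t u.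
Hypothesis q0 : forall (s t : R), 0 <= q s t.
Hypothesis qD : forall (s t u : R), 0 <= s -> s <= t -> t <= u -> u <= H ->
  q s u = q s t + q t u.
Hypothesis omq : forall (s t : R), 0 <= s -> s < t -> t <= H -> om s t ^+ 2 <= (t - s) * q s t.
Hypothesis Anorm : forall (s t : R) (x : E), 0 <= s -> t <= H -> `|A s t x| <= om s t.
Hypothesis Alip : forall (s t : R) (x y : E), 0 <= s -> t <= H -> `|A s t x - A s t y| <= om s t * `|x - y|.
Hypothesis AD : forall (s t u : R) (x : E), 0 <= s -> s <= t -> t <= u -> u <= H ->
  A s u x = A s t x + A t u x.

Fixpoint euler (tau : nat -> R) (n : nat) (x : E) : E :=
  if n is m.+1 then euler tau m x + A (tau m) (tau m.+1) (euler tau m x) else x.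

Section one_mesh.
Variable tau : nat -> R.
Hypothesis tau0 : 0 <= tau 0%N.
Hypothesis tauS : forall k, tau k <= tau k.+1.

Let tau_ge0 k : 0 <= tau k.
Proof. by elim: k => // k; move/le_trans; apply. Qed.

Let tau_le k : tau 0%N <= tau k.
Proof. by elim: k => // k; move/le_trans; apply. Qed.

(** One step of a discrete Gronwall argument: [1 + om <= exp om], and [om] is additive. *)
Lemma exp_omS n : tau n.+1 <= H ->
  (1 + om (tau n) (tau n.+1)) * expR (om (tau 0%N) (tau n)) <= expR (om (tau 0%N) (tau n.+1)).
Proof.
move=> nH; rewrite (@omD (tau 0%N) (tau n) (tau n.+1))//.
by rewrite expRD mulrC; apply: ler_wpM2l; rewrite ?expR_ge0 ?expR_ge1Dx.
Qed.

Lemma euler_lipschitz n x y : tau n <= H ->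
  `|euler tau n x - euler tau n y| <= expR (om (tau 0%N) (tau n)) * `|x - y|.
Proof.
elim: n => [|n ih] nH /=.
  by apply: ler_peMl => //; apply: le_trans (expR_ge1Dx _); rewrite lerDl.
rewrite opprD addrACA; apply: le_trans (ler_normD _ _) _.
have {}ih := ih (le_trans (tauS n) nH).
apply: le_trans (lerD (lexx _) (Alip _ _ (tau_ge0 n) nH)) _.
rewrite -[X in X + _]mul1r -mulrDl.
apply: le_trans (ler_wpM2l _ ih) _; first by rewrite addr_ge0.
by rewrite mulrA; apply: ler_wpM2r => //; exact: exp_omS.
Qed.

(* Two half steps and the full step differ by the oscillation of the second
   half step, hence by at most [om ^ 2]. *)
Lemma euler_refine (sig : nat -> R) n x : (forall k, sig k.*2 = tau k) ->
  (forall k, sig k <= sig k.+1) -> tau n <= H ->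
  `|euler sig n.*2 x - euler tau n x| <=
    expR (om (tau 0%N) (tau n)) * \sum_(j < n) om (tau j) (tau j.+1) ^+ 2.
Proof.
move=> sigE sigS; elim: n => [|n ih] nH.
  by rewrite double0/= subrr normr0 big_ord0 mulr0.
have {}ih := ih (le_trans (tauS n) nH).
rewrite doubleS /= sigE -doubleS sigE.
set y := euler sig _ x in ih *; set z := euler tau n x in ih *.
set s := tau n; set r := sig n.*2.+1; set t := tau n.+1.
have sr : s <= r by rewrite /s -sigE.
have rt : r <= t by rewrite /t -(sigE n.+1) doubleS; exact: sigS.
have s0 : 0 <= s := tau_ge0 n.
have rH : r <= H := le_trans rt nH.
have -> : y + A s r y + A r t (y + A s r y) - (z + A s t z) =
    (y - z) + (A s t y - A s t z) + (A r t (y + A s r y) - A r t y).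
  by rewrite (AD y s0 sr rt nH); apply/rowP => i; rewrite !mxE; ring.
apply: le_trans (ler_normD _ _) _.
have h1 : `|A r t (y + A s r y) - A r t y| <= om s t ^+ 2.
  apply: le_trans (Alip _ _ (le_trans s0 sr) nH) _.
  rewrite addrAC subrr add0r expr2; have := omD s0 sr rt nH => E1.
  apply: ler_pM => //; first by rewrite E1 lerDr.
  by apply: le_trans (Anorm _ s0 rH) _; rewrite E1 lerDl.
have h2 : `|(y - z) + (A s t y - A s t z)| <= (1 + om s t) * `|y - z|.
  by apply: le_trans (ler_normD _ _) _; rewrite mulrDl mul1r lerD2l; exact: Alip.
apply: le_trans (lerD (le_trans h2 (ler_wpM2l _ ih)) h1) _; first by rewrite addr_ge0.
rewrite big_ord_recr/= mulrDr; apply: lerD.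
  rewrite mulrA; apply: ler_wpM2r; last exact: exp_omS.
  by apply: sumr_ge0 => j _; exact: sqr_ge0.
apply: ler_peMl; first exact: sqr_ge0.
by apply: le_trans (expR_ge1Dx _); rewrite lerDl.
Qed.

(** Square integrability of the majorant enters here: by Cauchy-Schwarz the square of [om] over a
    step is at most the mesh times [q], and [q] is additive. *)
Lemma sum_om_sq (e : R) n : 0 < e -> (forall k, tau k.+1 = tau k + e) -> tau n <= H ->
  \sum_(j < n) om (tau j) (tau j.+1) ^+ 2 <= e * q (tau 0%N) (tau n).
Proof.
move=> e0 tauE; elim: n => [|n ih] nH; first by rewrite big_ord0 mulr_ge0// ltW.
rewrite big_ord_recr/= (@qD _ (tau n))// mulrDr; apply: lerD.
  exact: ih (le_trans (tauS n) nH).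
have := @omq (tau n) (tau n.+1) (tau_ge0 n); rewrite tauE addrAC subrr add0r.
by apply; [rewrite ltrDl|rewrite -tauE].
Qed.

(* [N u t] stands for the integral against the measure at time [t] of a
   mollification of [u]. *)
Lemma euler_transport (N : (E -> R) -> R -> R) (Cl : R -> (E -> R) -> Prop) (c e : R) n u L :
  0 <= c -> 0 <= e ->
  (forall L u s t, Cl L u -> 0 <= s -> s <= t -> t <= H ->
     [/\ 0 <= L, Cl (L * (1 + om s t)) (fun x => u (x + A s t x)) &
      `|N u t - N (fun x => u (x + A s t x)) s| <= L * (c * om s t ^+ 2 + e * om s t)]) ->
  Cl L u -> tau n <= H ->
  `|N u (tau n) - N (u \o euler tau n) (tau 0%N)| <=
    L * expR (om (tau 0%N) (tau n)) *
      (c * \sum_(j < n) om (tau j) (tau j.+1) ^+ 2 + e * om (tau 0%N) (tau n)).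
Proof.
move=> c0 e0 step; elim: n u L => [|n ih] u L uL nH.
  have [L0 _ _] := step _ _ _ _ uL tau0 (lexx _) nH.
  have -> : u \o euler tau 0 = u by apply/funext.
  by rewrite subrr normr0 !mulr_ge0 ?expR_ge0// addr_ge0// mulr_ge0// big_ord0.
have nH' := le_trans (tauS n) nH.
have [L0 uL' h] := step _ _ _ _ uL (tau_ge0 n) (tauS n) nH.
have {}ih := ih _ _ uL' nH'.
(* The last Euler step is absorbed into the test function, whose Lipschitz constant grows by the
   factor [1 + om]; the remaining steps are left to the induction hypothesis. *)
have -> : u \o euler tau n.+1 =
    (fun x => u (x + A (tau n) (tau n.+1) x)) \o euler tau n by apply/funext.
rewrite -[X in `|X|](subrKA (N (fun x => u (x + A (tau n) (tau n.+1) x)) (tau n))).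
apply: le_trans (ler_normD _ _) _; apply: le_trans (lerD h ih) _.
set w := om (tau n) (tau n.+1); set W := om (tau 0%N) (tau n).
set S := \sum_(j < n) _.
have W1 : om (tau 0%N) (tau n.+1) = W + w by exact: omD.
rewrite big_ord_recr/= -/S -/w W1.
have x1 : 1 <= expR (W + w).
  by apply: le_trans (expR_ge1Dx _); rewrite lerDl; apply: addr_ge0; exact: om0.
have x2 : (1 + w) * expR W <= expR (W + w) by rewrite -W1; exact: exp_omS.
have S0 : 0 <= S by apply: sumr_ge0 => j _; exact: sqr_ge0.
have a0 : 0 <= c * w ^+ 2 + e * w by rewrite addr_ge0 ?mulr_ge0 ?sqr_ge0// om0.
have b0 : 0 <= c * S + e * W by rewrite addr_ge0 ?mulr_ge0// om0.
have -> : c * (S + w ^+ 2) + e * (W + w) = (c * w ^+ 2 + e * w) + (c * S + e * W) by ring.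
rewrite -!mulrA -mulrDr; apply: ler_wpM2l => //.
rewrite [leRHS]mulrDr; apply: lerD; first exact: ler_peMl.
by rewrite mulrA; apply: ler_wpM2r.
Qed.

End one_mesh.

(** Halving every step turns each mesh into the next, which is the situation of [euler_refine]. *)
Definition grid (m k : nat) : R := k%:R * (H / 2 ^+ m).

Let step_gt0 m : 0 < H / 2 ^+ m. Proof. by rewrite divr_gt0 ?exprn_gt0. Qed.

Lemma gridS m k : grid m k.+1 = grid m k + H / 2 ^+ m.
Proof. by rewrite /grid -natr1 mulrDl mul1r. Qed.

Lemma grid_le m k : grid m k <= grid m k.+1.
Proof. by rewrite gridS lerDl ltW. Qed.

Lemma grid0 m : grid m 0 = 0. Proof. by rewrite /grid mul0r. Qed.

Lemma grid_end m : grid m (2 ^ m) = H.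
Proof. by rewrite /grid natrX mulrC divfK// expf_neq0. Qed.

Lemma grid_double m k : grid m.+1 k.*2 = grid m k.
Proof. by rewrite /grid -mul2n natrM exprS; field; rewrite expf_neq0. Qed.

Definition euler_grid m := euler (grid m) (2 ^ m).

(** The amplification [exp om] times the bound [H / 2 ^+ m * q] on the sum of the squares of [om],
    without its factor [2 ^- m]. *)
Let K0 := expR (om 0 H) * q 0 H * H.

Lemma exists_euler_limit : exists X : E -> E,
  (forall m x, `|euler_grid m x - X x| <= 2 * K0 / 2 ^+ m) /\
  (forall x y, `|X x - X y| <= expR (om 0 H) * `|x - y|).
Proof.
have K00 : 0 <= K0 by rewrite /K0 !mulr_ge0 ?expR_ge0// ltW.
have h m x : `|euler_grid m.+1 x - euler_grid m x| <= K0 / 2 ^+ m.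
  rewrite /euler_grid expnS mul2n.
  have tauH : grid m (2 ^ m) <= H by rewrite grid_end.
  apply: le_trans (euler_refine _ (grid_le m) x (grid_double m) (grid_le m.+1) tauH) _.
    by rewrite grid0.
  rewrite grid0 grid_end /K0 -!mulrA; apply: ler_wpM2l; first exact: expR_ge0.
  have := sum_om_sq _ (grid_le m) (step_gt0 m) (gridS m) tauH.
  by rewrite grid0 grid_end [q 0 H * _]mulrC; apply.
have lim x i : exists v, forall m, `|euler_grid m x ord0 i - v| <= 2 * K0 / 2 ^+ m.
  apply: geometric_limit => m; apply: le_trans (h m x).
  by have := coord_le_norm (euler_grid m.+1 x - euler_grid m x) i; rewrite !mxE.
have {lim} [X XE] := choice (fun z : E * 'I_d.+1 => lim z.1 z.2).
exists (fun x => \row_i X (x, i)).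
have XE' m x : `|euler_grid m x - \row_i X (x, i)| <= 2 * K0 / 2 ^+ m.
  by apply: norm_le_coord => i; rewrite !mxE; exact: (XE (x, i)).
split => // x y; apply/ler_addgt0Pr => e e0.
have [m hm] := exists_div_exp2_lt (4 * K0) e0.
have h1 := XE' m x; have h2 := XE' m y.
have h3 : `|euler_grid m x - euler_grid m y| <= expR (om 0 H) * `|x - y|.
  have := @euler_lipschitz (grid m) _ (grid_le m) (2 ^ m) x y.
  by rewrite grid_end grid0; apply.
have := ler_normD (euler_grid m x - \row_i X (x, i)) (\row_i X (y, i) - euler_grid m y).
move: h2; rewrite distrC; set b := `|_ - euler_grid m y| => h2 h4.
rewrite -[X in `|X|](subrKA (euler_grid m x)).
apply: le_trans (ler_normD _ _) _; rewrite (distrC (\row_i X (x, i))).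
rewrite -[X in _ + `|X| <= _](subrKA (euler_grid m y)).
have := ler_normD (euler_grid m x - euler_grid m y) (euler_grid m y - \row_i X (y, i)).
rewrite (distrC _ (\row_i X (y, i))) -/b.
have E1 : 4 * K0 / 2 ^+ m = 2 * K0 / 2 ^+ m + 2 * K0 / 2 ^+ m by ring.
by rewrite E1 in hm; have {}e0 : 0 < (e : R) by []; lra.
Qed.

End euler_scheme.

(** * Lipschitz test functions, their mollification and their transport *)

Section test_classes.
Context {R : realType} {d : nat}.
Local Notation E := 'rV[R]_d.+1.
Implicit Types (D : domain R d) (u v : E -> R).

Definition periodic_by (L : R) (T : Type) (u : E -> T) :=
  forall x i, u (x + (2 * L) *: delta_mx ord0 i) = u x.

(** The part of [test_function] that is not smoothness; it survives both mollification and
    composition with an Euler step, which smoothness does not. *)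
Definition tclass D u :=
  if D is Torus L then periodic_by L u
  else exists M, forall x, M < enorm x -> u x = 0.

Lemma tclass_transfer D u v : tclass D u ->
  (forall L, D = Torus L -> periodic_by L u -> periodic_by L v) ->
  (forall M, (forall x, M < enorm x -> u x = 0) ->
     exists M', forall x, M' < enorm x -> v x = 0) ->
  tclass D v.
Proof.
case: D => [|Om|L] /= Hu Hp Hw.
- by have [M /Hw] := Hu.
- by have [M /Hw] := Hu.
- exact: Hp.
Qed.

Lemma periodic_grad (L : R) v : periodic_by L v -> periodic_by L (grad v).
Proof.
move=> pv x i; apply/rowP => j; rewrite !mxE /derive.
have -> // : (fun h : R => h^-1 *: ((v \o shift (x + (2 * L) *: delta_mx ord0 i)) (h *: delta_mx ord0 j) -
    v (x + (2 * L) *: delta_mx ord0 i))) =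
  (fun h : R => h^-1 *: ((v \o shift x) (h *: delta_mx ord0 j) - v x)).
by apply/funext => h /=; rewrite pv addrA pv.
Qed.

Lemma grad_supp v (M : R) : (forall x, M < enorm x -> v x = 0) ->
  forall x, M < enorm x -> grad v x = 0.
Proof.
move=> vM x Mx; apply/rowP => j; rewrite !mxE.
rewrite (@near_eq_derive _ _ _ v (cst 0)) ?derive_cst//.
have ce : continuous (@enorm R d).
  apply: (@lipschitz_continuous_rV _ _ _ d.+1%:R) => y z.
  exact: le_trans (enorm_lipschitz _ _) (enorm_le_norm _).
have hM : nbhs (enorm x) [set r : R | M < r] by exact: open_nbhs_nbhs.
have h : \forall y \near x, M < enorm y := ce x _ hM.
by near=> y; apply: vM; near: y.
Unshelve. all: by end_near. Qed.

Definition bounded_lipschitz D (B L : R) u :=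
  [/\ 0 <= L, forall x, `|u x| <= B, forall x y, `|u x - u y| <= L * `|x - y| & tclass D u].

Lemma smooth_partial_continuous u i : smooth u -> continuous ('D_(delta_mx ord0 i) u).
Proof. by move=> /(_ [:: i])[]. Qed.

Lemma smooth_partial_derivable u i x : smooth u -> derivable u x (delta_mx ord0 i).
Proof. by move=> /(_ [::])[_ ]. Qed.

Section one_mollifier.
Variables (D : domain R d) (e C : R) (M : (E -> R) -> E -> R).
Hypothesis HM : forall (u : E -> R) (B L : R), (forall x, `|u x| <= B) ->
    (forall x y, `|u x - u y| <= L * `|x - y|) ->
  [/\ smooth (M u),
      forall i x y, `|'D_(delta_mx ord0 i) (M u) x - 'D_(delta_mx ord0 i) (M u) y|
        <= C * L * `|x - y| &
      forall (w : E -> R) (B' L' c : R) (x y : E), (forall x, `|w x| <= B') ->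
        (forall x y, `|w x - w y| <= L' * `|x - y|) ->
        (forall z, `|z| <= e -> `|u (z + x) - w (z + y)| <= c) ->
        `|M u x - M w y| <= c] /\
  forall c x, M (cst c) x = c.
Variables (u : E -> R) (B L : R).
Hypothesis uBL : bounded_lipschitz D B L u.

Let cst_lip (c : R) (x y : E) : `|cst c x - cst c y| <= 0 * `|x - y|.
Proof. by rewrite /= subrr normr0 mul0r. Qed.

Let avg_cst (c m : R) x : (forall z, `|z| <= e -> `|u (z + x) - c| <= m) -> `|M u x - c| <= m.
Proof.
have [L0 uB uL _] := uBL; have [[_ _ av] Mc] := HM uB uL.
move=> h; rewrite -[X in `|_ - X|](Mc c 0).
by apply: (av (cst c) `|c| 0) => //; exact: cst_lip.
Qed.

Lemma mollify_bounded_lipschitz : bounded_lipschitz D B L (M u).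
Proof.
have [L0 uB uL uT] := uBL; have [[_ _ av] Mc] := HM uB uL; split => //.
- move=> x; rewrite -[M u x]subr0; apply: avg_cst => z _; rewrite subr0; exact: uB.
- move=> x y; apply: (av u B L) => // z _.
  by apply: le_trans (uL _ _) _; rewrite opprD addrACA subrr add0r.
- apply: tclass_transfer uT _ _ => [K DK pu x i|K uK].
    apply/eqP; rewrite -subr_eq0 -normr_le0; apply: (av u B L) => // z _.
    by rewrite addrA pu subrr normr0.
  exists (K + d.+1%:R * e) => x Kx; apply/eqP; rewrite -normr_le0 -[M u x]subr0.
  apply: avg_cst => z ze; rewrite subr0 uK ?normr0//.
  have := enormD (z + x) (- z); rewrite addrAC subrr add0r enormN.
  have : enorm z <= d.+1%:R * e by apply: le_trans (enorm_le_norm _) (ler_wpM2l _ ze).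
  by lra.
Qed.

Lemma mollify_test_function : test_function D (M u).
Proof.
have [L0 uB uL uT] := uBL; have [[sm _ _] _] := HM uB uL; split => //.
by have [_ _ _] := mollify_bounded_lipschitz.
Qed.

Lemma mollify_partial_bound i x : `|'D_(delta_mx ord0 i) (M u) x| <= L.
Proof.
have [_ _ lip _] := mollify_bounded_lipschitz; apply: derive_lipschitz => //.
by apply: smooth_partial_derivable; case: mollify_test_function.
Qed.

Lemma mollify_partial_lipschitz i x y :
  `|'D_(delta_mx ord0 i) (M u) x - 'D_(delta_mx ord0 i) (M u) y| <= C * L * `|x - y|.
Proof. by have [_ uB uL _] := uBL; have [[_ h _] _] := HM uB uL. Qed.

Lemma mollify_close x : `|M u x - u x| <= L * e.
Proof.
have [L0 _ uL _] := uBL; apply: avg_cst => z ze.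
by apply: le_trans (uL _ _) _; rewrite addrK; exact: ler_wpM2l.
Qed.

End one_mollifier.

(** Averaging after the shift samples [u] at [z + x + A x], averaging before it at
    [z + x + A (z + x)]. These points differ by [A x - A (z + x)], at most [w * e] for [z] in the
    support of the kernel. *)
Lemma mollify_comm (D : domain R d) (e : R) (M : (E -> R) -> E -> R) (u : E -> R)
    (B L w : R) (A : E -> E) x : 0 <= w -> bounded_lipschitz D B L u ->
  (forall (u : E -> R) (B L : R), (forall x, `|u x| <= B) ->
    (forall x y, `|u x - u y| <= L * `|x - y|) ->
    forall (w : E -> R) (B' L' c : R) (x y : E), (forall x, `|w x| <= B') ->
        (forall x y, `|w x - w y| <= L' * `|x - y|) ->
        (forall z, `|z| <= e -> `|u (z + x) - w (z + y)| <= c) ->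
        `|M u x - M w y| <= c) ->
  (forall x y, `|A x - A y| <= w * `|x - y|) ->
  `|M u (x + A x) - M (fun y => u (y + A y)) x| <= L * (w * e).
Proof.
move=> w0 [L0 uB uL uT] av Aw.
apply: (av u B L uB uL _ B (L * (1 + w))) => [y|y z|z ze]; first exact: uB.
  apply: le_trans (uL _ _) _; rewrite -mulrA; apply: ler_wpM2l => //.
  rewrite opprD addrACA mulrDl mul1r; apply: le_trans (ler_normD _ _) _.
  by rewrite lerD2l.
apply: le_trans (uL _ _) _; apply: ler_wpM2l => //.
have -> : z + (x + A x) - (z + x + A (z + x)) = A x - A (z + x).
  by apply/rowP => i; rewrite !mxE; ring.
apply: le_trans (Aw _ _) _; apply: ler_wpM2l => //.
by rewrite opprD addrCA subrr addr0 normrN.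
Qed.

End test_classes.

(** * Identification of a weak solution with the image under a flow *)

Section transport.
Context {R : realType} {d : nat}.
Local Notation E := 'rV[R]_d.+1.
Local Notation leb := (@lebesgue_measure R).
Variables (D : domain R d) (H : R) (l : R -> R) (a : R -> E -> E).
Variable mu : measurableTypeR R -> probability E R.
Hypothesis H0 : 0 < H.
Hypothesis ml : measurable_fun [set: measurableTypeR R] l.
Hypothesis l0 : forall t, 0 <= l t.
Hypothesis l2 : (\int[leb]_(t in `[0%R, H]) ((l t) ^+ 2)%:E < +oo)%E.
Hypothesis ma : measurable_fun setT (fun z : measurableTypeR R * E => a z.1 z.2).
Hypothesis ab : forall t x, `|a t x| <= l t.
Hypothesis al : forall t x y, `|a t x - a t y| <= l t * `|x - y|.
Hypothesis ap : forall L, D = Torus L -> forall t, periodic_by L (a t).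
Hypothesis mmu : forall A, measurable A -> measurable_fun setT (fun t => mu t A).
Hypothesis weak : forall phi (b : R), test_function D phi ->
  (forall i x, `|'D_(delta_mx ord0 i) phi x| <= b) -> forall s t : R, 0 <= s -> s <= t -> t <= H ->
  \int[mu t]_x phi x - \int[mu s]_x phi x =
  int_oc (fun r => \int[mu r]_x dotv (a r x) (grad phi x)) s t.

Local Notation om := (int_oc l).
Local Notation A := (displacement a).
Local Notation n := (d.+1%:R : R).

Let J (u : E -> R) (t : R) := \int[mu t]_x u x.

Let m_bl B L u : bounded_lipschitz D B L u -> measurable_fun setT u.
Proof. by move=> [_ _ uL _]; exact: lipschitz_measurable_rV uL. Qed.

Let m_field (g : E -> E) : (forall i, measurable_fun setT (fun x => g x ord0 i)) ->
  measurable_fun setT (fun z : measurableTypeR R * E => dotv (a z.1 z.2) (g z.2)).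
Proof.
move=> mg; apply: measurable_sum => i; apply: measurable_funM.
  exact: (measurableT_comp (measurable_coord i) ma).
exact: (measurableT_comp (mg i) measurable_snd).
Qed.

Let m_grad (phi : E -> R) : smooth phi -> forall i, measurable_fun setT (fun x => grad phi x ord0 i).
Proof.
move=> sphi i.
have -> : (fun x => grad phi x ord0 i) = 'D_(delta_mx ord0 i) phi by apply/funext => x; rewrite mxE.
by apply: continuous_measurable_rV; exact: smooth_partial_continuous.
Qed.

Let m_sec (f : R -> E -> R) r :
  measurable_fun setT (fun z : measurableTypeR R * E => f z.1 z.2) ->
  measurable_fun setT (f r).
Proof. by move=> mf; exact: (measurableT_comp mf (pair1_measurable (r : measurableTypeR R))). Qed.

Let field_bound (phi : E -> R) (b : R) r x : (forall i x, `|'D_(delta_mx ord0 i) phi x| <= b) ->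
  `|dotv (a r x) (grad phi x)| <= n * b * l r.
Proof.
move=> hb; apply: le_trans (dotv_norm_le _ (b := b) _) _.
  by move=> i; rewrite mxE.
rewrite -mulrA; apply: ler_wpM2l => //; rewrite mulrC; apply: ler_wpM2l => //.
exact: le_trans (normr_ge0 _) (hb ord0 0).
Qed.

Lemma test_integral_lipschitz phi (b s t : R) : test_function D phi ->
  (forall i x, `|'D_(delta_mx ord0 i) phi x| <= b) -> 0 <= s -> s <= t -> t <= H ->
  `|J phi t - J phi s| <= n * b * om s t.
Proof.
move=> tphi hb s0 st tH; rewrite /J (weak tphi hb)//.
apply: (int_oc_norm ml l0 l2) => //.
  apply: (measurable_Rintegral_kernel mmu (f := fun r x => dotv (a r x) (grad phi x))).
  by apply: m_field; apply: m_grad; case: tphi.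
move=> r _; apply: prob_Rintegral_norm => [|x]; last exact: field_bound.
apply: (m_sec (f := fun r x => dotv (a r x) (grad phi x))).
by apply: m_field; apply: m_grad; case: tphi.
Qed.

(** Extends the previous estimate from test functions to Lipschitz ones by mollifying with a
    vanishing radius. It is needed for the integrands [dotv (a r x) (grad v x)], which are no
    smoother in [x] than the field. *)
Lemma integral_lipschitz B L u (s t : R) : bounded_lipschitz D B L u ->
  0 <= s -> s <= t -> t <= H -> `|J u t - J u s| <= n * L * om s t.
Proof.
move=> uB s0 st tH; apply/ler_addgt0Pr => e; move=> e0; have {}e0 : 0 < (e : R) by [].
have L0 : 0 <= L by case: uB.
pose h : R := e / (2 * (L + 1)).
have h0 : 0 < h by rewrite divr_gt0// mulr_gt0// ltr_wpDl.
have [M [C [C0 HM]]] := @exists_mollifier R d h h0.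
have MB := mollify_bounded_lipschitz HM uB.
have close r : `|J u r - J (M u) r| <= L * h.
  case: (uB) => _ u1 _ _; case: (MB) => _ u2 _ _.
  apply: (@prob_Rintegral_dist _ _ _ (mu r) u (M u) B B) => //; [exact: m_bl uB|exact: m_bl MB|].
  by move=> x; rewrite distrC; exact: (mollify_close HM uB).
have main := test_integral_lipschitz (mollify_test_function HM uB)
  (mollify_partial_bound HM uB) s0 st tH.
have h1 := close t; have h2 := close s.
have h3 : L * h + L * h <= e.
  have -> : L * h + L * h = e * ((L * 2) / (2 * (L + 1))).
    by rewrite /h; field; rewrite gt_eqF// ltr_wpDl.
  rewrite -[leRHS]mulr1; apply: ler_wpM2l; first exact: ltW.
  rewrite ler_pdivrMr ?mulr_gt0// ?ltr_wpDl//; lra.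
have := ler_normD (J u t - J (M u) t) (J (M u) t - J (M u) s).
rewrite subrKA => h4.
have := ler_normD (J u t - J (M u) s) (J (M u) s - J u s); rewrite subrKA.
rewrite (distrC (J (M u) s)); lra.
Qed.

Let int_oc_sum (I : Type) (r : seq I) (f : I -> R -> R) (s t : R) :
  (forall i, leb.-integrable `]s, t] (EFin \o f i)) ->
  leb.-integrable `]s, t] (EFin \o (fun x => \sum_(i <- r) f i x)) /\
  int_oc (fun x => \sum_(i <- r) f i x) s t = \sum_(i <- r) int_oc (f i) s t.
Proof.
move=> iF; elim: r => [|i r [ih1 ih2]].
  have -> : (fun x : R => \sum_(i <- [::]) f i x) = cst 0 by apply/funext => x; rewrite big_nil.
  split; first by exact: integrable0.
  by rewrite big_nil /int_oc Rintegral_cst ?mul0r//; exact: measurable_itv.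
have -> : (fun x : R => \sum_(j <- i :: r) f j x) = (fun x => f i x + \sum_(j <- r) f j x).
  by apply/funext => x; rewrite big_cons.
split; first by apply: real_integrableD => //; exact: measurable_itv.
by rewrite big_cons -ih2 /int_oc RintegralD//; exact: measurable_itv.
Qed.

Lemma int_oc_dotv (x y : E) (s t : R) : 0 <= s -> t <= H ->
  int_oc (fun r => dotv (a r x) y) s t = dotv (A s t x) y.
Proof.
move=> s0 tH.
have mai i : measurable_fun [set: measurableTypeR R] (fun r => a r x ord0 i).
  exact: (measurableT_comp (measurable_coord i) (measurableT_comp ma (pair2_measurable x))).
have iai i : leb.-integrable `]s, t] (EFin \o (fun r => a r x ord0 i)).
  apply: (dominated_integrable ml l0 l2 (c := 1)) => // r _; rewrite mul1r.
  exact: le_trans (coord_le_norm _ _) (ab r x).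
have iay i : leb.-integrable `]s, t] (EFin \o (fun r => y ord0 i * a r x ord0 i)).
  by apply: real_integrableZ => //; exact: measurable_itv.
rewrite /dotv (_ : (fun r => _) = (fun r => \sum_i y ord0 i * a r x ord0 i)); last first.
  by apply/funext => r; apply: eq_bigr => i _; rewrite mulrC.
rewrite (int_oc_sum _ iay).2; apply: eq_bigr => i _.
by rewrite mxE mulrC /int_oc RintegralZl//; exact: measurable_itv.
Qed.

Lemma smooth_transport v (B b K s t : R) : test_function D v -> (forall x, `|v x| <= B) ->
  0 <= K -> (forall i x, `|'D_(delta_mx ord0 i) v x| <= b) ->
  (forall i x y, `|'D_(delta_mx ord0 i) v x - 'D_(delta_mx ord0 i) v y| <= K * `|x - y|) ->
  0 <= s -> s <= t -> t <= H ->
  `|J v t - \int[mu s]_x v (x + A s t x)| <= (n * n * (b + K) + n * K) * om s t ^+ 2.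
Proof.
move=> tv vB K0 vb vK s0 st tH.
have sv : smooth v by case: tv.
have b0 : 0 <= b := le_trans (normr_ge0 _) (vb ord0 0).
pose f r x := dotv (a r x) (grad v x).
have mf : measurable_fun setT (fun z : measurableTypeR R * E => f z.1 z.2).
  by apply: m_field; exact: m_grad.
have fb r x : `|f r x| <= n * b * l r by exact: field_bound.
have fBL r : bounded_lipschitz D (n * b * l r) (n * (b + K) * l r) (f r).
  split => //; first by rewrite !mulr_ge0 ?addr_ge0.
  - move=> x y.
    have -> : f r x - f r y = dotv (a r x - a r y) (grad v x) + dotv (a r y) (grad v x - grad v y).
      rewrite /f /dotv -sumrB -big_split/=; apply: eq_bigr => i _; rewrite !mxE; ring.
    apply: le_trans (ler_normD _ _) _.
    have h1 : `|dotv (a r x - a r y) (grad v x)| <= n * (l r * `|x - y| * b).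
      apply: le_trans (dotv_norm_le _ (b := b) _) _; first by move=> i; rewrite mxE.
      by apply: ler_wpM2l => //; apply: ler_wpM2r.
    have h2 : `|dotv (a r y) (grad v x - grad v y)| <= n * (l r * (K * `|x - y|)).
      apply: le_trans (dotv_norm_le _ (b := K * `|x - y|) _) _; first by move=> i; rewrite !mxE.
      by apply: ler_wpM2l => //; apply: ler_wpM2r => //; rewrite mulr_ge0.
    by apply: le_trans (lerD h1 h2) _; rewrite le_eqVlt; apply/orP; left; apply/eqP; ring.
  - apply: tclass_transfer tv.2 _ _ => [L DL pv x i|M vM].
      by rewrite /f (ap DL) (periodic_grad pv).
    exists M => x Mx; rewrite /f (grad_supp vM Mx) dotvC /dotv big1// => i _.
    by rewrite mxE mul0r.
have mfr r : measurable_fun setT (f r) by exact: m_sec mf.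
have nrm (P : probability E R) r : `|\int[P]_x f r x| <= n * b * l r.
  by apply: prob_Rintegral_norm; [exact: mfr|exact: fb].
pose g r := \int[mu s]_x f r x.
have mg : measurable_fun [set: measurableTypeR R] g.
  by apply: (@measurable_Rintegral_kernel R d (fun=> mu s) _ f) => // B mB; exact: measurable_cst.
have mG : measurable_fun [set: measurableTypeR R] (fun r => \int[mu r]_x f r x).
  exact: (measurable_Rintegral_kernel mmu (f := f)) mf.
have nn : 0 <= n * n * (b + K) by rewrite !mulr_ge0 ?addr_ge0.
have h1 : `|(J v t - J v s) - int_oc g s t| <= n * n * (b + K) * om s t ^+ 2.
  rewrite /J (weak tv vb)// (int_ocB ml l0 l2 (c := n * b) (c' := n * b))//; last 2 first.
  - by move=> r _; exact: nrm.
  - by move=> r _; exact: nrm.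
  rewrite expr2 mulrA; apply: (int_oc_norm ml l0 l2) => //; first exact: measurable_funB.
  move=> r /andP[sr rt]; rewrite -/(J (f r) r) -/(J (f r) s).
  apply: le_trans (integral_lipschitz (fBL r) s0 (ltW sr) (le_trans rt tH)) _.
  rewrite (om_add ml l0 l2 s0 (ltW sr) rt tH).
  have := om_ge0 l0 r t; set w := om s r; set w' := om r t => w0.
  have : 0 <= n * n * (b + K) * l r * w' by rewrite !mulr_ge0 ?addr_ge0.
  have -> : n * (n * (b + K) * l r) * w = n * n * (b + K) * l r * w by ring.
  have -> : n * n * (b + K) * (w + w') * l r = n * n * (b + K) * l r * w + n * n * (b + K) * l r * w' by ring.
  lra.
have E1 : int_oc g s t = \int[mu s]_x dotv (A s t x) (grad v x).
  rewrite (int_oc_prob ml l0 l2 (mu s) mf fb s0 tH).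
  by congr Rintegral; apply/funext => x; exact: int_oc_dotv.
have w0 := om_ge0 l0 s t.
have AL x y : `|A s t x - A s t y| <= om s t * `|x - y|.
  exact: (displacement_lipschitz ml l0 l2 ma ab al).
have AN x : `|A s t x| <= om s t by exact: (displacement_norm ml l0 l2 ma ab).
have dN x : `|dotv (A s t x) (grad v x)| <= n * b * om s t.
  apply: le_trans (dotv_norm_le _ (b := b) _) _; first by move=> i; rewrite mxE.
  by rewrite -mulrA; apply: ler_wpM2l => //; rewrite mulrC; apply: ler_wpM2l.
have mA i : measurable_fun setT (fun x => A s t x ord0 i).
  apply: (@lipschitz_measurable_rV _ _ _ (om s t)) => x y; apply: le_trans (AL x y).
  by have := coord_le_norm (A s t x - A s t y) i; rewrite !mxE.
have mD : measurable_fun setT (fun x => dotv (A s t x) (grad v x)).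
  by apply: measurable_sum => i; apply: measurable_funM => //; exact: m_grad.
have mv : measurable_fun setT v.
  exact: (continuous_measurable_rV (sv [::]).1).
have mvA : measurable_fun setT (fun x : E => v (x + A s t x)).
  have mid : measurable_fun setT (fun x : E => x + A s t x).
    apply: measurable_fun_coordP => i; under eq_fun do rewrite mxE.
    by apply: measurable_funD => //; exact: measurable_coord.
  exact: (measurableT_comp mv mid).
have i1 := prob_integrable (mu s) mvA (fun x => vB _).
have i2 := prob_integrable (mu s) mv vB.
have i3 := prob_integrable (mu s) mD dN.
have h2 : `|\int[mu s]_x v (x + A s t x) - J v s - int_oc g s t| <= n * (K * om s t ^+ 2).
  have mB : measurable_fun setT (fun x : E => v (x + A s t x) - v x) by exact: measurable_funB.
  have bB (x : E) : `|v (x + A s t x) - v x| <= B + B.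
    by apply: le_trans (ler_normB _ _) _; exact: lerD.
  have i4 := prob_integrable (mu s) mB bB.
  rewrite E1 /J -RintegralB// -RintegralB//.
  apply: prob_Rintegral_norm.
    by apply: measurable_funB => //; apply: measurable_funB.
  have ds i x : derivable v x (delta_mx ord0 i) by exact: smooth_partial_derivable.
  move=> x; have h := taylor1 K0 ds vK x (A s t x).
  apply: le_trans h _.
  apply: ler_wpM2l => //; apply: ler_wpM2l => //.
  by rewrite ler_pXn2r// nnegrE.
rewrite mulrDl; apply: le_trans _ (lerD h1 _); last by rewrite -mulrA; exact: h2.
have := ler_normB (J v t - J v s - int_oc g s t) (\int[mu s]_x v (x + A s t x) - J v s - int_oc g s t).
by rewrite opprB addrA subrK opprB addrA subrK.
Qed.

(** On the torus a periodic field has a periodic displacement; otherwise the support is enlarged by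
    at most [n * om s t]. *)
Lemma bounded_lipschitz_shift B L u (s t : R) : bounded_lipschitz D B L u ->
  0 <= s -> t <= H ->
  bounded_lipschitz D B (L * (1 + om s t)) (fun x => u (x + A s t x)).
Proof.
move=> [L0 uB uL uT] s0 tH.
have w0 := om_ge0 l0 s t.
split => //; first by rewrite mulr_ge0// addr_ge0.
  move=> x y; apply: le_trans (uL _ _) _; rewrite -mulrA; apply: ler_wpM2l => //.
  rewrite opprD addrACA mulrDl mul1r; apply: le_trans (ler_normD _ _) _.
  by rewrite lerD2l; exact: (displacement_lipschitz ml l0 l2 ma ab al).
apply: tclass_transfer uT _ _ => [L' DL pu x i|M uM].
  have -> : A s t (x + (2 * L') *: delta_mx ord0 i) = A s t x.
    by apply/rowP => j; rewrite !mxE; congr Rintegral; apply/funext => r; rewrite (ap DL).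
  by rewrite addrAC pu.
exists (M + n * om s t) => x Mx; apply: uM.
have h : enorm (A s t x) <= n * om s t.
  apply: le_trans (enorm_le_norm _) (ler_wpM2l _ _) => //.
  exact: (displacement_norm ml l0 l2 ma ab).
by have := enormD (x + A s t x) (- A s t x); rewrite addrK enormN; lra.
Qed.

Let W := om 0 H.
Let Q := int_oc (fun r => l r ^+ 2) 0 H.

Theorem exists_flow : exists X : E -> E,
  [/\ forall x y, `|X x - X y| <= expR W * `|x - y|,
      forall x, `|X x - (x + A 0 H x)| <= 2 * (expR W * Q * H) &
      forall B L u, bounded_lipschitz D B L u ->
        \int[mu H]_x u x = \int[mu 0]_x u (X x)].
Proof.
have omD (s t u : R) := @om_add _ _ _ ml l0 l2 s t u.
have qD (s t u : R) : 0 <= s -> s <= t -> t <= u -> u <= H ->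
    int_oc (fun r => l r ^+ 2) s u =
    int_oc (fun r => l r ^+ 2) s t + int_oc (fun r => l r ^+ 2) t u.
  by move=> s0 st tu uH; apply: int_oc_add => //; exact: (integrable_sq ml l2).
have q0 (s t : R) : 0 <= int_oc (fun r => l r ^+ 2) s t.
  by apply: int_oc_ge0 => r; exact: sqr_ge0.
have omq (s t : R) := @int_oc_sq _ _ _ ml l0 l2 s t.
have AN (s t : R) (x : E) := @displacement_norm _ _ _ _ _ ml l0 l2 ma ab s t x.
have AL (s t : R) (x y : E) := @displacement_lipschitz _ _ _ _ _ ml l0 l2 ma ab al s t x y.
have AD (s t u : R) (x : E) := @displacement_add _ _ _ _ _ ml l0 l2 ma ab s t u x.
have [X [XE XL]] := exists_euler_limit H0 (om_ge0 l0) omD q0 qD omq AN AL AD.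
exists X; split => // [x|B L u uB].
  (* The mesh of level [0] consists of a single Euler step over [[0, H]]. *)
  have := XE 0%N x; rewrite expr0 divr1 distrC /euler_grid /= /grid mul0r expr0 divr1 mul1r.
  by rewrite -/W -/Q.
have [L0 ub uL _] := uB.
have K0 : 0 <= expR W * Q * H by rewrite !mulr_ge0 ?expR_ge0 ?q0// ltW.
have w0 : 0 <= W by exact: om_ge0.
set K := expR W * Q * H in K0 *.
have mX i : measurable_fun setT (fun x : E => X x ord0 i).
  apply: (@lipschitz_measurable_rV _ _ _ (expR W)) => x y; apply: le_trans (XL x y).
  by have := coord_le_norm (X x - X y) i; rewrite !mxE.
have mX' : measurable_fun setT X by exact: measurable_fun_coordP.
have mu' : measurable_fun setT u by exact: m_bl uB.
have muX : measurable_fun setT (u \o X) by exact: measurableT_comp.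
(* Mollification errors per unit of the radius [e]: at time [H], at time [0], and from the
   commutators along the scheme. None of them depends on the mesh. *)
pose S : R := L + L * expR W + expR W * L * W.
have S0 : 0 <= S by rewrite !addr_ge0// !mulr_ge0// expR_ge0.
suff key (e : R) : 0 < e -> `|\int[mu H]_x u x - \int[mu 0]_x u (X x)| <= e * S.
  apply/eqP; rewrite -subr_eq0 -normr_le0; apply/ler_addgt0Pr => e; rewrite add0r => e0.
  have {}e0 : 0 < (e : R) by [].
  have S1 : 0 < S + 1 by rewrite ltr_wpDl.
  apply: le_trans (key (e / (S + 1)) (divr_gt0 e0 S1)) _.
  rewrite mulrAC ler_pdivrMr//; apply: ler_wpM2l; [exact: ltW|by rewrite lerDl].
move=> e0; have [M [C [C0 HM]]] := @exists_mollifier R d e e0.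
pose c : R := n * n * (1 + C) + n * C.
have c0 : 0 <= c by rewrite addr_ge0 ?mulr_ge0 ?addr_ge0.
pose N (u : E -> R) t := J (M u) t.
have step (L' : R) (u' : E -> R) (s t : R) : bounded_lipschitz D B L' u' ->
    0 <= s -> s <= t -> t <= H ->
    [/\ 0 <= L', bounded_lipschitz D B (L' * (1 + om s t)) (fun x => u' (x + A s t x)) &
      `|N u' t - N (fun x => u' (x + A s t x)) s| <= L' * (c * om s t ^+ 2 + e * om s t)].
  move=> uB' s0 st tH; have L'0 : 0 <= L' by case: uB'.
  have uA := bounded_lipschitz_shift uB' s0 tH; split => //.
  have vB := mollify_bounded_lipschitz HM uB'.
  have wB := mollify_bounded_lipschitz HM uA.
  have h1 : `|J (M u') t - \int[mu s]_x (M u') (x + A s t x)| <= L' * (c * om s t ^+ 2).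
    apply: le_trans (@smooth_transport _ B L' (C * L') s t (mollify_test_function HM uB') _ _
      (mollify_partial_bound HM uB') (mollify_partial_lipschitz HM uB') s0 st tH) _.
    - by case: vB.
    - exact: mulr_ge0.
    by rewrite /c le_eqVlt; apply/orP; left; apply/eqP; ring.
  have h2 : `|\int[mu s]_x (M u') (x + A s t x) - N (fun x => u' (x + A s t x)) s| <=
      L' * (om s t * e).
    apply: (@prob_Rintegral_dist _ _ _ (mu s) _ _ B B).
    - have := bounded_lipschitz_shift vB s0 tH; exact: m_bl.
    - exact: m_bl wB.
    - by move=> x; case: vB => _ + _ _; apply.
    - by case: wB.
    move=> x; apply: (@mollify_comm _ _ D e M u' B L' (om s t) (A s t) x) => //.
    - exact: om_ge0.
    - by move=> u0 B0 L0' h3 h4; have [[]] := HM u0 B0 L0' h3 h4.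
    - by move=> y z; exact: AL.
  have := ler_normD (J (M u') t - \int[mu s]_x (M u') (x + A s t x))
    (\int[mu s]_x (M u') (x + A s t x) - N (fun x => u' (x + A s t x)) s).
  rewrite subrKA => h3; apply: le_trans h3 _; rewrite mulrDr (mulrC e).
  exact: lerD h1 h2.
(* Since [c] depends on the radius [e] through [C], the mesh is refined here at fixed [e]; [key]
   lets [e] vanish only afterwards. *)
have bound m : `|\int[mu H]_x u x - \int[mu 0]_x u (X x)| <=
    e * S + (expR W * L * c * H * Q + L * (2 * K)) / 2 ^+ m.
  have gH : grid H m (2 ^ m) <= H by rewrite grid_end.
  have g0 : 0 <= grid H m 0 by rewrite grid0.
  have T1 := @euler_transport _ _ _ A om (om_ge0 l0) omD _ g0 (grid_le H0 m)
    N (bounded_lipschitz D B) c e (2 ^ m) u L c0 (ltW e0) step uB gH.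
  rewrite grid_end grid0 -/W in T1.
  have S1 := @sum_om_sq _ _ om _ q0 qD omq _ g0 (grid_le H0 m) (H / 2 ^+ m) (2 ^ m).
  have hm : 0 < H / 2 ^+ m by rewrite divr_gt0// exprn_gt0.
  have {}S1 := S1 hm (gridS H m) gH.
  rewrite grid_end grid0 -/Q in S1.
  pose Em := euler_grid H A m.
  have EL x y : `|Em x - Em y| <= expR W * `|x - y|.
    have := @euler_lipschitz _ _ H A om (om_ge0 l0) omD AL _ g0 (grid_le H0 m) (2 ^ m) x y.
    by rewrite grid_end grid0; apply.
  (* Retained from this is only the periodicity or the bounded support of [u] composed with the
     scheme; the Lipschitz constant comes from [EL], which is uniform in the mesh. *)
  have cls k : forall u L, bounded_lipschitz D B L u -> grid H m k <= H ->
      exists L', bounded_lipschitz D B L' (u \o euler A (grid H m) k).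
    elim: k => [|k ih] v Lv vB kH; first by exists Lv.
    have kS := grid_le H0 m k.
    have k0 : 0 <= grid H m k by rewrite /grid mulr_ge0// divr_ge0 ?exprn_ge0// ltW.
    exact: (ih _ _ (bounded_lipschitz_shift vB k0 kH) (le_trans kS kH)).
  have [L' [_ _ _ tE]] := cls _ _ _ uB gH.
  have EB : bounded_lipschitz D B (L * expR W) (u \o Em).
    split => //; first by rewrite mulr_ge0// expR_ge0.
      by move=> x; exact: ub.
    by move=> x y; apply: le_trans (uL _ _) _; rewrite -mulrA; exact: ler_wpM2l.
  have P1 : `|\int[mu H]_x u x - N u H| <= L * e.
    apply: (@prob_Rintegral_dist _ _ _ (mu H) _ _ B B) => //.
    - exact: m_bl (mollify_bounded_lipschitz HM uB).
    - by case: (mollify_bounded_lipschitz HM uB).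
    by move=> x; rewrite distrC; exact: (mollify_close HM uB).
  have P2 : `|N (u \o Em) 0 - \int[mu 0]_x u (Em x)| <= L * expR W * e.
    apply: (@prob_Rintegral_dist _ _ _ (mu 0) _ _ B B) => //.
    - exact: m_bl (mollify_bounded_lipschitz HM EB).
    - exact: m_bl EB.
    - by case: (mollify_bounded_lipschitz HM EB).
    by move=> x; exact: (mollify_close HM EB).
  have P3 : `|\int[mu 0]_x u (Em x) - \int[mu 0]_x u (X x)| <= L * (2 * K / 2 ^+ m).
    apply: (@prob_Rintegral_dist _ _ _ (mu 0) _ _ B B) => //; first exact: m_bl EB.
    by move=> x; apply: le_trans (uL _ _) _; apply: ler_wpM2l => //; exact: XE.
  have T2 : `|N u H - N (u \o Em) 0| <= L * expR W * (c * (H / 2 ^+ m * Q) + e * W).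
    apply: le_trans T1 _; apply: ler_wpM2l; first by rewrite mulr_ge0// expR_ge0.
    by rewrite lerD2r; exact: ler_wpM2l.
  rewrite -[X in `|X|](subrKA (N u H)) -[X in `|_ + X|](subrKA (N (u \o Em) 0)).
  rewrite -[X in `|_ + (_ + X)|](subrKA (\int[mu 0]_x u (Em x))).
  apply: le_trans (ler_normD _ _) _; apply: le_trans (lerD P1 (ler_normD _ _)) _.
  apply: le_trans (lerD (lexx _) (lerD T2 (ler_normD _ _))) _.
  apply: le_trans (lerD (lexx _) (lerD (lexx _) (lerD P2 P3))) _.
  by rewrite /S le_eqVlt; apply/orP; left; apply/eqP; ring.
apply/ler_addgt0Pr => e' e'0.
have [m hm] := exists_div_exp2_lt (expR W * L * c * H * Q + L * (2 * K)) e'0.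
by apply: le_trans (bound m) _; rewrite lerD2l ltW.
Qed.

End transport.

Lemma max0_lipschitz (R : realType) (p q : R) : `|Num.max 0 p - Num.max 0 q| <= `|p - q|.
Proof.
case: (leP 0 p) => p0; case: (leP 0 q) => q0.
- done.
- rewrite subr0 ger0_norm// ger0_norm; lra.
- rewrite sub0r normrN distrC ger0_norm// ger0_norm; lra.
- by rewrite subrr normr0.
Qed.

Lemma fine_eq (R : realType) (x y : \bar R) :
  x \is a fin_num -> y \is a fin_num -> fine x = fine y -> x = y.
Proof. by move=> fx fy xy; rewrite -(fineK fx) -(fineK fy) xy. Qed.

(** * Determination of measures by Lipschitz functions *)

Section set_distance.
Context {R : realType} {d : nat}.
Local Notation E := 'rV[R]_d.+1.
Local Notation n := (d.+1%:R : R).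
Variables (D : domain R d) (C : set E) (y0 : E).
Hypothesis Cy0 : C y0.

Definition setdist (x : E) : R := inf [set ddist D x y | y in C].

Let has_inf_setdist x : has_inf [set ddist D x y | y in C].
Proof. by split; [exists (ddist D x y0), y0|exists 0 => _ [y _ <-]; exact: ddist_ge0]. Qed.

Lemma setdist_ge0 x : 0 <= setdist x.
Proof. by apply: lb_le_inf; [case: (has_inf_setdist x)|move=> _ [y _ <-]; exact: ddist_ge0]. Qed.

Lemma setdist_le x y : C y -> setdist x <= ddist D x y.
Proof. by move=> Cy; apply: ge_inf; [case: (has_inf_setdist x)|exists y]. Qed.

Lemma setdist_lt x r : setdist x < r -> exists2 y, C y & ddist D x y < r.
Proof. by move=> /(inf_lt (has_inf_setdist x).1)[_ [y Cy <-] xr]; exists y. Qed.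

Lemma setdist_triangle x y : setdist x <= ddist D x y + setdist y.
Proof.
apply/ler_addgt0Pr => e e0; have {}e0 : 0 < (e : R) by [].
have [z Cz yz] := @setdist_lt y (setdist y + e) (ltr_pwDr e0 (lexx _)).
have h1 := setdist_le x Cz; have h2 := ddist_triangle D y x z.
by apply: (le_trans h1); apply: (le_trans h2); rewrite -addrA lerD2l ltW.
Qed.

Lemma setdist_lipschitz x y : `|setdist x - setdist y| <= n * `|x - y|.
Proof.
have h1 := setdist_triangle x y; have h2 := setdist_triangle y x.
have h3 : ddist D x y <= n * `|x - y| by apply: le_trans (ddist_le _ _ _) (enorm_le_norm _).
rewrite (ddistC D y) in h2.
apply: le_trans h3; move: h1 h2; move: (setdist x) (setdist y) (ddist D x y) => p q r h1 h2.
by rewrite ler_norml; apply/andP; split; lra.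
Qed.

(** Lipschitz functions decreasing, as [k] grows, to the indicator of the points at distance zero
    from [C]. *)
Definition setbump (k : nat) (x : E) : R := Num.max 0 (1 - k.+1%:R * setdist x).

Lemma setbump_ge0 k x : 0 <= setbump k x.
Proof. by rewrite /setbump le_max lexx. Qed.

Lemma setbump_le1 k x : setbump k x <= 1.
Proof. by rewrite /setbump ge_max ler01/= gerBl mulr_ge0 ?setdist_ge0. Qed.

Lemma setbump_norm k x : `|setbump k x| <= 1.
Proof. by rewrite ger0_norm ?setbump_ge0 ?setbump_le1. Qed.

Lemma setbump_class k : (exists M, forall y, C y -> enorm y <= M) ->
  bounded_lipschitz D 1 (k.+1%:R * n) (setbump k).
Proof.
move=> [M CM]; split; [by rewrite mulr_ge0|exact: setbump_norm| |].
  move=> x y; rewrite /setbump.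
  have h : `|(1 - k.+1%:R * setdist x) - (1 - k.+1%:R * setdist y)| <= k.+1%:R * n * `|x - y|.
    rewrite opprB addrC addrA subrK -mulrBr normrM ger0_norm// -mulrA.
    by apply: ler_wpM2l => //; rewrite distrC; exact: setdist_lipschitz.
  exact: le_trans (max0_lipschitz _ _) h.
have W : exists M', forall x, M' < enorm x -> forall y, C y -> 1 < enorm (x - y).
  exists (M + 1) => x Mx y Cy; have := CM y Cy; have := enormD (x - y) y.
  by rewrite subrK; lra.
have Z x : (forall y, C y -> 1 < ddist D x y) -> setbump k x = 0.
  move=> hx; rewrite /setbump max_l//.
  have h : 1 <= setdist x.
    by apply: lb_le_inf; [case: (has_inf_setdist x)|move=> _ [y Cy <-]; apply: ltW; exact: hx].
  rewrite subr_le0; apply: le_trans h _; apply: ler_peMl; first exact: setdist_ge0.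
  by rewrite ler1n.
rewrite /tclass; case DE: D => [|Om|L].
- by have [M' h] := W; exists M' => x /h hx; apply: Z; rewrite DE.
- by have [M' h] := W; exists M' => x /h hx; apply: Z; rewrite DE.
- move=> x i; rewrite /setbump; congr (Num.max 0 (1 - _ * _)); rewrite /setdist.
  congr inf; apply/seteqP; split => _ [y Cy <-]; exists y => //; rewrite DE.
    have := torus_ddist_shift L x y (delta_mx ord0 i).
    by rewrite map_delta_mx => ->.
  have := torus_ddist_shift L x y (delta_mx ord0 i).
  by rewrite map_delta_mx => ->.
Qed.

Lemma setbump_cvg x : setbump ^~ x @ \oo --> (\1_[set z | setdist z = 0] x : R).
Proof.
have [x0|x0] := eqVneq (setdist x) 0.
  rewrite indicE mem_set//=.
  rewrite (_ : setbump ^~ x = cst 1); first exact: cvg_cst.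
  by apply/funext => k; rewrite /setbump x0 mulr0 subr0 max_r.
rewrite indicE memNset/=; last by apply/eqP.
have xp : 0 < setdist x by rewrite lt_neqAle eq_sym x0 setdist_ge0.
apply: cvg_near_cst; exists (Num.bound (setdist x)^-1) => // k /= hk.
rewrite /setbump max_l// subr_le0 -ler_pdivrMr// mul1r.
have := archi_boundP (ltW (_ : 0 < (setdist x)^-1)); rewrite invr_gt0 => /(_ xp) h.
by apply: ltW; apply: lt_le_trans h _; rewrite ler_nat leqW.
Qed.

Lemma measurable_setdist0 : measurable [set z | setdist z = 0].
Proof.
have h : measurable_fun setT setdist by apply: (@lipschitz_measurable_rV _ _ _ n); exact: setdist_lipschitz.
have := h measurableT [set 0] (measurable_set1 0).
by rewrite setTI.
Qed.

(** Dominated convergence along the functions [setbump k], which are admissible in the hypothesis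
    because [C] is bounded. *)
Lemma setdist0_pushforward (P P' : probability E R) (X : E -> E) :
  (exists M, forall y, C y -> enorm y <= M) ->
  measurable_fun setT X ->
  (forall B L u, bounded_lipschitz D B L u -> \int[P]_x u x = \int[P']_x u (X x)) ->
  P [set z | setdist z = 0] = P' (X @^-1` [set z | setdist z = 0]).
Proof.
move=> CM mX PX; set Z := [set z | _].
have mZ : measurable Z := measurable_setdist0.
have mb k : measurable_fun setT (setbump k).
  have [_ _ h _] := setbump_class k CM; exact: lipschitz_measurable_rV h.
have lim (Q : probability E R) (f : E -> E) : measurable_fun setT f ->
    (\int[Q]_x (setbump k (f x))%:E)%E @[k --> \oo] --> Q (f @^-1` Z).
  move=> mf.
  have mfZ : measurable (f @^-1` Z) by rewrite -[X in measurable X]setTI; exact: mf.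
  have -> : Q (f @^-1` Z) = (\int[Q]_x (\1_(f @^-1` Z) x)%:E)%E.
    by rewrite integral_indic// setIT.
  have := @dominated_convergence _ _ R Q setT measurableT
    (fun k x => (setbump k (f x))%:E) (fun x => (\1_(f @^-1` Z) x)%:E) (cst 1%E).
  case => //.
  - by move=> k; apply/measurable_EFinP; exact: measurableT_comp (mb k) mf.
  - by apply/measurable_EFinP; exact: measurable_indic.
  - apply/aeW => x _; apply: cvg_EFin; first by apply: nearW.
    exact: (@setbump_cvg (f x)).
  - exact: finite_measure_integrable_cst.
  - by apply/aeW => x k _; rewrite lee_fin; exact: setbump_norm.
have h1 := lim P (fun x => x) (@measurable_id _ _ _).
have h2 := lim P' X mX.
have E1 k : (\int[P]_x (setbump k x)%:E = \int[P']_x (setbump k (X x))%:E)%E.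
  have := PX _ _ _ (setbump_class k CM); rewrite /Rintegral => h.
  have f1 : (\int[P]_x (setbump k x)%:E \is a fin_num)%E.
    apply: integrable_fin_num => //.
    exact: (prob_integrable P (mb k) (setbump_norm k)).
  have f2 : (\int[P']_x (setbump k (X x))%:E \is a fin_num)%E.
    apply: integrable_fin_num => //.
    exact: (prob_integrable P' (measurableT_comp (mb k) mX) (fun x => setbump_norm k (X x))).
  exact: fine_eq f1 f2 h.
have E2 : (fun k => \int[P]_x (setbump k x)%:E)%E =
  (fun k => \int[P']_x (setbump k (X x))%:E)%E by apply/funext.
rewrite E2 in h1; exact: (cvg_unique _ h1 h2).
Qed.

End set_distance.

Section pushforward_determination.
Context {R : realType} {d : nat}.
Local Notation E := 'rV[R]_d.+1.
Variable D : domain R d.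

Definition cbox (l u : E) : set E := [set x | forall i, l ord0 i <= x ord0 i <= u ord0 i].

(** The representative in the cell [(-L, L]]. The ceiling, rather than the floor, matches a cell
    that is open on the left and closed on the right. *)
Definition wrap_point (x : E) : E :=
  if D is Torus L then
    x + (2 * L) *: map_mx intr (\row_i - Num.ceil ((x ord0 i - L) / (2 * L)))
  else x.

(** Only what folding guarantees: for a bounded domain nothing is asserted of the image of the flow
    beyond membership in the whole space. *)
Definition wrap_range : set E := if D is Torus L then carrier D else setT.

Hypothesis hD : admissible D.

Lemma wrap_point_range x : wrap_range (wrap_point x).
Proof.
move: hD; rewrite /wrap_range /wrap_point; case: D => //= L L0 i; rewrite !mxE/=.
have L2 : 0 < 2 * L by rewrite mulr_gt0.
have := ceil_itv ((x ord0 i - L) / (2 * L)); set m := Num.ceil _.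
rewrite ltr_pdivlMr// ler_pdivrMr// intrB intrN => /andP[h1 h2].
apply/andP; split; lra.
Qed.

Lemma ddist_wrapl x y : ddist D (wrap_point x) y = ddist D x y.
Proof. by rewrite /wrap_point; case: D => // L; exact: torus_ddist_shift. Qed.

Lemma ddist_wrap x y : ddist D (wrap_point x) (wrap_point y) <= enorm (x - y).
Proof. by rewrite ddist_wrapl ddistC ddist_wrapl ddistC ddist_le. Qed.

Lemma measurable_wrap : measurable_fun setT wrap_point.
Proof.
move: hD; rewrite /wrap_point; case: D => [|Om|L] L0; try exact: measurable_id.
apply: measurable_fun_coordP => i.
under eq_fun do rewrite !mxE.
apply: measurable_funD; first exact: measurable_coord.
apply: measurable_funM; first exact: measurable_cst.
pose h (r : R) : R := (Num.ceil ((r - L) / (2 * L)))%:~R.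
have mh : measurable_fun setT h.
  apply: nondecreasing_measurable => // r s rs; rewrite /h ler_int; apply: le_ceil.
  by apply: ler_wpM2r; [rewrite invr_ge0 mulr_ge0// ltW|rewrite lerD2r].
have := measurable_funN (measurableT_comp mh (measurable_coord i)).
by apply: eq_measurable_fun => x _ /=; rewrite /h intrN.
Qed.

Lemma setdist_cbox0 (l u : E) (y0 w : E) : cbox l u y0 -> wrap_range w ->
  (forall L, D = Torus L -> forall i, - L < l ord0 i /\ u ord0 i <= L) ->
  setdist D (cbox l u) w = 0 <-> cbox l u w.
Proof.
move=> Cy0 Dw lu; split; last first.
  move=> Cw; apply/eqP; rewrite eq_le (setdist_ge0 D Cy0) andbT.
  by rewrite -(ddistxx D w); exact: setdist_le.
move=> w0.
have key : exists2 r0 : R, 0 < r0 & forall r y, 0 < r -> r <= r0 -> cbox l u y ->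
    ddist D w y < r -> forall i, `|w ord0 i - y ord0 i| < r.
  have plain r (y : E) : enorm (w - y) < r -> forall i, `|w ord0 i - y ord0 i| < r.
    move=> h i; apply: le_lt_trans h; have := coord_le_enorm (w - y) i.
    by rewrite !mxE.
  move: lu Dw hD; rewrite /wrap_range; case: D => [|Om|L] lu Dw HD.
  - by exists 1 => // r y _ _ _; exact: plain.
  - by exists 1 => // r y _ _ _; exact: plain.
  have [r0 r00 hr0] : exists2 r0 : R, 0 < r0 &
      forall i, r0 <= L + l ord0 i /\ r0 <= L + w ord0 i.
    exists (\big[Num.min/1]_i (Num.min (L + l ord0 i) (L + w ord0 i))).
      apply: lt_bigmin => // i _; rewrite lt_min; have [? _] := lu L erefl i.
      by have /andP[? _] := Dw i; apply/andP; split; lra.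
    move=> i; have := bigmin_le_cond 1 (fun i => Num.min (L + l ord0 i) (L + w ord0 i)) (isT : xpredT i).
    by rewrite le_min => /andP.
  exists r0 => // r y rp rr0 Cy wy; apply: torus_ddist_small wy => // i.
  have [h1 h2] := hr0 i; have [h3 h4] := lu L erefl i; have /andP[h5 h6] := Dw i.
  have /andP[h7 h8] := Cy i; rewrite ler_norml; apply/andP; split; lra.
have [r0 r00 hr] := key.
have near (e : R) : 0 < e -> exists2 y, cbox l u y & forall i, `|w ord0 i - y ord0 i| < e.
  move=> e0; have m0 : 0 < Num.min e r0 by rewrite lt_min e0.
  have wm : setdist D (cbox l u) w < Num.min e r0 by rewrite w0.
  have [y Cy wy] := setdist_lt Cy0 wm.
  exists y => // i; have := hr _ y m0 _ Cy wy i; rewrite ge_min lexx orbT => /(_ isT).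
  by rewrite lt_min => /andP[].
move=> i; apply/andP; split; apply/ler_addgt0Pr => e e0; have {}e0 : 0 < (e : R) by [].
- have [y Cy /(_ i)] := near e e0; have /andP[? ?] := Cy i; rewrite ltr_norml => /andP[? ?]; lra.
- have [y Cy /(_ i)] := near e e0; have /andP[? ?] := Cy i; rewrite ltr_norml => /andP[? ?]; lra.
Qed.

(** Passes from closed boxes off the left faces of the cell, which Lipschitz functions detect, to
    half-open boxes that may touch them. *)
Lemma box_bigcup_cbox (l u : E) :
  box l u = \bigcup_k cbox (l + const_mx k.+1%:R^-1) u.
Proof.
apply/seteqP; split => x.
  move=> /in_box xb.
  pose r := \big[Num.min/1]_i (x ord0 i - l ord0 i).
  have r0 : 0 < r by apply: lt_bigmin => // i _; rewrite subr_gt0; have /andP[] := xb i.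
  exists (Num.bound r^-1) => // i; have /andP[h1 ->] := xb i; rewrite andbT !mxE.
  rewrite -lerBrDl; apply: le_trans (bigmin_le_cond 1 (fun i => x ord0 i - l ord0 i) (isT : xpredT i)).
  rewrite -/r invf_ple ?posrE//; apply: ltW; apply: lt_le_trans (archi_boundP _) _.
    by rewrite invr_ge0 ltW.
  by rewrite ler_nat.
move=> [k _ xk]; apply/in_box => i; have := xk i; rewrite !mxE => /andP[h ->].
by rewrite andbT; apply: lt_le_trans h; rewrite ltrDl invr_gt0.
Qed.

Lemma measurable_cbox (l u : E) : measurable (cbox l u).
Proof.
have -> : cbox l u = [set x | forall i, `[l ord0 i, u ord0 i]%classic (x ord0 i)].
  by apply/seteqP; split => x h i; have := h i; rewrite /= in_itv.
by apply: (@measurable_rV_box R _ (fun i => `[l ord0 i, u ord0 i]%classic)) => i; exact: measurable_itv.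
Qed.

(** Closed boxes are zero sets of [setdist], half-open boxes are increasing unions of closed ones,
    and measures are determined by half-open boxes. Folding leaves [setdist] unchanged, so the
    periodic functions do not see it. *)
Lemma pushforward_determined (P P' : probability E R) (X : E -> E) :
  P (~` carrier D) = 0%E -> measurable_fun setT X ->
  (forall B L u, bounded_lipschitz D B L u -> \int[P]_x u x = \int[P']_x u (X x)) ->
  forall A, measurable A -> P A = P' ((wrap_point \o X) @^-1` A).
Proof.
move=> PD mX PX.
have mWX : measurable_fun setT (wrap_point \o X) by exact: measurableT_comp measurable_wrap mX.
have mpre A : measurable A -> measurable ((wrap_point \o X) @^-1` A).
  by move=> mA; rewrite -[X in measurable X]setTI; exact: mWX.
have mwr : measurable wrap_range.
  rewrite /wrap_range; case DE: D => [|Om|L]; [exact: measurableT|exact: measurableT|].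
  by rewrite -DE; exact: measurable_carrier.
(* Both [P] and the folded image are carried by [wrap_range], so the comparison may be confined to
   boxes inside the cell. *)
have Pwr A : measurable A -> P A = P (A `&` wrap_range).
  move=> mA; have mAw : measurable (A `&` wrap_range) by exact: measurableI.
  apply/eqP; rewrite eq_le; apply/andP; split; last first.
    by apply: le_measure; rewrite ?inE//; exact: subIsetl.
  have mDc : measurable (~` carrier D) by apply: measurableC; exact: measurable_carrier.
  apply: (@le_trans _ _ (P ((A `&` wrap_range) `|` ~` carrier D))).
    apply: le_measure; rewrite ?inE//; first exact: measurableU.
    move=> x Ax; have [xD|xD] := pselect (carrier D x); [left; split => //|by right].
    by move: xD; rewrite /wrap_range; case: D.
  apply: le_trans (measureU2 _ mAw mDc) _; rewrite -[leRHS]adde0.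
  by apply: leeD => //; rewrite le_eqVlt; apply/orP; left; apply/eqP; exact: PD.
have closed (l u : E) : (forall L, D = Torus L -> forall i, - L < l ord0 i /\ u ord0 i <= L) ->
    P (cbox l u) = P' ((wrap_point \o X) @^-1` cbox l u).
  move=> lu; have [C0|/set0P[y0 Cy0]] := eqVneq (cbox l u) set0.
    by rewrite C0 preimage_set0 !measure0.
  have mZ := measurable_setdist0 D Cy0.
  have Zw : [set z | setdist D (cbox l u) z = 0] `&` wrap_range = cbox l u `&` wrap_range.
    apply/seteqP; split => z [h1 h2]; split => //.
      by apply/(setdist_cbox0 Cy0 h2 lu).
    by apply/(setdist_cbox0 Cy0 h2 lu).
  rewrite Pwr; last exact: measurable_cbox.
  rewrite -Zw -Pwr//.
  have -> : (wrap_point \o X) @^-1` cbox l u = X @^-1` [set z | setdist D (cbox l u) z = 0].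
    apply/seteqP; split => z /=.
      move=> /(setdist_cbox0 Cy0 (wrap_point_range (X z)) lu).2.
      rewrite /setdist => <-; congr inf; apply/seteqP; split => _ [y Cy <-]; exists y => //.
        by rewrite ddist_wrapl.
      by rewrite ddist_wrapl.
    move=> h; apply/(setdist_cbox0 Cy0 (wrap_point_range (X z)) lu); rewrite -h /setdist.
    congr inf; apply/seteqP; split => _ [y Cy <-]; exists y => //; by rewrite ddist_wrapl.
  apply: (setdist0_pushforward Cy0) => //.
  exists (\sum_i (`|l ord0 i| + `|u ord0 i|)) => y Cy.
  apply: le_trans (enorm_le_sum _) _; apply: ler_sum => i _; have /andP[h1 h2] := Cy i.
  have := ler_norm (u ord0 i); have := ler_norm (- l ord0 i); rewrite normrN.
  have := normr_ge0 (u ord0 i); have := normr_ge0 (l ord0 i).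
  move: `|l ord0 i| `|u ord0 i| => a b a0 b0 ha hb; rewrite ler_norml; apply/andP; split; lra.
have half (l u : E) : (forall L, D = Torus L -> forall i, - L <= l ord0 i /\ u ord0 i <= L) ->
    P (box l u) = P' ((wrap_point \o X) @^-1` box l u).
  move=> lu; rewrite box_bigcup_cbox.
  pose F k := cbox (l + const_mx k.+1%:R^-1) u.
  have mF k : measurable (F k) by exact: measurable_cbox.
  have ndF : nondecreasing_seq F.
    move=> i j ij; apply/subsetPset => x Fx k; have /andP[h ->] := Fx k; rewrite andbT.
    apply: le_trans h; rewrite !mxE lerD2l lef_pV2 ?posrE// ler_nat ltnS//.
  have h1 := @nondecreasing_cvg_mu _ _ _ P F mF (bigcupT_measurable _ mF) ndF.
  have h2 := @nondecreasing_cvg_mu _ _ _ P' (fun k => (wrap_point \o X) @^-1` F k) (fun k => mpre _ (mF k)).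
  have {}h2 := h2 (bigcupT_measurable _ (fun k => mpre _ (mF k))).
  have ndF' : nondecreasing_seq (fun k => (wrap_point \o X) @^-1` F k).
    by move=> i j ij; apply/subsetPset; apply: preimage_subset; apply/subsetPset; exact: ndF.
  have {}h2 := h2 ndF'; rewrite -preimage_bigcup in h2.
  have E2 : P \o F = P' \o (fun k => (wrap_point \o X) @^-1` F k).
    apply/funext => k; apply: closed => L DL i; have [h3 h4] := lu L DL i; split => //.
    by rewrite !mxE; apply: le_lt_trans h3 _; rewrite ltrDl invr_gt0.
  rewrite E2 in h1; exact: (cvg_unique _ h1 h2).
have [Q [QE _]] := ex_image_probability P' mWX.
have Qwr A : Q A = Q (A `&` wrap_range).
  rewrite !QE; congr (P' _); apply/seteqP; split => x /=; last by case.
  by move=> Ax; split => //; exact: wrap_point_range.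
move=> A mA; rewrite -QE; move: A mA.
apply: (@box_measure_unique R d P Q) => [l u|l u]; last first.
  by apply: le_lt_trans (probability_le1 P _) _; [exact: measurable_box|exact: ltry].
etransitivity; first (by apply: Pwr; exact: measurable_box).
etransitivity; last (by symmetry; exact: Qwr).
have [l' [u' [-> lu]]] : exists l' u', box l u `&` wrap_range = box l' u' /\
    (forall L, D = Torus L -> forall i, - L <= l' ord0 i /\ u' ord0 i <= L).
  rewrite /wrap_range; case: D => [|Om|L].
  - by exists l, u; rewrite setIT.
  - by exists l, u; rewrite setIT.
  exists (\row_i Num.max (l ord0 i) (- L)), (\row_i Num.min (u ord0 i) L); split; last first.
    by move=> _ [<-] i; rewrite !mxE le_max lexx orbT ge_min lexx orbT.
  apply/seteqP; split => x.
    move=> [/in_box xb xL]; apply/in_box => i; rewrite !mxE gt_max le_min.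
    by have /andP[-> ->] := xb i; have /andP[-> ->] := xL i.
  move=> /in_box xb; split; first (apply/in_box); move=> i; have := xb i;
    by rewrite !mxE gt_max le_min => /andP[/andP[? ?] /andP[? ?]]; apply/andP.
by etransitivity; [exact: half|symmetry; exact: QE].
Qed.

End pushforward_determination.

(** When the whole space is null the norm is [0] by convention instead of an essential supremum;
    every property then holds almost everywhere. *)
Lemma ae_le_Lnorm_infty dd (X : measurableType dd) (R : realType)
    (m : {measure set X -> \bar R}) (f : X -> \bar R) (c : \bar R) :
  ('N[m]_+oo[f] <= c)%E -> \forall x \ae m, (`|f x| <= c)%E.
Proof.
rewrite unlock; case: ifPn => [_ /ess_supP//|m0 _].
exists setT; split => //; apply/eqP; rewrite eq_le measure_ge0 andbT.
by rewrite leNgt.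
Qed.

(** * Velocity fields as Lipschitz fields on the whole space *)

Section essential_bounds.
Context {R : realType} {d : nat}.
Local Notation E := 'rV[R]_d.+1.
Local Notation lebE := (lebesgue_rV R d.+1).
Variable D : domain R d.
Hypothesis hD : admissible D.

Lemma carrier_nonempty : carrier D !=set0.
Proof.
move: hD; case: D => [|Om|L] /=; [by exists 0|by case|move=> L0].
by exists (const_mx L) => i; rewrite mxE lexx andbT; lra.
Qed.

(** The half-open box below [x] inside the carrier has positive measure, hence meets every set of
    full measure. *)
Lemma ae_carrier_dense (Q : E -> Prop) (x : E) (r : R) :
  (\forall y \ae lebE, Q y) -> carrier D x -> 0 < r ->
  exists y, [/\ carrier D y, Q y & `|x - y| <= r].
Proof.
move=> [N [mN N0 QN]] Dx r0; have [r1 r10 br1] := carrier_box hD Dx.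
pose s := Num.min r r1; have s0 : 0 < s by rewrite lt_min r0.
have [[y [by_ yN]]|h] := pselect (exists y, box (x - const_mx s) x y /\ ~ N y).
  exists y; split.
  - apply: br1; move/in_box: by_ => hb; apply/in_box => i; have /andP[h1 ->] := hb i.
    rewrite andbT; apply: le_lt_trans h1; rewrite !mxE lerD2l lerN2.
    by rewrite ge_min lexx orbT.
  - by apply: contrapT => nQ; apply: yN; exact: QN.
  - apply: norm_le_coord => i; rewrite !mxE; move/in_box: by_ => /(_ i).
    rewrite !mxE => /andP[h1 h2]; rewrite ger0_norm; last by rewrite subr_ge0.
    have : s <= r by rewrite ge_min lexx.
    lra.
exfalso.
have sub : box (x - const_mx s) x `<=` N.
  by move=> y hy; apply: contrapT => hN; apply: h; exists y.
have : (lebE (box (x - const_mx s) x) <= lebE N)%E.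
  by apply: le_measure; rewrite ?inE//; exact: measurable_box.
have -> : lebE N = 0%E by exact: N0.
have -> : lebE (box (x - const_mx s) x) = (s ^+ d.+1)%:E by exact: lebesgue_half_open_box.
by rewrite lee_fin leNgt exprn_gt0.
Qed.

Lemma Linf_ge0 (A : set E) f : (0 <= Linf A f)%E.
Proof. exact: Lnorm_ge0. Qed.

Lemma ae_le_Linf (A : set E) f (b : R) : (Linf A f <= b%:E)%E ->
  \forall x \ae lebE, A x -> `|f x| <= b.
Proof.
move=> /ae_le_Lnorm_infty; apply: filterS => x /= + Ax.
by rewrite patchE mem_set// lee_fin.
Qed.

Lemma ddist_gt0 (x y : E) : carrier D x -> carrier D y -> x != y -> 0 < ddist D x y.
Proof.
move=> Dx Dy xy; rewrite lt_neqAle ddist_ge0 andbT eq_sym; apply/negP => /eqP xy0.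
move/negP: xy; apply; apply/eqP; move: hD Dx Dy xy0; case: D => [|Om|L] HD Dx Dy xy0.
- by apply/eqP; rewrite -subr_eq0; apply/eqP; exact: enorm_eq0.
- by apply/eqP; rewrite -subr_eq0; apply/eqP; exact: enorm_eq0.
pose r0 := \big[Num.min/1]_i (2 * L - `|x ord0 i - y ord0 i|).
have r00 : 0 < r0.
  apply: lt_bigmin => // i _; have /andP[h1 h2] := Dx i; have /andP[h3 h4] := Dy i.
  by rewrite subr_gt0 ltr_norml; apply/andP; split; lra.
apply/rowP => i; apply/eqP; rewrite -subr_eq0 -normr_le0.
apply/ler_addgt0Pr => e e0; have {}e0 : 0 < (e : R) by []; rewrite add0r; apply: ltW.
have m0 : 0 < Num.min e r0 by rewrite lt_min e0.
have := @torus_ddist_small _ _ L (Num.min e r0) x y HD.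
rewrite xy0 => /(_ _ m0) h; have := h _ i; rewrite lt_min; move=> /(_ _)/andP[]//.
move=> j; have : r0 <= 2 * L - `|x ord0 j - y ord0 j|.
  exact: (bigmin_le_cond 1 (fun j => 2 * L - `|x ord0 j - y ord0 j|) (isT : xpredT j)).
have : Num.min e r0 <= r0 by rewrite ge_min lexx orbT.
lra.
Qed.

(** One constant for both bounds, which hold everywhere on the carrier and no longer up to null
    sets. *)
Definition bl_bound (f : E -> E) (b : R) :=
  (forall x, carrier D x -> enorm (f x) <= b) /\
  (forall x y, carrier D x -> carrier D y -> enorm (f x - f y) <= b * ddist D x y).

Lemma bl_boundD f g a b : bl_bound f a -> bl_bound g b ->
  bl_bound (fun x => f x + g x) (a + b).
Proof.
move=> [f1 f2] [g1 g2]; split => [x Dx|x y Dx Dy].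
  by apply: le_trans (enormD _ _) _; apply: lerD; [exact: f1|exact: g1].
rewrite opprD addrACA mulrDl; apply: le_trans (enormD _ _) _.
by apply: lerD; [exact: f2|exact: g2].
Qed.

Lemma bl_boundZ f b k : bl_bound f b -> bl_bound (fun x => k *: f x) (`|k| * b).
Proof.
move=> [f1 f2]; split => [x Dx|x y Dx Dy]; first by rewrite enormZ; apply: ler_wpM2l => //; exact: f1.
by rewrite -scalerBr enormZ -mulrA; apply: ler_wpM2l => //; exact: f2.
Qed.

Lemma bl_bound0 : bl_bound (fun=> 0) 0.
Proof. by split => *; rewrite ?subr0 enorm0 ?mul0r. Qed.

Lemma bl_bound_sum (I : Type) (r : seq I) (f : I -> E -> E) (b : I -> R) :
  (forall i, bl_bound (f i) (b i)) ->
  bl_bound (fun x => \sum_(i <- r) f i x) (\sum_(i <- r) b i).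
Proof.
move=> fb; elim: r => [|i r ih].
  by rewrite big_nil; under eq_fun do rewrite big_nil; exact: bl_bound0.
by rewrite big_cons; under eq_fun do rewrite big_cons; exact: bl_boundD.
Qed.

(** An empty supremum would be [-oo]; two distinct points of the carrier exclude this. *)
Lemma BLnorm_ge0 (f : E -> E) : (0 <= Lip D f)%E.
Proof.
have [x Dx] := carrier_nonempty; have [r r0 br] := carrier_box hD Dx.
pose y := x - const_mx (r / 2).
have Dy : carrier D y.
  by apply: br; apply/in_box => i; rewrite !mxE; apply/andP; split; lra.
have xy : x != y.
  by apply/eqP => /rowP /(_ ord0); rewrite !mxE; lra.
apply: (@le_trans _ _ (enorm (f x - f y) / ddist D x y)%:E).
  by rewrite lee_fin divr_ge0 ?enorm_ge0 ?ddist_ge0.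
by apply: ereal_sup_ubound; exists (x, y).
Qed.

(** Both terms of the norm are nonnegative, so each is at most [b]. The essential bound becomes a
    bound everywhere because a Lipschitz function is controlled by its values at arbitrarily close
    good points. *)
Lemma BLnorm_bound (f : E -> E) (b : R) : (BLnorm D f <= b%:E)%E -> bl_bound f b.
Proof.
rewrite /BLnorm => fb.
have L0 := Linf_ge0 (carrier D) (enorm \o f); have K0 := BLnorm_ge0 f.
have Lb : (Linf (carrier D) (enorm \o f) <= b%:E)%E by apply: le_trans fb; rewrite leeDl.
have Kb : (Lip D f <= b%:E)%E by apply: le_trans fb; rewrite leeDr.
have b0 : 0 <= b by rewrite -lee_fin; exact: le_trans Lb.
have lip x y : carrier D x -> carrier D y -> enorm (f x - f y) <= b * ddist D x y.
  move=> Dx Dy; have [->|xy] := eqVneq x y; first by rewrite subrr enorm0 mulr_ge0// ddist_ge0.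
  rewrite -ler_pdivrMr; last exact: ddist_gt0.
  by rewrite -lee_fin; apply: le_trans Kb; apply: ereal_sup_ubound; exists (x, y).
split => // x Dx; apply/ler_addgt0Pr => e e0; have {}e0 : 0 < (e : R) by [].
have c0 : 0 < b * d.+1%:R + 1 by rewrite ltr_wpDl// mulr_ge0.
have [y [Dy yb xy]] := ae_carrier_dense (ae_le_Linf Lb) Dx (divr_gt0 e0 c0).
have h1 := enormD (f x - f y) (f y); rewrite subrK in h1.
have h2 := lip _ _ Dx Dy; have h3 := yb Dy; rewrite /= ger0_norm ?enorm_ge0// in h3.
have h4 : b * ddist D x y <= e.
  apply: (@le_trans _ _ (b * (d.+1%:R * (e / (b * d.+1%:R + 1))))).
    apply: ler_wpM2l => //; apply: le_trans (ddist_le _ _ _) _.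
    by apply: le_trans (enorm_le_norm _) _; apply: ler_wpM2l.
  have -> : b * (d.+1%:R * (e / (b * d.+1%:R + 1))) = e * (b * d.+1%:R / (b * d.+1%:R + 1)) by ring.
  rewrite -[leRHS]mulr1; apply: ler_wpM2l; first exact: ltW.
  by rewrite ler_pdivrMr// mul1r lerDl.
apply: le_trans h1 _; rewrite addrC; apply: lerD => //; exact: le_trans h2 h4.
Qed.

Lemma BL_simple_bound (V : R -> E -> E) (t : R) : BL_simple D V -> exists b, bl_bound (V t) b.
Proof.
move=> [m [B [f [Bf VE]]]].
have fb i : exists b, bl_bound (f i) b.
  have [_ h] := Bf i; exists (fine (BLnorm D (f i))); apply: BLnorm_bound.
  rewrite fineK// ge0_fin_numE//; apply: adde_ge0; [exact: Linf_ge0|exact: BLnorm_ge0].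
have {fb} [b fb] := choice fb.
exists (\sum_(i < m) `|\1_(B i) t| * b i).
have -> : V t = (fun x => \sum_(i < m) (\1_(B i) t : R) *: f i x) by apply/funext => x; exact: VE.
by apply: bl_bound_sum => i; apply: bl_boundZ.
Qed.

(** At almost every time [V t] is within distance [1] of a simple function, which is bounded and
    Lipschitz; this avoids any question about the measurability of the norm in time. *)
Lemma Lq_BL_bound (q h : R) (V : R -> E -> E) : Lq_BL D q h V ->
  \forall t \ae (@lebesgue_measure R), 0 < t < h -> exists b, bl_bound (V t) b.
Proof.
move=> [[s [sS [N [mN N0 sub]]]] _]; exists N; split => // t nt; apply: sub => sV; apply: nt => ht.
have [n] : exists n, (BLnorm D (fun x => (V t x - s n t x)%R) <= 1%:E)%E.
  have h1 : nbhs (0%E : \bar R) [set y : \bar R | (y < 1%:E)%E].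
    by apply: open_ereal_lt'; rewrite lte_fin.
  by have [n _ hn] := sV ht _ h1; exists n; apply: ltW; apply: hn => /=.
move=> /BLnorm_bound h1; have [b h2] := BL_simple_bound t (sS n).
exists (1 + b); have := bl_boundD h1 h2.
by under eq_fun do rewrite subrK.
Qed.

End essential_bounds.

(** * McShane extension from a countable dense set *)

Section mcshane.
Context {R : realType} {d : nat}.
Local Notation E := 'rV[R]_d.+1.
Variables (D : domain R d) (q : nat -> E).
Hypothesis Dq : forall n, carrier D (q n).
Hypothesis qdense : forall x e, carrier D x -> 0 < e -> exists n, `|x - q n| < e.

(** The infimum runs over a sequence, not over the whole carrier, so that it stays measurable in the
    time on which [v] and [k] will depend. *)
Definition mcshane (v : nat -> R) (k : R) (x : E) : R :=
  infs (fun n => v n + k * ddist D x (q n)) 0.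

Section one_function.
Variables (v : nat -> R) (k : R).
Hypothesis k0 : 0 <= k.
Hypothesis vk : forall n, `|v n| <= k.

Let S x := [set v n + k * ddist D x (q n) | n in [set: nat]].

Let mcshaneE x : mcshane v k x = inf (S x).
Proof. by rewrite /mcshane /infs /= /sdrop; congr inf; apply/seteqP; split => _ [n _ <-]; exists n. Qed.

Let S_ge x : lbound (S x) (- k).
Proof.
move=> _ [n _ <-]; have := vk n; rewrite ler_norml => /andP[h _].
by rewrite -[- k]addr0; apply: lerD => //; rewrite mulr_ge0// ddist_ge0.
Qed.

Let S_inf x : has_inf (S x).
Proof. by split; [exists (v 0%N + k * ddist D x (q 0%N)), 0%N|exists (- k)]. Qed.

Lemma mcshane_ge x : - k <= mcshane v k x.
Proof. by rewrite mcshaneE; apply: lb_le_inf; [case: (S_inf x)|exact: S_ge]. Qed.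

Lemma mcshane_le x n : mcshane v k x <= v n + k * ddist D x (q n).
Proof. by rewrite mcshaneE; apply: ge_inf; [case: (S_inf x)|exists n]. Qed.

Lemma mcshane_glb x c : (forall n, c <= v n + k * ddist D x (q n)) -> c <= mcshane v k x.
Proof. by move=> h; rewrite mcshaneE; apply: lb_le_inf; [case: (S_inf x)|move=> _ [n _ <-]]. Qed.

Lemma mcshane_lipschitz x y : `|mcshane v k x - mcshane v k y| <= k * ddist D x y.
Proof.
have h z w : mcshane v k z <= mcshane v k w + k * ddist D z w.
  rewrite -lerBlDr; apply: mcshane_glb => n; rewrite lerBlDr.
  apply: le_trans (mcshane_le z n) _; rewrite -addrA lerD2l -mulrDr.
  by apply: ler_wpM2l => //; rewrite addrC; exact: ddist_triangle.
have := h x y; have := h y x; rewrite (ddistC D y x).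
move: (k * _) (mcshane v k x) (mcshane v k y) => c a b h1 h2.
by rewrite ler_norml; apply/andP; split; lra.
Qed.

Lemma mcshane_extends (f : E -> R) (b : R) x : (forall n, v n = f (q n)) ->
  (forall n m, `|v n - v m| <= k * ddist D (q n) (q m)) ->
  (forall y z, carrier D y -> carrier D z -> `|f y - f z| <= b * ddist D y z) ->
  carrier D x -> Num.min k (mcshane v k x) = f x.
Proof.
move=> vE vl fl Dx.
have near (e : R) : 0 < e -> exists m, `|f x - v m| <= e /\ k * ddist D x (q m) <= e.
  move=> e0; pose c := (`|b| + k + 1) * d.+1%:R.
  have c0 : 0 < c by rewrite mulr_gt0// ltr_wpDl// addr_ge0.
  have [m hm] := qdense Dx (divr_gt0 e0 c0); exists m.
  have dx : d.+1%:R * `|x - q m| <= e / (`|b| + k + 1).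
    rewrite mulrC -ler_pdivlMr//; apply: le_trans (ltW hm) _.
    by rewrite /c invfM mulrA.
  have {}dx : ddist D x (q m) <= e / (`|b| + k + 1).
    by apply: le_trans (ddist_le _ _ _) _; apply: le_trans (enorm_le_norm _) _.
  have dx0 := ddist_ge0 D x (q m).
  have b1 : 0 < `|b| + k + 1 by rewrite ltr_wpDl// addr_ge0.
  have main (r : R) : r <= `|b| + k + 1 -> r * ddist D x (q m) <= e.
    move=> rb; apply: (@le_trans _ _ ((`|b| + k + 1) * ddist D x (q m))); first exact: ler_wpM2r.
    by rewrite mulrC -ler_pdivlMr.
  split; last by apply: main; move: (normr_ge0 b) k0; move: `|b| => b' ? ?; lra.
  rewrite vE; apply: le_trans (fl _ _ Dx (Dq m)) _; apply: main.
  by move: (ler_norm b) k0; move: `|b| => b' ? ?; lra.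
have fk : f x <= k.
  apply/ler_addgt0Pr => e e0; have {}e0 : 0 < (e : R) by [].
  have [m [h1 _]] := near e e0; have := vk m; rewrite ler_norml => /andP[_ h2].
  by move: h1; rewrite ler_norml => /andP[_ h1]; lra.
have E1 : mcshane v k x = f x.
  apply/eqP; rewrite eq_le; apply/andP; split.
    apply/ler_addgt0Pr => e e0; have {}e0 : 0 < (e : R) by [].
    have e2 : 0 < e / 2 by rewrite divr_gt0.
    have [m [h1 h2]] := near (e / 2) e2.
    apply: le_trans (mcshane_le x m) _; move: h1; rewrite ler_norml => /andP[h1 h3]; lra.
  apply: mcshane_glb => n; apply/ler_addgt0Pr => e e0; have {}e0 : 0 < (e : R) by [].
  have e2 : 0 < e / 2 by rewrite divr_gt0.
  have [m [h1 h2]] := near (e / 2) e2.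
  have h3 : k * ddist D (q m) (q n) <= k * ddist D x (q m) + k * ddist D x (q n).
    by rewrite -mulrDr; apply: ler_wpM2l => //; rewrite (ddistC D x (q m)); exact: ddist_triangle.
  have := vl m n; move: h1 h2 h3.
  move: (k * ddist D (q m) (q n)) (k * ddist D x (q m)) (k * ddist D x (q n)) => a1 a2 a3.
  by rewrite !ler_norml => /andP[? ?] ? ? /andP[? ?]; lra.
by rewrite E1 min_r.
Qed.

End one_function.

Lemma mcshane_periodic v k L : D = Torus L -> periodic_by L (mcshane v k).
Proof.
move=> DL x i; rewrite /mcshane DL.
have h n : ddist (Torus L) (x + (2 * L) *: delta_mx ord0 i) (q n) = ddist (Torus L) x (q n).
  by rewrite -(torus_ddist_shift L x (q n) (delta_mx ord0 i)) map_delta_mx.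
by congr (infs _ 0); apply/funext => n; rewrite h.
Qed.

End mcshane.

Lemma min_lipschitz (R : realType) (k a b : R) : `|Num.min k a - Num.min k b| <= `|a - b|.
Proof.
case: (leP k a) => ka; case: (leP k b) => kb.
- by rewrite subrr normr0.
- rewrite ger0_norm ?ger0_norm; lra.
- rewrite distrC (distrC a) ger0_norm ?ger0_norm; lra.
- done.
Qed.

Section field_extension.
Context {R : realType} {d : nat}.
Local Notation E := 'rV[R]_d.+1.
Local Notation leb := (@lebesgue_measure R).
Variables (D : domain R d) (T h p : R) (V : R -> E -> E).
Hypothesis hD : admissible D.
Hypotheses (h0 : 0 < h) (hT : h <= T) (p2 : 2 <= p).
Hypothesis mV : measurable_fun (`[0, T] `*` carrier D)
  (fun z : measurableTypeR R * E => V z.1 z.2).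
Hypothesis VL : Lq_BL D p h V.

(** The majorant is the supremum of values and difference quotients over the dense sequence:
    measurable as a countable supremum, and at most the [BLnorm] at good times. Off the good times
    the field is set to [0]. *)
Lemma exists_field_extension : exists (l : R -> R) (a : R -> E -> E) (N : set (measurableTypeR R)),
  [/\ measurable_fun [set: measurableTypeR R] l, forall t, 0 <= l t,
      (\int[leb]_(t in `[0%R, h]) ((l t) ^+ 2)%:E < +oo)%E &
      measurable_fun setT (fun z : measurableTypeR R * E => a z.1 z.2)] /\
  [/\ forall t x, `|a t x| <= l t, forall t x y, `|a t x - a t y| <= l t * `|x - y|,
      forall L, D = Torus L -> forall t, periodic_by L (a t),
      measurable N /\ leb N = 0%E &
      forall t, 0 < t < h -> ~ N t -> forall x, carrier D x -> a t x = V t x].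
Proof.
have itv_sub (t : R) : `]0, h[%classic t -> `[0, T]%classic t.
  by rewrite /= !in_itv/= => /andP[/ltW -> /ltW th]; exact: le_trans th hT.
have [N [mN N0 sub]] := Lq_BL_bound hD VL.
have good t : 0 < t < h -> ~ N t -> exists b, bl_bound D (V t) b.
  by move=> ht nt; apply: contrapT => hb; apply: nt; apply: sub => /(_ ht).
have [q [Dq qdense]] := carrier_countable_dense hD (carrier_nonempty hD).
pose I : set (measurableTypeR R) := `]0, h[%classic `\` N.
have mI : measurable I by apply: measurableD => //; exact: measurable_itv.
pose v t n i : R := if t \in I then V t (q n) ord0 i else 0.
have mv n i : measurable_fun [set: measurableTypeR R] (fun t => v t n i).
  have h1 : measurable_fun I (fun t : measurableTypeR R => V t (q n) ord0 i).
    have mp : measurable_fun I (fun t : measurableTypeR R => (t, q n)).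
      exact: measurable_funTS (pair2_measurable (q n)).
    have mTD : measurable ((`[0, T]%classic : set (measurableTypeR R)) `*` carrier D).
      by apply: measurableX; [exact: measurable_itv|exact: measurable_carrier].
    have mc : measurable_fun (`[0, T] `*` carrier D)
        (fun z : measurableTypeR R * E => V z.1 z.2 ord0 i).
      exact: (measurableT_comp (measurable_coord i) mV).
    apply: (measurable_comp mTD _ mc mp) => _ [t [It _] <-]; split => /=; last exact: Dq.
    exact: itv_sub.
  have := (measurable_restrictT (fun t : measurableTypeR R => V t (q n) ord0 i) mI).1 h1.
  by apply: eq_measurable_fun => t _; rewrite patchE.
(* One number [k] codes two points of the sequence and a coordinate. For equal points the quotient
   is [0 / 0 = 0], so only the value counts. *)
pose G k t : \bar R := if @unpickle (nat * nat * 'I_d.+1)%type k is Some (n, m, i) then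
  (Num.max `|v t n i| (`|v t n i - v t m i| / ddist D (q n) (q m)))%:E else 0%E.
have mG k : measurable_fun [set: measurableTypeR R] (G k).
  rewrite /G; case: unpickle => [[[n m] i]|]; last exact: measurable_cst.
  apply/measurable_EFinP; apply: measurable_maxr.
    by apply: measurableT_comp => //; exact: mv.
  apply: measurable_funM; last exact: measurable_cst.
  by apply: measurableT_comp => //; apply: measurable_funB; exact: mv.
have G0 k t : (0 <= G k t)%E.
  by rewrite /G; case: unpickle => [[[n m] i]|]//; rewrite lee_fin le_max normr_ge0.
pose le t := esups (G ^~ t) 0.
have mle : measurable_fun [set: measurableTypeR R] le by exact: measurable_fun_esups.
have G_le k t : (G k t <= le t)%E by apply: ereal_sup_ubound; exists k.
have le_le t (b : \bar R) : (0 <= b)%E -> (forall n m i, t \in I ->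
    (`|V t (q n) ord0 i|%:E <= b)%E /\
    ((`|V t (q n) ord0 i - V t (q m) ord0 i| / ddist D (q n) (q m))%:E <= b)%E) -> (le t <= b)%E.
  move=> b0 hb; apply: ge_ereal_sup => _ [k _ <-].
  rewrite /G; case: unpickle => [[[n m] i]|]//; rewrite /v; case: ifPn => tI; last first.
    by rewrite subr0 normr0 mul0r maxxx.
  by have [h1 h2] := hb n m i tI; rewrite EFin_max ge_max; apply/andP; split.
have le_bl t b : t \in I -> bl_bound D (V t) b -> (le t <= b%:E)%E.
  move=> tI [h1 h2]; apply: le_le.
    by rewrite lee_fin; apply: le_trans (h1 (q 0%N) (Dq 0%N)); exact: enorm_ge0.
  move=> n m i _; split; first by rewrite lee_fin; apply: le_trans (coord_le_enorm _ _) (h1 _ _).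
  rewrite lee_fin; have [nm|nm] := eqVneq (q n) (q m).
    rewrite nm subrr normr0 mul0r; apply: le_trans (h1 (q 0%N) (Dq 0%N)); exact: enorm_ge0.
  rewrite ler_pdivrMr ?ddist_gt0//; apply: le_trans (h2 _ _ (Dq n) (Dq m)).
  by have := coord_le_enorm (V t (q n) - V t (q m)) i; rewrite !mxE.
have le0 t : (0 <= le t)%E by apply: le_trans (G_le 0%N t).
have le_out t : t \notin I -> le t = 0%E.
  move=> tI; apply/eqP; rewrite eq_le le0 andbT; apply: le_le => // n m i.
  by rewrite (negbTE tI).
have lef t : le t \is a fin_num.
  rewrite ge0_fin_numE//; have [tI|/le_out ->] := boolP (t \in I); last exact: ltry.
  have [ht nt] : (`]0, h[%classic : set R) t /\ ~ N t by move: tI; rewrite inE.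
  have [b hb] := good t (ltac:(by move: ht; rewrite /= in_itv)) nt.
  exact: le_lt_trans (le_bl t b tI hb) (ltry _).
pose l0 t := fine (le t).
have l0E t : (l0 t)%:E = le t by rewrite fineK.
have ml0 : measurable_fun [set: measurableTypeR R] l0.
  by apply: measurableT_comp mle; exact: fine_measurable.
have l00 t : 0 <= l0 t by rewrite fine_ge0.
have vl t n i : `|v t n i| <= l0 t.
  rewrite -lee_fin l0E; apply: le_trans (G_le (pickle (n, n, i)) t).
  by rewrite /G pickleK lee_fin le_max lexx.
have vd t n m i : `|v t n i - v t m i| <= l0 t * ddist D (q n) (q m).
  have [nm|nm] := eqVneq (q n) (q m).
    by rewrite /v nm; case: ifP => _; rewrite subrr normr0 mulr_ge0// ddist_ge0.
  rewrite -ler_pdivrMr ?ddist_gt0// -lee_fin l0E; apply: le_trans (G_le (pickle (n, m, i)) t).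
  by rewrite /G pickleK lee_fin le_max lexx orbT.
pose a t x : E := \row_i Num.min (l0 t) (mcshane D q (fun n => v t n i) (l0 t) x).
have ab t x : `|a t x| <= l0 t.
  apply: norm_le_coord => i; rewrite mxE ler_norml ge_min lexx andbT le_min.
  apply/andP; split; first by apply: le_trans (l00 t); rewrite oppr_le0.
  by apply: mcshane_ge.
have al t x y : `|a t x - a t y| <= l0 t * ddist D x y.
  apply: norm_le_coord => i; rewrite !mxE.
  by apply: (le_trans (min_lipschitz _ _ _)); apply: mcshane_lipschitz.
(* The Lipschitz bound is in terms of [ddist], which is at most [d.+1] times the sup norm. *)
pose n1 : R := d.+1%:R.
have n1_ge1 : 1 <= n1 by rewrite ler1n.
have n10 : 0 <= n1 by exact: ler0n.
exists (fun t => n1 * l0 t), a, N; split; split => //.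
- by apply: measurable_funM => //; exact: measurable_cst.
- by move=> t; rewrite mulr_ge0.
- have mcc : measurable (`[0, h]%classic : set (measurableTypeR R)) by exact: measurable_itv.
  have mp : measurable_fun [set: measurableTypeR R] (fun t => l0 t `^ p).
    by apply: (measurableT_comp (f := fun r : R => r `^ p)) ml0; exact: measurable_powR.
  have lBL t : t \in I -> (le t <= BLnorm D (V t))%E.
    move=> tI; have B0 : (0 <= BLnorm D (V t))%E.
      by apply: adde_ge0; [exact: Linf_ge0|exact: BLnorm_ge0].
    have [->|Bf] := eqVneq (BLnorm D (V t)) +oo%E; first exact: leey.
    have Bfin : BLnorm D (V t) \is a fin_num by rewrite ge0_fin_numE// ltey.
    by rewrite -(fineK Bfin); apply: le_bl => //; apply: BLnorm_bound => //; rewrite fineK.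
  have ip : leb.-integrable `[0, h] (EFin \o (fun t => l0 t `^ p)).
    apply/integrableP; split; first by apply/measurable_EFinP; exact: measurable_funTS.
    under eq_integral do rewrite /= ger0_norm ?powR_ge0//.
    (* The [BLnorm] need not be measurable in time, hence the comparison of integrals through simple
       functions. *)
    have [_ VF] := VL; apply: le_lt_trans VF.
    rewrite integral_mkcond [leRHS]integral_mkcond; apply: ge0_le_integral_lower => t _.
      by rewrite patchE; case: ifP => // _; rewrite lee_fin powR_ge0.
    rewrite !patchE.
    have [tI|tI] := boolP (t \in I); last first.
      have -> : l0 t = 0 by rewrite /l0 le_out.
      rewrite powR0; last by rewrite gt_eqF// (lt_le_trans _ p2).
      case: ifP => _; case: ifP => _ //; exact: poweR_ge0.
    have ht : (`]0, h[%classic : set R) t by move: tI; rewrite inE => -[].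
    rewrite [X in (_ <= if X then _ else _)%E]mem_set//.
    case: ifP => _; last exact: poweR_ge0.
    rewrite -poweR_EFin l0E; apply: poweR_le => //; last exact: lBL.
    by apply: le_trans p2.
  have i1 : leb.-integrable `[0, h] (EFin \o (fun t => 1 + l0 t `^ p)).
    apply: real_integrableD => //; apply: measurable_bounded_integrable => //.
      by have /= -> := lebesgue_measure_itv `[0, h]; rewrite lte_fin h0 -EFinB ltry.
    by exists 1; split; [exact: num_real|move=> M M1 x _ /=; rewrite normr1 ltW].
  have i2 := real_integrableZ (n1 ^+ 2) mcc i1.
  apply: integrable_lty => //; apply: le_integrable i2 => //.
    apply/measurable_EFinP; apply: measurable_funTS; apply: measurable_funX.
    by apply: measurable_funM => //; exact: measurable_cst.
  move=> t _ /=; rewrite lee_fin [leRHS]ger0_norm; last first.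
    by rewrite mulr_ge0 ?exprn_ge0 ?addr_ge0 ?powR_ge0.
  rewrite ger0_norm ?sqr_ge0// exprMn; apply: ler_wpM2l; first exact: exprn_ge0.
  (* Since [2 <= p], the square is at most [1] below level [1] and at most the power [p] above it;
     the time interval is bounded. *)
  have [l1|l1] := leP (l0 t) 1.
    by apply: (@le_trans _ _ 1); [exact: exprn_ile1|rewrite lerDl powR_ge0].
  rewrite -powR_mulrn//; apply: le_trans (ler_powR (ltW l1) p2) _.
  by rewrite lerDr.
- apply: measurable_fun_coordP => i; under eq_fun do rewrite mxE.
  apply: measurable_minr; first exact: (measurableT_comp ml0 measurable_fst).
  apply: (@measurable_fun_infs _ _ _ setT (fun n (z : measurableTypeR R * E) =>
    v z.1 n i + l0 z.1 * ddist D z.2 (q n)) 0).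
    move=> z _; exists (- l0 z.1) => _ [n _ <-].
    have := vl z.1 n i; rewrite ler_norml => /andP[hh _].
    by rewrite -[- l0 z.1]addr0; apply: lerD => //; rewrite mulr_ge0// ddist_ge0.
  move=> n; apply: measurable_funD; first exact: (measurableT_comp (mv n i) measurable_fst).
  apply: measurable_funM; first exact: (measurableT_comp ml0 measurable_fst).
  exact: (measurableT_comp (measurable_ddist D) (measurable_fun_pair measurable_snd (measurable_cst (q n)))).
- by move=> t x; apply: le_trans (ab t x) _; exact: ler_peMl.
- move=> t x y; apply: le_trans (al t x y) _; rewrite -mulrA mulrCA; apply: ler_wpM2l => //.
  exact: le_trans (ddist_le _ _ _) (enorm_le_norm _).
- move=> L DL t x i; apply/rowP => j; rewrite !mxE.
  by have -> := mcshane_periodic q (fun n => v t n j) (l0 t) DL x i.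
- move=> t ht nt x Dx; have [b [hb1 hb2]] := good t ht nt.
  have tI : t \in I by rewrite inE; split => //=; rewrite in_itv.
  apply/rowP => i; rewrite mxE.
  apply: (mcshane_extends Dq qdense (l00 t) (fun n => vl t n i) (b := b) (f := fun x => V t x ord0 i)) => //.
    by move=> n; rewrite /v tI.
  move=> y z Dy Dz; apply: le_trans (hb2 y z Dy Dz).
  by have := coord_le_enorm (V t y - V t z) i; rewrite !mxE.
Qed.

End field_extension.

Lemma prob_Rintegral_full dd (X : measurableType dd) (R : realType) (P : probability X R)
    (A : set X) (f : X -> R) : measurable A -> P (~` A) = 0%E -> measurable_fun setT f ->
  \int[P]_(x in A) f x = \int[P]_x f x.
Proof.
move=> mA PA mf; rewrite /Rintegral integral_mkcond; congr fine.
apply: ae_eq_integral => //.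
- by apply/(measurable_restrictT _ mA).1; apply: measurable_funTS; exact/measurable_EFinP.
- exact/measurable_EFinP.
exists (~` A); split => //; first exact: measurableC.
move=> x /= h Ax; apply: h => _; rewrite patchE mem_set//.
Qed.

(** * Solutions as images of their initial measure *)

Section solution_flow.
Context {R : realType} {d : nat}.
Local Notation E := 'rV[R]_d.+1.
Local Notation leb := (@lebesgue_measure R).
Variables (D : domain R d) (T h p : R) (v : probability E R -> E -> E).
Variable mu : R -> probability E R.
Hypothesis hD : admissible D.
Hypotheses (h0 : 0 < h) (hT : h <= T) (p2 : 2 <= p).
Hypothesis sol : weak_solution D T v mu.
Hypothesis muD : forall t : R, 0 <= t <= T -> mu t (~` carrier D) = 0%E.
Hypothesis VL : Lq_BL D p h (fun t => v (mu t)).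

Theorem exists_solution_flow :
  exists (l : R -> R) (a : R -> E -> E) (N : set (measurableTypeR R)),
  [/\ measurable_fun [set: measurableTypeR R] l, forall t, 0 <= l t,
      (\int[leb]_(t in `[0%R, h]) ((l t) ^+ 2)%:E < +oo)%E,
      measurable_fun setT (fun z : measurableTypeR R * E => a z.1 z.2) &
      forall t x, `|a t x| <= l t] /\
  [/\ measurable N /\ leb N = 0%E,
      forall t, 0 < t < h -> ~ N t -> forall x, carrier D x -> a t x = v (mu t) x &
      forall H, 0 < H < h -> exists2 X : E -> E, measurable_fun setT X &
        (forall x, `|X x - (x + displacement a 0 H x)| <=
           2 * (expR (int_oc l 0 H) * int_oc (fun r => l r ^+ 2) 0 H * H)) /\
        forall A, measurable A -> mu H A = mu 0 ((wrap_point D \o X) @^-1` A)].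
Proof.
have [mmu0 mv _ weak] := sol.
have [l [a [N [[ml l0 l2 ma] [ab al ap [mN N0] aV]]]]] := exists_field_extension hD h0 hT p2 mv VL.
exists l, a, N; do 2!split => //.
move=> H /andP[H0 Hh].
have HT : H <= T := le_trans (ltW Hh) hT.
have T0 : 0 <= T := le_trans (ltW H0) HT.
(* Stopping the time outside [[0, T]] gives a curve of measures defined and measurable on the whole
   line. *)
pose cl (t : R) : R := Num.max 0 (Num.min T t).
have clI (t : R) : `[0, T]%classic (cl t).
  by rewrite /= in_itv/= /cl le_max lexx ge_max T0 ge_min lexx.
have clE (t : R) : 0 <= t <= T -> cl t = t.
  by move=> /andP[t0 tT]; rewrite /cl min_r// max_r.
pose mu' (t : measurableTypeR R) := mu (cl t).
have mcl : measurable_fun [set: measurableTypeR R] cl.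
  by apply: measurable_maxr; [exact: measurable_cst|apply: measurable_minr => //; exact: measurable_cst].
have mmu A : measurable A -> measurable_fun setT (fun t => mu' t A).
  move=> mA; have mI : measurable (`[0, T]%classic : set (measurableTypeR R)) by exact: measurable_itv.
  apply: (measurable_comp mI _ (mmu0 A mA) mcl) => _ [t _ <-]; exact: clI.
have l2H : (\int[leb]_(t in `[0%R, H]) ((l t) ^+ 2)%:E < +oo)%E.
  apply: le_lt_trans l2; rewrite integral_mkcond [leRHS]integral_mkcond.
  apply: ge0_le_integral_lower => t _.
    by rewrite patchE; case: ifP => // _; rewrite lee_fin sqr_ge0.
  rewrite !patchE; case: ifPn => tH; last by case: ifP => // _; rewrite lee_fin sqr_ge0.
  rewrite mem_set//=; move: tH; rewrite inE /= !in_itv/= => /andP[-> tH].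
  exact: le_trans tH (ltW Hh).
have mD := measurable_carrier hD.
have weak' phi (c0 : R) : test_function D phi ->
  (forall i x, `|'D_(delta_mx ord0 i) phi x| <= c0) -> forall s t : R, 0 <= s -> s <= t -> t <= H ->
  \int[mu' t]_x phi x - \int[mu' s]_x phi x =
  int_oc (fun r => \int[mu' r]_x dotv (a r x) (grad phi x)) s t.
  move=> tphi phic s t s0 st tH.
  have sphi : smooth phi by case: tphi.
  have mphi : measurable_fun setT phi by exact: continuous_measurable_rV (sphi [::]).1.
  have mgrad i : measurable_fun setT (fun x => grad phi x ord0 i).
    have -> : (fun x => grad phi x ord0 i) = 'D_(delta_mx ord0 i) phi.
      by apply/funext => x; rewrite mxE.
    by apply: continuous_measurable_rV; exact: smooth_partial_continuous.
  have mdot (b : R -> E -> E) : measurable_fun setT (fun z : measurableTypeR R * E => b z.1 z.2) ->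
      measurable_fun setT (fun z : measurableTypeR R * E => dotv (b z.1 z.2) (grad phi z.2)).
    move=> mb; apply: measurable_sum => i; apply: measurable_funM.
      exact: (measurableT_comp (measurable_coord i) mb).
    exact: (measurableT_comp (mgrad i) measurable_snd).
  pose G r := \int[mu' r]_x dotv (a r x) (grad phi x).
  have mG : measurable_fun [set: measurableTypeR R] G.
    exact: (measurable_Rintegral_kernel mmu (f := fun r x => dotv (a r x) (grad phi x)) (mdot _ ma)).
  have mTD : measurable ((`[0, T]%classic : set (measurableTypeR R)) `*` carrier D).
    by apply: measurableX; [exact: measurable_itv|exact: mD].
  (* The original field cut off to zero outside the cylinder, to be measurable everywhere. For
     almost every time it agrees on the carrier with the Lipschitz extension [a], so the weak
     equation may be rewritten with [a]. *)
  pose b (r : R) (x : E) : E := \row_i (((fun z : measurableTypeR R * E => v (mu z.1) z.2 ord0 i)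
    \_ (`[0, T] `*` carrier D)) (r, x)).
  have mb : measurable_fun setT (fun z : measurableTypeR R * E => b z.1 z.2).
    apply: measurable_fun_coordP => i; under eq_fun do rewrite mxE -surjective_pairing.
    have mvi : measurable_fun (`[0, T] `*` carrier D)
        (fun z : measurableTypeR R * E => v (mu z.1) z.2 ord0 i).
      exact: (measurableT_comp (measurable_coord i) mv).
    exact: (measurable_restrictT _ mTD).1 mvi.
  pose g r := \int[mu' r]_x dotv (b r x) (grad phi x).
  have mg : measurable_fun [set: measurableTypeR R] g.
    exact: (measurable_Rintegral_kernel mmu (f := fun r x => dotv (b r x) (grad phi x)) (mdot _ mb)).
  have bE (r : R) x : 0 <= r <= T -> carrier D x -> b r x = v (mu r) x.
    move=> rT Dx; apply/rowP => i; rewrite mxE patchE.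
    by rewrite mem_set.
  have msec (c : R -> E -> E) (r : R) : measurable_fun setT (fun z : measurableTypeR R * E => c z.1 z.2) ->
      measurable_fun setT (fun x => dotv (c r x) (grad phi x)).
    by move=> mc; exact: (measurableT_comp (mdot _ mc) (pair1_measurable (r : measurableTypeR R))).
  have wk (u : R) : 0 <= u <= H -> \int[mu' u]_x phi x = \int[mu 0]_x phi x + int_oc G 0 u.
    move=> /andP[u0 uH].
    have uT : 0 <= u <= T by rewrite u0 (le_trans uH).
    have := weak phi tphi u uT.
    have P0 : mu 0 (~` carrier D) = 0%E by apply: muD; rewrite lexx.
    rewrite (prob_Rintegral_full mD (muD uT) mphi) (prob_Rintegral_full mD P0 mphi).
    rewrite /mu' clE// => ->; congr (_ + _).
    have -> : \int[leb]_(s in `[0, u]) (\int[mu s]_(x in carrier D)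
        dotv (v (mu s) x) (grad phi x)) = \int[leb]_(s in `[0, u]) g s.
      apply: eq_Rintegral => r; rewrite inE /= in_itv/= => /andP[r0 ru].
      have rT : 0 <= r <= T by rewrite r0 (le_trans ru)// (le_trans uH).
      rewrite /g /mu' clE// -(prob_Rintegral_full mD (muD rT) (msec b r mb)).
      by apply: eq_Rintegral => x; rewrite inE => Dx; rewrite bE.
    rewrite /int_oc /Rintegral; congr fine; rewrite -integral_itv_obnd_cbnd; last first.
      by apply: measurable_funTS; apply/measurable_EFinP.
    apply: ae_eq_integral.
    - exact: measurable_itv.
    - by apply: measurable_funTS; apply/measurable_EFinP.
    - by apply: measurable_funTS; apply/measurable_EFinP.
    exists N; split => // r /=; apply: contra_notP => nN; rewrite in_itv/= => /andP[r0 ru].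
    have rT : 0 <= r <= T by rewrite (ltW r0) (le_trans ru)// (le_trans uH).
    congr EFin; rewrite /g /G /mu' clE//.
    rewrite -(prob_Rintegral_full mD (muD rT) (msec b r mb)).
    rewrite -(prob_Rintegral_full mD (muD rT) (msec a r ma)).
    apply: eq_Rintegral => x; rewrite inE => Dx; rewrite bE// aV// r0.
    exact: le_lt_trans (le_trans ru uH) Hh.
  have sH : s <= H := le_trans st tH.
  rewrite !wk ?s0 ?sH ?tH ?(le_trans s0)//.
  rewrite (@int_oc_add _ G 0 s t)//.
    by rewrite opprD addrACA subrr add0r addrAC subrr add0r.
  apply: (dominated_integrable ml l0 l2H (c := d.+1%:R * c0)) => // r _.
  apply: prob_Rintegral_norm; first exact: msec ma.
  move=> x; apply: le_trans (dotv_norm_le _ (b := c0) _) _; first by move=> i; rewrite mxE.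
  rewrite -mulrA; apply: ler_wpM2l => //; rewrite mulrC; apply: ler_wpM2l => //.
  exact: le_trans (normr_ge0 _) (phic ord0 0).
have [X [XL XA XP]] := exists_flow H0 ml l0 l2H ma ab al ap mmu weak'.
have mX : measurable_fun setT X.
  apply: measurable_fun_coordP => i.
  apply: (@lipschitz_measurable_rV _ _ _ (expR (int_oc l 0 H))) => x y; apply: le_trans (XL x y).
  by have := coord_le_norm (X x - X y) i; rewrite !mxE.
exists X => //; split => // A mA.
have EH : mu' H = mu H by rewrite /mu' clE// HT ltW.
have E0 : mu' 0 = mu 0 by rewrite /mu' clE// lexx.
rewrite EH E0 in XP.
by apply: (pushforward_determined hD) => //; apply: muD; rewrite HT ltW.
Qed.

End solution_flow.

(** * The infinitesimal estimate *)

Section null_sections.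
Context d1 d2 (T1 : measurableType d1) (T2 : measurableType d2) (R : realType).
Variables (m1 : {sigma_finite_measure set T1 -> \bar R})
  (m2 : {sigma_finite_measure set T2 -> \bar R}).
Variable Z : set (T1 * T2).
Hypothesis mZ : measurable Z.

Let mx := measurable_fun_xsection m2 mZ.

Lemma null_xsections : (m1 \x m2)%E Z = 0%E -> \forall x \ae m1, m2 (xsection Z x) = 0%E.
Proof.
move=> Z0; have : (\int[m1]_x `|(m2 \o xsection Z) x| = 0)%E.
  rewrite -[RHS]Z0 -[RHS]/(product_measure1 m1 m2 Z) /product_measure1.
  by apply: eq_integral => x _; rewrite gee0_abs.
move/(ae_eq_integral_abs m1 measurableT mx).1.
by case=> N [mN N0 sub]; exists N; split => // x /= nx; apply: sub => /= h; apply: nx; exact: h.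
Qed.

(** Tonelli's theorem: both hypotheses and conclusion say that the product measure of [Z] vanishes.
    It turns a statement valid at almost every time for almost every point into one valid at almost
    every point for almost every time. *)
Lemma null_ysections : (\forall x \ae m1, m2 (xsection Z x) = 0%E) ->
  \forall y \ae m2, m1 (ysection Z y) = 0%E.
Proof.
move=> Z0.
have E1 : (\int[m1]_x (m2 \o xsection Z) x = 0)%E.
  have h : (\int[m1]_x `|(m2 \o xsection Z) x| = 0)%E.
    apply/(ae_eq_integral_abs m1 measurableT mx).2.
    by case: Z0 => N [mN N0 sub]; exists N; split => // x /= nx; apply: sub => /= h; apply: nx.
  by rewrite -[RHS]h; apply: eq_integral => x _; rewrite gee0_abs.
have E2 : (\int[m2]_y (m1 \o ysection Z) y = 0)%E.
  rewrite -[RHS]E1 -(indic_fubini_tonelli_FE m2 mZ) -(indic_fubini_tonelli_GE m1 mZ).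
  exact/esym/indic_fubini_tonelli.
have my := measurable_fun_ysection m1 mZ.
have : (\int[m2]_y `|(m1 \o ysection Z) y| = 0)%E.
  by rewrite -[RHS]E2; apply: eq_integral => x _; rewrite gee0_abs.
move/(ae_eq_integral_abs m2 measurableT my).1.
by case=> N [mN N0 sub]; exists N; split => // x /= nx; apply: sub => /= h; apply: nx; exact: h.
Qed.

End null_sections.

(** * Compact sets of almost full measure *)

Section compact_exhaustion.
Context {R : realType} {d : nat}.
Local Notation E := 'rV[R]_d.+1.

Lemma compact_subsequence (C : set E) (u : nat -> E) : compact C -> (forall n, C (u n)) ->
  exists2 x, C x & exists2 g : nat -> nat, {homo g : m n / (m < n)%N} &
    forall n, `|u (g n) - x| < n.+1%:R^-1.
Proof.
move=> cC Cu.
have FC : (u @ \oo) C by exists 0%N => // n _; exact: Cu.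
have [x [Cx cx]] := cC _ _ FC; exists x => //.
have near N k : exists m, (N <= m)%N /\ `|u m - x| < k.+1%:R^-1.
  have h1 : (u @ \oo) [set u m | m in [set m | (N <= m)%N]].
    by exists N => // m /= Nm; exists m.
  have h2 : nbhs x (ball x (k.+1%:R^-1 : R)) by apply: nbhsx_ballx; rewrite invr_gt0.
  have [_ [[m Nm <-] hm]] := cx _ _ h1 h2; exists m; split => //.
  by move: hm; rewrite -ball_normE /= distrC.
have {near} [f fP] := choice (fun z : nat * nat => near z.1 z.2).
pose g := fix g n := if n is k.+1 then f ((g k).+1, k.+1) else f (0%N, 0%N).
exists g; last first.
  by case=> [|k]; [have [] := fP (0%N, 0%N)|have [] := fP ((g k).+1, k.+1)].
apply: homo_ltn => [|k]; first exact: ltn_trans.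
by have [h _] := fP ((g k).+1, k.+1).
Qed.

Variable D : domain R d.
Hypothesis hD : admissible D.

Lemma cvg_ddist (u : nat -> E) x : (forall n, `|u n - x| < n.+1%:R^-1) ->
  ddist D (u n) x @[n --> \oo] --> (0 : R).
Proof.
move=> ux.
have h : d.+1%:R * harmonic n @[n --> \oo] --> (d.+1%:R * 0 : R).
  by apply: cvgM; [exact: cvg_cst|exact: cvg_harmonic].
rewrite mulr0 in h; apply: squeeze_cvgr (cvg_cst 0) h.
apply: nearW => n; rewrite ddist_ge0/=.
apply: le_trans (ddist_le _ _ _) _; apply: le_trans (enorm_le_norm _) _.
by apply: ler_wpM2l => //; exact: ltW.
Qed.

Lemma norm_ball_closed (r : R) : closed [set x : E | `|x| <= r].
Proof.
have -> : [set x : E | `|x| <= r] = Num.norm @^-1` [set s : R | s <= r] by [].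
have cn : continuous (fun x : E => `|x| : R).
  apply: (@lipschitz_continuous_rV _ _ _ 1) => y z.
  by rewrite mul1r ler_dist_dist.
by apply: preimage_closed => // x; exact: cn.
Qed.

Lemma norm_ball_compact (r : R) : compact [set x : E | `|x| <= r].
Proof.
apply: bounded_closed_compact; last exact: norm_ball_closed.
  by exists r; split; [exact: num_real|move=> M rM x /= xr; exact: le_trans xr (ltW rM)].
Qed.

(** Large balls on the whole space, by continuity of the measure from above; the closure of a
    bounded domain; the cell itself on the torus, which is compact for the quotient distance because
    limits can be folded back into it. *)
Lemma exists_dcompact (P : probability E R) (e : R) : P (~` carrier D) = 0%E -> 0 < e ->
  exists K, [/\ dcompact D K, measurable K & (P (~` K) <= e%:E)%E].
Proof.
move=> PD e0; move: hD PD.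
have mc : measurable (carrier D) by exact: measurable_carrier.
have ce := cvg_ddist; move: mc ce; case: D => [|Om|L] mc ce HD PD.
- pose K (j : nat) : set E := [set x | `|x| <= j%:R].
  have mK j : measurable (K j).
    rewrite -[K j]setCK; apply: measurableC; apply: open_measurable_rV; apply: closed_openC.
    by apply: compact_closed; [exact: norm_hausdorff|exact: norm_ball_compact].
  have cK : (P \o (fun j => ~` K j)) j @[j --> \oo] --> P (\bigcap_j ~` K j).
    apply: nonincreasing_cvg_mu.
    + by apply: le_lt_trans (probability_le1 P _) (ltry _); exact: measurableC.
    + by move=> j; exact: measurableC.
    + by apply: bigcap_measurable => // j _; exact: measurableC.
    + move=> i j ij; apply/subsetPset; apply: subsetC => x /= h.
      by apply: le_trans h _; rewrite ler_nat.
  have K0 : \bigcap_j ~` K j = set0.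
    apply/seteqP; split => // x /(_ (Num.bound `|x|) I) /=; apply.
    by apply: ltW; apply: archi_boundP.
  rewrite K0 measure0 in cK.
  have h1 : nbhs (0%E : \bar R) [set y : \bar R | (y < e%:E)%E].
    by apply: open_ereal_lt'; rewrite lte_fin.
  have [j _ hj] := cK _ h1.
  exists (K j); split; [|exact: mK|by apply: ltW; exact: (hj j (leqnn j))].
  split => // u Ku; have [x Kx [g gm gx]] := compact_subsequence (@norm_ball_compact j%:R) Ku.
  by exists x => //; exists g => //; exact: ce.
- have [oO _ _ bO _] := HD.
  exists (closure Om); split.
  + split => // u Ku; have cO : compact (closure Om).
      apply: bounded_closed_compact; last exact: closed_closure.
      have [M [_ hM]] := bO; exists (M + 1); split; first exact: num_real.
      move=> M' hM' x /= xO.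
      have sub : closure Om `<=` [set x : E | `|x| <= M + 1].
        rewrite [X in _ `<=` X](closure_id _).1; last exact: norm_ball_closed.
        by apply: closure_subset => y Oy; apply: hM => //; rewrite ltrDl.
      exact: le_trans (sub x xO) (ltW hM').
    have [x Kx [g gm gx]] := compact_subsequence cO Ku.
    by exists x => //; exists g => //; exact: ce.
  + rewrite -[closure Om]setCK; apply: measurableC; apply: open_measurable_rV.
    by apply: closed_openC; exact: closed_closure.
  + apply: (@le_trans _ _ (P (~` carrier (Bounded Om)))); last first.
      by apply: (@le_trans _ _ 0%E); [rewrite le_eqVlt; apply/orP; left; apply/eqP; exact: PD|rewrite lee_fin ltW].
    apply: le_measure; rewrite ?inE; last by apply: subsetC; exact: subset_closure.
      by apply: open_measurable_rV; apply: closed_openC; exact: closed_closure.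
    exact: measurableC.
- exists (carrier (Torus L)); split => //; last first.
    by apply: (@le_trans _ _ 0%E); [rewrite le_eqVlt; apply/orP; left; apply/eqP; exact: PD|rewrite lee_fin ltW].
  split => // u Ku.
  have Ku' n : [set x : E | `|x| <= L] (u n).
    apply: norm_le_coord => i; have /andP[h1 h2] := Ku n i; rewrite ler_norml.
    by apply/andP; split; lra.
  have [x Kx [g gm gx]] := compact_subsequence (@norm_ball_compact L) Ku'.
  exists (wrap_point (Torus L) x); first exact: (wrap_point_range HD).
  exists g => //.
  have -> : (fun n => ddist (Torus L) (u (g n)) (wrap_point (Torus L) x)) =
      (fun n => ddist (Torus L) (u (g n)) x).
    by apply/funext => n; rewrite ddistC ddist_wrapl ddistC.
  exact: ce.
Qed.

End compact_exhaustion.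

Section displacement_difference.
Context {R : realType} {d : nat}.
Local Notation E := 'rV[R]_d.+1.
Local Notation leb := (@lebesgue_measure R).
Local Notation n := (d.+1%:R : R).
Variables (h : R) (l : R -> R).
Hypothesis h0 : 0 < h.
Hypothesis ml : measurable_fun [set: measurableTypeR R] l.
Hypothesis l0 : forall t, 0 <= l t.
Hypothesis l2 : (\int[leb]_(t in `[0%R, h]) ((l t) ^+ 2)%:E < +oo)%E.

(** Absolute continuity of the integral at [0]; this is what improves the flow error from [O(H)] to
    [o(H)]. *)
Lemma int_oc_sq_small (e : R) : 0 < e -> exists2 c, 0 < c &
  forall H, 0 < H < c -> H <= h -> int_oc (fun r => l r ^+ 2) 0 H <= e.
Proof.
move=> e0.
have il : leb.-integrable `[0, h] (EFin \o (fun r => l r ^+ 2)).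
  apply/integrableP; split.
    by apply/measurable_EFinP; apply: measurable_funTS; exact: measurable_funX.
  by under eq_integral do rewrite /= ger0_norm ?sqr_ge0//.
have [c /= c0 hc] := parameterized_integral_near_left h0 e0 il.
exists c => // H /andP[H0 Hc] Hh.
have := hc H; rewrite /= sub0r normrN gtr0_norm// => /(_ Hc (ltW H0)) h1.
apply: le_trans (ltW h1); apply: le_trans (ler_norm _).
rewrite /int_oc /parameterized_integral Rintegral_itv_obnd_cbnd//.
apply: (integrableS _ _ _ il); [exact: measurable_itv|exact: measurable_itv|].
by move=> r /=; rewrite !in_itv/= => /andP[/ltW -> rH]; exact: le_trans rH Hh.
Qed.

Variables (a b : R -> E -> E).
Hypothesis ma : measurable_fun setT (fun z : measurableTypeR R * E => a z.1 z.2).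
Hypothesis mb : measurable_fun setT (fun z : measurableTypeR R * E => b z.1 z.2).
Hypothesis al : forall t x, `|a t x| <= l t.
Hypothesis bl : forall t x, `|b t x| <= l t.

Let w (x : E) (r : R) := enorm (a r x - b r x).

Lemma measurable_field_distance : measurable_fun setT
  (fun z : measurableTypeR R * E => enorm (a z.1 z.2 - b z.1 z.2)).
Proof. by apply: (measurableT_comp measurable_enorm); exact: measurable_rVB. Qed.

Let mw x : measurable_fun [set: measurableTypeR R] (w x).
Proof. exact: (measurableT_comp measurable_field_distance (pair2_measurable x)). Qed.

Let wl x r : `|w x r| <= n * 2 * l r.
Proof.
rewrite ger0_norm ?enorm_ge0//; apply: le_trans (enorm_le_norm _) _.
rewrite -mulrA; apply: ler_wpM2l => //; apply: le_trans (ler_normB _ _) _.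
by have := al r x; have := bl r x; lra.
Qed.

Lemma field_distance_integrable x H : 0 <= H -> H <= h ->
  leb.-integrable `]0, H] (EFin \o w x).
Proof. by move=> H0 Hh; apply: (dominated_integrable ml l0 l2 (c := n * 2)). Qed.

(** The integral is coordinatewise, while the norm is Euclidean: the difference [z] is tested
    against itself, [|z|^2] being the integral of [dotv (a - b) z], which is at most [|z|] times the
    integral of [|a - b|]. *)
Lemma enorm_displacementB x H : 0 <= H -> H <= h ->
  enorm (displacement a 0 H x - displacement b 0 H x) <= int_oc (w x) 0 H.
Proof.
move=> H0 Hh; set z := _ - _.
have [z0|z0] := eqVneq (enorm z) 0.
  by rewrite z0; apply: int_oc_ge0 => r; exact: enorm_ge0.
have zp : 0 < enorm z by rewrite lt_neqAle eq_sym z0 enorm_ge0.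
rewrite -(ler_pM2r zp) -expr2 sqr_enorm {1}/z.
have mdz (c : R -> E -> E) : measurable_fun setT (fun z : measurableTypeR R * E => c z.1 z.2) ->
    measurable_fun [set: measurableTypeR R] (fun r => dotv (c r x) z).
  move=> mc; apply: measurable_sum => i; apply: measurable_funM; last exact: measurable_cst.
  exact: (measurableT_comp (measurable_coord i) (measurableT_comp mc (pair2_measurable x))).
have bz (c : R -> E -> E) r : (forall t x, `|c t x| <= l t) ->
    `|dotv (c r x) z| <= n * `|z| * l r.
  move=> cl; apply: le_trans (dotv_norm_le _ (b := `|z|) _) _; first exact: coord_le_norm.
  by rewrite -mulrA; apply: ler_wpM2l => //; rewrite mulrC; apply: ler_wpM2l.
have -> : dotv (displacement a 0 H x - displacement b 0 H x) z =
    int_oc (fun r => dotv (a r x) z - dotv (b r x) z) 0 H.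
  rewrite -(int_ocB ml l0 l2 (c := n * `|z|) (c' := n * `|z|))//; first last.
  - by move=> r _; exact: bz.
  - exact: mdz.
  - by move=> r _; exact: bz.
  - exact: mdz.
  have iE := @int_oc_dotv R d h l _ ml l0 l2 _ _ x z 0 H (lexx 0) Hh.
  rewrite (iE a)// (iE b)// /dotv -sumrB; apply: eq_bigr => i _.
  by rewrite !mxE mulrBl.
rewrite /int_oc [leRHS]mulrC -RintegralZl; last 2 first.
- exact: measurable_itv.
- exact: field_distance_integrable.
have miz : measurable (`]0, H]%classic : set (measurableTypeR R)) by exact: measurable_itv.
apply: le_Rintegral => //.
- apply: (dominated_integrable ml l0 l2 (c := n * `|z| + n * `|z|)) => //.
    by apply: measurable_funB; exact: mdz.
  by move=> r _; rewrite mulrDl; apply: le_trans (ler_normB _ _) _; apply: lerD; exact: bz.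
- by apply: real_integrableZ => //; exact: field_distance_integrable.
move=> r _; rewrite mulrC; apply: le_trans (dotv_le _ _).
by rewrite /dotv -sumrB le_eqVlt; apply/orP; left; apply/eqP; apply: eq_bigr => i _; rewrite !mxE mulrBl.
Qed.

End displacement_difference.

Section almost_everywhere.
Context dd (X : measurableType dd) (R : realType) (m : {measure set X -> \bar R}).

Lemma ae_and (A B : X -> Prop) : (\forall x \ae m, A x) -> (\forall x \ae m, B x) ->
  \forall x \ae m, A x /\ B x.
Proof. by move=> mA mB; apply: filterS2 mA mB => x. Qed.

Lemma ae_imply (A B : X -> Prop) : (forall x, A x -> B x) -> (\forall x \ae m, A x) ->
  \forall x \ae m, B x.
Proof. by move=> AB; exact: filterS. Qed.

Lemma ae_notin (N : set X) : measurable N -> m N = 0%E -> \forall x \ae m, ~ N x.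
Proof. by move=> mN N0; exists N; split => // x /= /contrapT. Qed.

Lemma ae_null (A : set X) : (\forall x \ae m, ~ A x) -> measurable A -> m A = 0%E.
Proof.
move=> [B [mB B0 sub]] mA; apply/eqP; rewrite eq_le measure_ge0 andbT -B0.
by apply: le_measure; rewrite ?inE// => x Ax; apply: sub => /=; apply.
Qed.

End almost_everywhere.

Section vrestrict.
Context dd (X : measurableType dd) (R : realType) (n : nat).
Variables (A : set X) (f : X -> 'rV[R]_n).

Definition vrestrict (x : X) : 'rV[R]_n := \row_i ((fun x => f x ord0 i) \_ A) x.

Lemma vrestrict_in x : A x -> vrestrict x = f x.
Proof. by move=> Ax; apply/rowP => i; rewrite mxE patchE mem_set. Qed.

Lemma vrestrict_out x : ~ A x -> vrestrict x = 0.
Proof. by move=> Ax; apply/rowP => i; rewrite !mxE patchE memNset. Qed.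

Lemma measurable_vrestrict : measurable A -> measurable_fun A f -> measurable_fun setT vrestrict.
Proof.
move=> mA mf; apply: measurable_fun_coordP => i; under eq_fun do rewrite mxE.
apply: (measurable_restrictT _ mA).1; exact: (measurableT_comp (measurable_coord i) mf).
Qed.

End vrestrict.

Lemma int_oc_ae_le (R : realType) (f : R -> R) (c s t : R) :
  (@lebesgue_measure R).-integrable `]s, t] (EFin \o f) -> 0 <= c -> s <= t ->
  (forall r, 0 <= f r) ->
  (\forall r \ae (@lebesgue_measure R), s < r <= t -> f r <= c) ->
  int_oc f s t <= (t - s) * c.
Proof.
move=> iF c0 st f0 fc; rewrite /int_oc /Rintegral -lee_fin fineK; last first.
  by apply: integrable_fin_num => //; exact: measurable_itv.
have mI : measurable (`]s, t]%classic : set (measurableTypeR R)) by exact: measurable_itv.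
have -> : ((t - s) * c)%:E = (\int[@lebesgue_measure R]_(r in `]s, t]) (cst c%:E r))%E.
  rewrite integral_cst// mulrC EFinM; congr (_ * _)%E; exact/esym/lebesgue_oc.
apply: ae_ge0_le_integral => //.
- by move=> r _; rewrite lee_fin.
- by case/integrableP: iF.
Qed.

Lemma le_fine (R : realType) (x : \bar R) : (0 <= x)%E -> (x < +oo)%E -> (x <= (fine x)%:E)%E.
Proof. by move=> x0 xoo; rewrite fineK// ge0_fin_numE. Qed.

Lemma root_fine (R : realType) (x : \bar R) (p : R) : 0 < p -> (0 <= x)%E -> (x < +oo)%E ->
  (x `^ p^-1)%E = (fine x `^ p^-1)%:E /\ ((fine x `^ p^-1) `^ p)%:E = x.
Proof.
move=> p0 x0 xoo; have xf : x \is a fin_num by rewrite ge0_fin_numE.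
split; first by rewrite -{1}(fineK xf) poweR_EFin.
by rewrite -powRrM mulVf ?gt_eqF// powRr1 ?fineK// fine_ge0.
Qed.

Section probability_bounds.
Context dd (X : measurableType dd) (R : realType) (P : probability X R) (p : R).
Hypothesis p1 : 1 <= p.

Let p0 : 0 < p. Proof. exact: lt_le_trans p1. Qed.

Lemma prob_integral_ae_le (f : X -> R) (c : R) : measurable_fun setT f ->
  (forall x, 0 <= f x) -> 0 <= c -> (\forall x \ae P, f x <= c) ->
  (\int[P]_x (f x)%:E <= c%:E)%E.
Proof.
move=> mf f0 c0 fc; apply: (@le_trans _ _ (\int[P]_x (cst c%:E x))%E).
  apply: ae_ge0_le_integral => //.
  - by move=> x _; rewrite lee_fin.
  - exact/measurable_EFinP.
  - by apply: ae_imply fc => x h _; rewrite lee_fin.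
rewrite integral_cst// -[leRHS]mule1; apply: lee_wpmul2l; first by rewrite lee_fin.
exact: probability_le1.
Qed.

(** Isolates the bookkeeping of the majorant used in the local estimate: small error on [K], crude
    bound off [K]. *)
Lemma piecewise_integral_le (F : X -> R) (K : set X) (M eta b : R) : measurable K ->
  measurable_fun setT F -> (forall x, 0 <= F x) -> 0 <= M -> 0 <= eta ->
  (\int[P]_x (F x)%:E + eta%:E + (M `^ p)%:E * P (~` K) <= (b `^ p)%:E)%E ->
  (\int[P]_x ((if x \in K then (F x + eta) `^ p^-1 else M) `^ p)%:E <= (b `^ p)%:E)%E.
Proof.
move=> mK mF F0 M0 e0; apply: le_trans.
have mKc : measurable (~` K) by exact: measurableC.
apply: (@le_trans _ _ (\int[P]_x ((F x)%:E + (eta%:E + (M `^ p)%:E * (\1_(~` K) x)%:E)))%E).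
  apply: ge0_le_integral_lower => x _; first by rewrite lee_fin powR_ge0.
  rewrite -EFinM -!EFinD lee_fin indicE in_setC; case: ifP => _ /=.
    rewrite mulr0 addr0 -powRrM mulVf ?gt_eqF// powRr1//.
    exact: addr_ge0.
  by rewrite mulr1 addrA lerDr addr_ge0.
have M1 : 0 <= M `^ p by rewrite powR_ge0.
have mI : measurable_fun setT (fun x => (\1_(~` K) x)%:E : \bar R).
  by apply/measurable_EFinP; exact: measurable_indic.
rewrite ge0_integralD//; last 4 first.
- by move=> x _; rewrite lee_fin.
- exact/measurable_EFinP.
- by move=> x _; apply: adde_ge0; [rewrite lee_fin|apply: mule_ge0; rewrite lee_fin].
- apply: emeasurable_funD; first exact: measurable_cst.
  by apply: emeasurable_funM => //; exact: measurable_cst.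
rewrite ge0_integralD//; last 2 first.
- by move=> x _; apply: mule_ge0; rewrite lee_fin.
- by apply: emeasurable_funM => //; exact: measurable_cst.
rewrite ge0_integralZl//.
rewrite integral_indic// setIT addeA leeD2r// leeD2l//.
rewrite integral_cst// -[leRHS]mule1; apply: lee_wpmul2l; first by rewrite lee_fin.
exact: probability_le1.
Qed.

Lemma Lpn_affine_le (f phi : X -> R) (H b c : R) : measurable_fun setT f ->
  measurable_fun setT phi -> (forall x, 0 <= f x) -> (forall x, 0 <= phi x) ->
  0 <= H -> 0 <= b -> 0 <= c -> (\int[P]_x (phi x `^ p)%:E <= (b `^ p)%:E)%E ->
  (\forall x \ae P, f x <= H * phi x + c) -> (Lpn P p f <= (H * b + c)%:E)%E.
Proof.
move=> mf mphi f0 phi0 H0 b0 c0 phib fphi.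
have mH : measurable_fun setT (fun x => H * phi x).
  by apply: measurable_funM => //; exact: measurable_cst.
have H1 x : 0 <= H * phi x by exact: mulr_ge0.
apply: (@le_trans _ _ (Lpn P p (fun x => H * phi x + c))).
  apply: Lpn_le => //; first by apply: measurable_funD => //; exact: measurable_cst.
apply: le_trans (LpnD P p1 mH (measurable_cst c) H1 (fun=> c0)) _.
rewrite EFinD; apply: leeD; last first.
  by rewrite (@Lpn_cst _ _ _ P p p1 c c0) ?probability_setT//; exact: probability_setT.
rewrite /Lpn.
have -> : (\int[P]_x ((H * phi x) `^ p)%:E = (H `^ p)%:E * \int[P]_x (phi x `^ p)%:E)%E.
  rewrite -ge0_integralZl//.
  - by apply: eq_integral => x _; rewrite powRM.
  - exact: measurable_powR_EFin.
  - by move=> x _; rewrite lee_fin powR_ge0.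
  - by rewrite lee_fin powR_ge0.
have -> : (H * b)%:E = (((H * b) `^ p)%:E `^ p^-1)%E.
  by rewrite poweR_EFin -powRrM mulfV ?gt_eqF// powRr1// mulr_ge0.
apply: poweR_le; first by rewrite invr_ge0 ltW.
  by rewrite mule_ge0 ?lee_fin ?powR_ge0//; apply: integral_ge0 => x _; rewrite lee_fin powR_ge0.
by rewrite powRM// EFinM; apply: lee_wpmul2l => //; rewrite lee_fin powR_ge0.
Qed.

End probability_bounds.

(** The coupling is the joint image of [rho] under the pair of maps [X] and [Y]. *)
Lemma Wp_image_le (R : realType) (d : nat) (D : domain R d) (p : R)
    (rho mu nu : probability 'rV[R]_d.+1 R) (X Y : 'rV[R]_d.+1 -> 'rV[R]_d.+1) :
  1 <= p -> measurable_fun setT X -> measurable_fun setT Y ->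
  (forall A, measurable A -> mu A = rho (X @^-1` A)) ->
  (forall A, measurable A -> nu A = rho (Y @^-1` A)) ->
  (Wp D p mu nu <= Lpn rho p (fun x => ddist D (X x) (Y x)))%E.
Proof.
move=> p1 mX mY muX nuY.
have mXY : measurable_fun setT (fun x => (X x, Y x)) by exact: measurable_fun_pair.
have [pi [piE piI]] := ex_image_probability rho mXY.
have -> : Lpn rho p (fun x => ddist D (X x) (Y x)) = Lpn pi p (fun z => ddist D z.1 z.2).
  by symmetry; exact: (Lpn_image piI p (measurable_ddist D)).
apply: (@Wp_le_coupling R d D p p1 mu nu pi) => A mA; split.
  rewrite piE muX//; congr (rho _); apply/seteqP; split => x /=; first by case.
  by [].
by rewrite piE nuY//; congr (rho _); apply/seteqP; split => x /=; first by case.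
Qed.

(** The deviation of the flow from a single Euler step is [H] times the integral of [l ^ 2] up to
    [H], and that integral vanishes with [H]; the exponential stays below its value at [h]. *)
Lemma flow_error_small (R : realType) (h : R) (l : R -> R) (k e : R) : 0 < h ->
  measurable_fun [set: measurableTypeR R] l -> (forall t, 0 <= l t) ->
  (\int[@lebesgue_measure R]_(t in `[0%R, h]) ((l t) ^+ 2)%:E < +oo)%E -> 0 < k -> 0 < e ->
  exists2 c, 0 < c & forall H, 0 < H < c -> H <= h ->
    k * (expR (int_oc l 0 H) * int_oc (fun r => l r ^+ 2) 0 H * H) <= e * H.
Proof.
move=> h0 ml l0 l2 k0 e0.
pose X := expR (int_oc l 0 h).
have X0 : 0 < X by exact: expR_gt0.
have [c c0 hc] := int_oc_sq_small h0 ml l2 (divr_gt0 e0 (mulr_gt0 k0 X0)).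
exists c => // H Hc Hh; have /andP[H0 _] := Hc; have Q := hc H Hc Hh.
rewrite mulrA; apply: ler_wpM2r; first exact: ltW.
have XH : expR (int_oc l 0 H) <= X.
  rewrite ler_expR (om_add ml l0 l2 (lexx 0) (ltW H0) Hh (lexx h)) lerDl.
  exact: om_ge0.
have Q0 : 0 <= int_oc (fun r => l r ^+ 2) 0 H by apply: int_oc_ge0 => r; exact: sqr_ge0.
apply: (@le_trans _ _ (k * (X * (e / (k * X))))).
  apply: ler_wpM2l; first exact: ltW.
  by apply: ler_pM; [exact: expR_ge0|exact: Q0|exact: XH|exact: Q].
by rewrite le_eqVlt; apply/orP; left; apply/eqP; field; rewrite !gt_eqF.
Qed.

Lemma half_powR_gap_gt0 (R : realType) (p g e : R) : 0 < p -> 0 <= g -> 0 < e ->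
  0 < ((g + e) `^ p - g `^ p) / 2.
Proof.
move=> p0 g0 e0; rewrite divr_gt0// subr_gt0; apply: gt0_ltr_powR => //; rewrite ?ltrDl//.
by rewrite nnegrE addr_ge0// ltW.
Qed.

Lemma powR_le_root (R : realType) (p w b : R) : 0 < p -> 0 <= w -> w `^ p <= b -> w <= b `^ p^-1.
Proof.
move=> p0 w0 wb; have b0 : 0 <= b := le_trans (powR_ge0 w p) wb.
rewrite -[leLHS]powRr1// -(mulfV (lt0r_neq0 p0)) powRrM.
by apply: ge0_ler_powR; rewrite ?nnegrE ?invr_ge0 ?powR_ge0// ltW.
Qed.

Lemma mulr_fraction_le (R : realType) (m e : R) : 0 <= m -> 0 <= e -> m * (e / (m + 1)) <= e.
Proof.
move=> m0 e0; rewrite mulrCA; apply: ler_piMr => //.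
by rewrite ler_pdivrMr ?mul1r ?lerDl// ltr_wpDl.
Qed.

Lemma square_integral_add (R : realType) (h : R) (f g : R -> R) :
  measurable_fun [set: measurableTypeR R] f -> measurable_fun [set: measurableTypeR R] g ->
  (\int[@lebesgue_measure R]_(t in `[0%R, h]) ((f t) ^+ 2)%:E < +oo)%E ->
  (\int[@lebesgue_measure R]_(t in `[0%R, h]) ((g t) ^+ 2)%:E < +oo)%E ->
  (\int[@lebesgue_measure R]_(t in `[0%R, h]) ((f t + g t) ^+ 2)%:E < +oo)%E.
Proof.
move=> mf mg f2 g2.
have mI : measurable (`[0, h]%classic : set (measurableTypeR R)) by exact: measurable_itv.
have int2 (k : R -> R) : measurable_fun [set: measurableTypeR R] k ->
    (\int[@lebesgue_measure R]_(t in `[0%R, h]) ((k t) ^+ 2)%:E < +oo)%E ->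
    (@lebesgue_measure R).-integrable `[0, h] (EFin \o (fun t => 2 * k t ^+ 2)).
  move=> mk k2; apply: real_integrableZ => //; apply/integrableP; split.
    by apply/measurable_EFinP; apply: measurable_funTS; exact: measurable_funX.
  by under eq_integral do rewrite /= ger0_norm ?sqr_ge0//.
apply: integrable_lty => //; apply: le_integrable (real_integrableD mI (int2 f mf f2) (int2 g mg g2)) => //.
  apply/measurable_EFinP; apply: measurable_funTS; apply: measurable_funX.
  exact: measurable_funD.
move=> t _ /=; rewrite lee_fin ger0_norm ?sqr_ge0// ger0_norm; last first.
  by rewrite addr_ge0// mulr_ge0// sqr_ge0.
by have := sqr_ge0 (f t - g t); rewrite sqrrB sqrrD; lra.
Qed.

Lemma measurable_piecewise dd (X : measurableType dd) (R : realType) (K : set X)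
    (f : X -> R) (M : R) : measurable K -> measurable_fun setT f ->
  measurable_fun setT (fun x => if x \in K then f x else M).
Proof.
move=> mK mf.
have -> : (fun x => if x \in K then f x else M) =
    (fun x => (\1_K x : R) * f x + (1 - \1_K x) * M).
  by apply/funext => x; rewrite indicE; case: ifP => _ /=; ring.
have m1 : measurable_fun setT (fun x => \1_K x : R) by exact: measurable_indic.
apply: measurable_funD; first exact: measurable_funM.
have m2 : measurable_fun setT (fun x => 1 - (\1_K x : R)) by exact: measurable_funB.
by apply: measurable_funM => //; exact: measurable_cst.
Qed.

(** * Distance of the two solutions over a short time *)

Section local_estimate.
Context {R : realType} {d : nat}.
Local Notation E := 'rV[R]_d.+1.
Local Notation leb := (@lebesgue_measure R).
Local Notation lebE := (lebesgue_rV R d.+1).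
Local Notation P := (probability E R).
Local Notation n := (d.+1%:R : R).
Variables (D : domain R d) (p T h delta : R) (vm vn : P -> E -> E) (mu nu : R -> P) (rho : P).
Hypotheses (hD : admissible D) (p1 : 1 <= p) (h0 : 0 < h) (hT : h <= T) (delta0 : 0 < delta).
Hypotheses (solm : weak_solution D T vm mu) (soln : weak_solution D T vn nu).
Hypotheses (mu0 : mu 0 = rho) (nu0 : nu 0 = rho).
Hypothesis muD : forall t : R, 0 <= t <= T -> mu t (~` carrier D) = 0%E.
Hypothesis nuD : forall t : R, 0 <= t <= T -> nu t (~` carrier D) = 0%E.
Hypothesis rho_ac : forall A, measurable A -> lebE A = 0%E -> rho A = 0%E.
Hypothesis Lm : Lq_BL D (2 + delta) h (fun t => vm (mu t)).
Hypothesis Ln : Lq_BL D (2 + delta) h (fun t => vn (nu t)).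
Hypothesis w0_bound :
  (Linf (carrier D) (fun x => (enorm (vm rho x - vn rho x) `^ p)%R) < +oo)%E.
Hypothesis cyl : exists2 h' : R, 0 < h' <= T &
  Linf_cyl D h' (fun t x => vn (nu t) x - vm (mu t) x).
Hypothesis cpt : forall C, dcompact D C ->
  ('N[@lebesgue_measure R]_+oo
     [(fun tau => Linf (C `&` carrier D)
         (fun x => (enorm (vn (nu tau) x - vm (mu tau) x) `^ p
                    - enorm (vn rho x - vm rho x) `^ p)%R))
      \_ `[0%R, h]])%E @[h --> 0^'+] --> 0%E.

Let mD : measurable (carrier D). Proof. exact: measurable_carrier. Qed.

Let T0 : 0 <= T. Proof. exact: le_trans (ltW h0) hT. Qed.

Let rhoD : rho (~` carrier D) = 0%E. Proof. by rewrite -mu0 muD// lexx T0. Qed.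

Let p0 : 0 < p. Proof. exact: lt_le_trans p1. Qed.

Let initial_measurable (v : P -> E -> E) (m : R -> P) : weak_solution D T v m ->
  measurable_fun (carrier D) (v (m 0)).
Proof.
move=> [_ mv _ _].
have mTD : measurable ((`[0, T]%classic : set (measurableTypeR R)) `*` carrier D).
  by apply: measurableX; [exact: measurable_itv|exact: mD].
have mp : measurable_fun (carrier D) (fun x : E => ((0 : measurableTypeR R), x)).
  exact: measurable_funTS (pair1_measurable (0 : measurableTypeR R)).
apply: (measurable_comp mTD _ mv mp) => _ [x Dx <-]; split => //=.
by rewrite in_itv/= lexx T0.
Qed.

(** Velocities are constrained on the carrier only; cutting them off makes the difference measurable
    on the whole space. *)
Let w0 (x : E) : R := enorm (vrestrict (carrier D) (vn rho) x - vrestrict (carrier D) (vm rho) x).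

Let mw0 : measurable_fun setT w0.
Proof.
apply: (measurableT_comp measurable_enorm); apply: measurable_rVB.
  by apply: measurable_vrestrict => //; rewrite -nu0; exact: initial_measurable soln.
by apply: measurable_vrestrict => //; rewrite -mu0; exact: initial_measurable solm.
Qed.

Let w0E x : carrier D x -> w0 x = enorm (vn rho x - vm rho x).
Proof. by move=> Dx; rewrite /w0 !vrestrict_in. Qed.

Let mF0 : measurable_fun setT (fun x => w0 x `^ p).
Proof. by apply: (measurableT_comp (f := fun r : R => r `^ p)) mw0; exact: measurable_powR. Qed.

Definition speed : \bar R :=
  ((\int[rho]_(x in carrier D) (enorm (vn rho x - vm rho x) `^ p)%:E) `^ p^-1)%E.

Let I0 : \bar R := (\int[rho]_x (w0 x `^ p)%:E)%E.

Let I0E : (\int[rho]_(x in carrier D) (enorm (vn rho x - vm rho x) `^ p)%:E)%E = I0.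
Proof.
rewrite integral_mkcond; apply: eq_integral => x _; rewrite patchE.
case: ifPn => [|xD]; first by rewrite inE => /w0E <-.
have w00 : w0 x = 0.
  rewrite /w0 !vrestrict_out ?subrr ?enorm0// => Dx; by move: xD; rewrite mem_set.
by rewrite w00 powR0// gt_eqF.
Qed.

Let ac_ae (Q : E -> Prop) : (\forall x \ae lebE, Q x) -> \forall x \ae rho, Q x.
Proof. by move=> [N [mN N0 sub]]; exists N; split; [exact: mN|exact: rho_ac mN N0|exact: sub]. Qed.

Let I0_lty : (I0 < +oo)%E.
Proof.
pose B := fine (Linf (carrier D) (fun x => (enorm (vm rho x - vn rho x) `^ p)%R)).
have BE : (Linf (carrier D) (fun x => (enorm (vm rho x - vn rho x) `^ p)%R) <= B%:E)%E.
  by apply: le_fine w0_bound; exact: Linf_ge0.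
have B0 : 0 <= B by apply: fine_ge0; exact: Linf_ge0.
have h1 := ac_ae (ae_le_Linf BE).
have h2 : \forall x \ae rho, carrier D x.
  by exists (~` carrier D); split; [exact: measurableC|exact: rhoD|].
apply: (le_lt_trans _ (ltry B)); apply: prob_integral_ae_le => [|x||].
- exact: mF0.
- exact: powR_ge0.
- exact: B0.
- apply: ae_imply (ae_and h1 h2) => x [hx Dx].
  have := le_trans (ler_norm _) (hx Dx); rewrite (w0E Dx) (enormB (vn rho x)); exact.
Qed.

Let I0_ge0 : (0 <= I0)%E.
Proof. by apply: integral_ge0 => x _; rewrite lee_fin powR_ge0. Qed.

Let speedE : speed = ((fine I0) `^ p^-1)%:E.
Proof. by rewrite /speed I0E; exact: (root_fine p0 I0_ge0 I0_lty).1. Qed.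

Lemma speed_fin_num : speed \is a fin_num.
Proof. by rewrite speedE. Qed.

Let g := fine speed.

Let g0 : 0 <= g. Proof. by rewrite /g speedE powR_ge0. Qed.

Let gp : (g `^ p)%:E = I0.
Proof. by rewrite /g speedE; exact: (root_fine p0 I0_ge0 I0_lty).2. Qed.

Lemma exists_cylinder_bound : exists h' M, [/\ 0 < h', 0 <= M &
  \forall t \ae leb, 0 < t < h' ->
    \forall x \ae lebE, carrier D x -> enorm (vn (nu t) x - vm (mu t) x) <= M].
Proof.
have [h' /andP[h'0 _] [_ Vb]] := cyl.
have VM := le_fine (Lnorm_ge0 _ _ _) Vb.
set M := fine _ in VM.
have M0 : 0 <= M by apply: fine_ge0; exact: Lnorm_ge0.
exists h', M; split; [exact: h'0|exact: M0|].
have [N [mN N0 sub]] := ae_le_Lnorm_infty VM.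
apply: ae_imply (null_xsections mN N0) => t Nt ht.
exists (xsection N t); split; [exact: measurable_xsection|exact: Nt|].
move=> x /= nx; rewrite /xsection /= inE; apply: sub => /= h1; apply: nx => Dx.
move: h1; rewrite patchE mem_set; last by split => //=; rewrite in_itv.
by rewrite /= lee_fin ger0_norm ?enorm_ge0.
Qed.

Lemma exists_compact_bound (K : set E) (eta : R) : dcompact D K -> 0 < eta ->
  exists2 h', 0 < h' & \forall t \ae leb, 0 < t < h' ->
    \forall x \ae lebE, (K `&` carrier D) x ->
      `|enorm (vn (nu t) x - vm (mu t) x) `^ p - enorm (vn rho x - vm rho x) `^ p| <= eta.
Proof.
move=> cK e0.
have h1 : nbhs (0%E : \bar R) [set y : \bar R | (y < eta%:E)%E].
  by apply: open_ereal_lt'; rewrite lte_fin.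
have {h1} := cpt cK h1; rewrite near_simpl => h1.
near (0 : R)^'+ => h'.
have h'0 : 0 < h' by near: h'; exact: nbhs_right_gt.
exists h'; first exact: h'0.
have Nh : ('N[leb]_+oo [(fun tau => Linf (K `&` carrier D)
         (fun x => (enorm (vn (nu tau) x - vm (mu tau) x) `^ p
                    - enorm (vn rho x - vm rho x) `^ p)%R))
      \_ `[0%R, h']] < eta%:E)%E by near: h'.
apply: ae_imply (ae_le_Lnorm_infty (ltW Nh)) => t + /andP[t0 th].
rewrite patchE mem_set; last by rewrite /= in_itv/= !ltW.
by move=> h2; apply: ae_le_Linf; apply: le_trans h2; exact: lee_abs.
Unshelve. all: by end_near. Qed.

Theorem local_estimate (e : R) : 0 < e -> exists2 c, 0 < c &
  forall H, 0 < H < c -> (Wp D p (mu H) (nu H) <= (H * (fine speed + e))%:E)%E.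
Proof.
have gI : (\int[rho]_x (w0 x `^ p)%:E = (g `^ p)%:E)%E := esym gp.
rewrite -/g; move=> e0; clear gp I0E I0_lty I0_ge0 speedE; clearbody g; clear I0.
have w0_ge0 x : 0 <= w0 x by exact: enorm_ge0.
(* Half of [e] goes to the L^p norm of the velocity difference, and a quarter to the deviation of
   each flow from its Euler step. *)
clearbody w0; pose e2 := e / 2; have e20 : 0 < e2 by rewrite divr_gt0.
have e40 : 0 < e / 4 by rewrite divr_gt0.
(* The gap between the two powers is split in two: one [eta] for the error on [K], the other for the
   mass outside [K]. *)
pose eta := ((g + e2) `^ p - g `^ p) / 2.
have eta0 : 0 < eta.
  exact: half_powR_gap_gt0 p0 g0 e20.
have [hc [M [hc0 M0 cylM]]] := exists_cylinder_bound.
have Mp0 : 0 < M `^ p + 1 by apply: ltr_wpDl; [exact: powR_ge0|exact: ltr01].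
(* The mass left outside [K] is weighted by [M] to the power [p]; the added [1] keeps the divisor
   positive. *)
have [K [cK mK KP]] := exists_dcompact hD rhoD (divr_gt0 eta0 Mp0).
have [hk hk0 cptK] := exists_compact_bound cK eta0.
have p2 : 2 <= 2 + delta by rewrite lerDl ltW.
have [l [a [N [[ml l0 l2 ma ab] [[mN N0] aV Xa]]]]] := exists_solution_flow hD h0 hT p2 solm muD Lm.
have [l' [b [N' [[ml' l'0 l'2 mb bb] [[mN' N'0] bV Xb]]]]] :=
  exists_solution_flow hD h0 hT p2 soln nuD Ln.
pose L r := l r + l' r.
have mL : measurable_fun [set: measurableTypeR R] L by exact: measurable_funD.
have L0 t : 0 <= L t by exact: addr_ge0.
have L2 : (\int[leb]_(t in `[0%R, h]) ((L t) ^+ 2)%:E < +oo)%E.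
  exact: square_integral_add ml ml' l2 l'2.
have aL t x : `|a t x| <= L t by apply: le_trans (ab t x) _; rewrite lerDl.
have bL t x : `|b t x| <= L t by apply: le_trans (bb t x) _; rewrite lerDr.
(* A majorant of the velocity difference valid for all small times: the initial difference up to
   [eta] on [K], the bound [M] elsewhere. *)
pose phi (x : E) : R := if x \in K then (w0 x `^ p + eta) `^ p^-1 else M.
have phi0 x : 0 <= phi x by rewrite /phi; case: ifP => _; [exact: powR_ge0|exact: M0].
have mphi : measurable_fun setT phi.
  apply: measurable_piecewise => //.
  apply: (measurableT_comp (f := fun r : R => r `^ p^-1)); first exact: measurable_powR.
  by apply: measurable_funD; [exact: mF0|exact: measurable_cst].
have phib : (\int[rho]_x (phi x `^ p)%:E <= ((g + e2) `^ p)%:E)%E.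
  apply: (piecewise_integral_le p1 mK mF0 (fun x => powR_ge0 _ _) M0 (ltW eta0)).
  rewrite gI.
  apply: (@le_trans _ _ ((g `^ p)%:E + eta%:E + (M `^ p)%:E * (eta / (M `^ p + 1))%:E)%E).
    by apply: leeD => //; apply: lee_wpmul2l => //; rewrite lee_fin powR_ge0.
  rewrite -EFinM -!EFinD lee_fin.
  have h1 : M `^ p * (eta / (M `^ p + 1)) <= eta.
    by apply: mulr_fraction_le; [exact: powR_ge0|exact: ltW].
  have h2 : eta + eta = (g + e2) `^ p - g `^ p by rewrite /eta; field.
  by rewrite -addrA -lerBrDl -h2 lerD2l.
pose hs := Num.min h (Num.min hc hk).
have hs0 : 0 < hs by rewrite !lt_min h0 hc0 hk0.
have [hsh hsc hsk] : [/\ hs <= h, hs <= hc & hs <= hk].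
  by rewrite /hs; split; rewrite !ge_min lexx ?orbT.
clearbody hs.
(* The pairs of time and starting point where the majorant fails. At almost every time the points
   concerned are Lebesgue negligible, hence [rho]-negligible; exchanging sections, for [rho]-almost
   every starting point the majorant holds at almost every time. *)
pose Z : set (measurableTypeR R * E) := ((`]0, hs[%classic : set (measurableTypeR R)) `*` carrier D) `&`
  [set z | phi z.2 < enorm (a z.1 z.2 - b z.1 z.2)].
have mZ : measurable Z.
  apply: measurableI; first by apply: measurableX; [exact: measurable_itv|exact: mD].
  apply: measurable_ltr_set; first exact: (measurableT_comp mphi measurable_snd).
  exact: measurable_field_distance.
have Zx : \forall r \ae leb, rho (xsection Z r) = 0%E.
  apply: ae_imply (ae_and (ae_and (ae_notin mN N0) (ae_notin mN' N'0)) (ae_and cylM cptK)).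
  move=> r [[nN nN'] [h1 h2]].
  have [/andP[r0 rs]|r1] := pselect (0 < r < hs); last first.
    have -> : xsection Z r = set0.
      apply/seteqP; split => // x; rewrite /xsection/= inE => -[[]] /=.
      by rewrite in_itv.
    exact: measure0.
  have rh := lt_le_trans rs hsh.
  have rc := lt_le_trans rs hsc; have rk := lt_le_trans rs hsk.
  have {}h1 := h1 (introT andP (conj r0 rc)).
  have {}h2 := h2 (introT andP (conj r0 rk)).
  have mxs : measurable (xsection Z r) by exact: measurable_xsection.
  suff nz : \forall x \ae lebE, ~ xsection Z r x by exact: (rho_ac mxs (ae_null nz mxs)).
  apply: ae_imply (ae_and h1 h2) => x [M1 K1].
  rewrite /xsection /= inE => -[[_ /= Dx] /=]; apply/negP; rewrite -leNgt.
  rewrite (aV r (introT andP (conj r0 rh)) nN x Dx) (bV r (introT andP (conj r0 rh)) nN' x Dx).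
  rewrite (enormB (vm (mu r) x)) /phi; case: ifPn => [|_]; last exact: M1.
  rewrite inE => xK; have := K1 (conj xK Dx); rewrite -(w0E Dx).
  rewrite ler_norml => /andP[_ h3]; apply: powR_le_root; [exact: p0|exact: enorm_ge0|].
  by rewrite -lerBlDl; exact: h3.
have Zy := null_ysections mZ Zx.
have n2 : 0 < n * 2 by rewrite mulr_gt0.
have [c1 c10 hc1] := flow_error_small h0 ml l0 l2 n2 e40.
have [c2 c20 hc2] := flow_error_small h0 ml' l'0 l'2 n2 e40.
exists (Num.min hs (Num.min c1 c2)); first by rewrite !lt_min hs0 c10 c20.
move=> H /andP[H0]; rewrite lt_min => /andP[Hs]; rewrite lt_min => /andP[Hc1 Hc2].
have Hh := lt_le_trans Hs hsh.
have [X mX [XA Xmu]] := Xa H (introT andP (conj H0 Hh)).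
have [Y mY [YA Ynu]] := Xb H (introT andP (conj H0 Hh)).
rewrite mu0 in Xmu; rewrite nu0 in Ynu.
have mX' : measurable_fun setT (wrap_point D \o X) by exact: measurableT_comp (measurable_wrap hD) mX.
have mY' : measurable_fun setT (wrap_point D \o Y) by exact: measurableT_comp (measurable_wrap hD) mY.
apply: le_trans (Wp_image_le D p1 mX' mY' Xmu Ynu) _.
have -> : H * (g + e) = H * (g + e2) + H * e2 by rewrite /e2; field.
have ge2 : 0 <= g + e2 by rewrite addr_ge0// ltW.
have He2 : 0 <= H * e2 by rewrite mulr_ge0// ltW.
apply: (Lpn_affine_le p1 _ mphi _ phi0 (ltW H0) ge2 He2 phib).
- exact: (measurableT_comp (measurable_ddist D) (measurable_fun_pair mX' mY')).
- by move=> x; exact: ddist_ge0.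
have aeD : \forall x \ae rho, carrier D x.
  by exists (~` carrier D); split; [exact: measurableC|exact: rhoD|].
apply: ae_imply (ae_and Zy aeD) => x [Z0 Dx].
apply: le_trans (ddist_wrap D (X x) (Y x)) _.
have Hh' : H <= h := ltW Hh.
have i1 : int_oc (fun r => enorm (a r x - b r x)) 0 H <= (H - 0) * phi x.
  apply: int_oc_ae_le (phi0 x) (ltW H0) _ _.
  - exact: (field_distance_integrable mL L0 L2 ma mb aL bL x (ltW H0) Hh').
  - by move=> r; exact: enorm_ge0.
  exists (ysection Z x); split; [exact: measurable_ysection|exact: Z0|].
  move=> r /=; apply: contra_notP => nZ; move/andP => [r0 rH]; rewrite leNgt; apply/negP => hr.
  apply: nZ; rewrite /ysection /= inE; split; last exact: hr.
  by split; [rewrite /= in_itv/= r0 (le_lt_trans rH)|exact: Dx].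
rewrite subr0 in i1.
have i2 := enorm_displacementB mL L0 L2 ma mb aL bL x (ltW H0) Hh'.
have i3 := hc1 H (introT andP (conj H0 Hc1)) Hh'.
have i4 := hc2 H (introT andP (conj H0 Hc2)) Hh'.
have i5 : enorm (X x - (x + displacement a 0 H x)) <= e / 4 * H.
  apply: le_trans (enorm_le_norm _) _; apply: le_trans (ler_wpM2l _ (XA x)) _ => //.
  by rewrite -mulrA in i3.
have i6 : enorm (Y x - (x + displacement b 0 H x)) <= e / 4 * H.
  apply: le_trans (enorm_le_norm _) _; apply: le_trans (ler_wpM2l _ (YA x)) _ => //.
  by rewrite -mulrA in i4.
(* Only the displacements from [x] see the difference of the fields; what remains is the deviation
   of each flow from its own displacement. *)
have -> : X x - Y x = (displacement a 0 H x - displacement b 0 H x) +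
    ((X x - (x + displacement a 0 H x)) + - (Y x - (x + displacement b 0 H x))).
  move: (displacement a 0 H x) (displacement b 0 H x) (X x) (Y x) => u v y z.
  by apply/rowP => i; rewrite !mxE; ring.
apply: le_trans (enormD _ _) _; apply: lerD; first exact: le_trans i2 i1.
apply: le_trans (enormD _ _) _; rewrite enormN.
by apply: le_trans (lerD i5 i6) _; rewrite /e2; lra.
Qed.

End local_estimate.

(** * Comparison of semigroups *)

Lemma small_interval_integral (R : realType) (T : R) (h : R -> R) :
  (forall u : R, 0 <= u -> 0 <= h u) ->
  (@lebesgue_measure R).-integrable `[0, T] (EFin \o h) ->
  forall e : R, 0 < e -> exists2 a : R, 0 < a & forall r s : R, 0 <= r -> r <= s -> s <= T ->
    s - r < a -> (\int[@lebesgue_measure R]_(u in `[r, s]) (h u)%:E < e%:E)%E.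
Proof.
move=> h0 ih e e0.
have mT : measurable (`[0, T]%classic : set (measurableTypeR R)) by exact: measurable_itv.
pose f : measurableTypeR R -> R := h \_ `[0, T].
have fi : (@lebesgue_measure R).-integrable setT (EFin \o f).
  have := (@integrable_mkcond _ _ R (@lebesgue_measure R) _ (EFin \o h : measurableTypeR R -> \bar R) mT).1 ih.
  by apply: eq_integrable => // x _; rewrite /f /= restrict_EFin.
have [a [a0 ha]] := integral_normr_continuous fi e0.
exists a => // r s r0 rs sT sr.
have mrs : measurable (`[r, s]%classic : set (measurableTypeR R)) by exact: measurable_itv.
have lrs : (@lebesgue_measure R (`[r, s]%classic : set (measurableTypeR R)) < a%:E)%E.
  have /= -> := lebesgue_measure_itv `[r, s].
  by rewrite lte_fin; case: ifP => _; rewrite -?EFinB lte_fin.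
have := ha _ mrs lrs; rewrite -lte_fin.
have fE (u : R) : `[r, s]%classic u -> `|f u| = h u.
  rewrite /= in_itv/= => /andP[ru us]; rewrite /f patchE mem_set/= ?in_itv/=.
    by rewrite ger0_norm// h0// (le_trans r0).
  by rewrite (le_trans r0)//= (le_trans us).
rewrite /Rintegral fineK; last first.
  apply: integrable_fin_num => //; apply: integrable_norm.
  exact: (integrableS measurableT _ _ fi).
apply: le_lt_trans; rewrite le_eqVlt; apply/orP; left; apply/eqP.
by apply: eq_integral => u; rewrite inE => /fE /= ->.
Qed.

Section semigroup_comparison.
Context {R : realType} (X : Type).
Local Notation leb := (@lebesgue_measure R).
Variables (W : X -> X -> \bar R) (A1 A2 : set X) (S1 S2 : R -> X -> X) (K : R -> R) (T : R).
Variable g : X -> R.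
Hypothesis W_ge0 : forall x y, (0 <= W x y)%E.
Hypothesis Wxx : forall x, W x x = 0%E.
Hypothesis WC : forall x y, W x y = W y x.
Hypothesis Wtri : forall y x z, (W x z <= W x y + W y z)%E.
Hypothesis A12 : A1 `<=` A2.
Hypothesis S1A : forall (t : R) (x : X), 0 <= t <= T -> A1 x -> A1 (S1 t x).
Hypothesis S2A : forall (t : R) (x : X), 0 <= t <= T -> A2 x -> A2 (S2 t x).
Hypothesis S1_0 : forall x, A1 x -> S1 0 x = x.
Hypothesis S2_0 : forall x, A2 x -> S2 0 x = x.
Hypothesis S1D : forall (t s : R) (x : X), 0 <= t -> 0 <= s -> t + s <= T -> A1 x ->
  S1 t (S1 s x) = S1 (t + s) x.
Hypothesis S2D : forall (t s : R) (x : X), 0 <= t -> 0 <= s -> t + s <= T -> A2 x ->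
  S2 t (S2 s x) = S2 (t + s) x.
Hypothesis AC : forall x y, A1 x -> A2 y -> exists h : R -> R,
  [/\ forall u : R, 0 <= u -> 0 <= h u, forall M : R, leb.-integrable `[0, M] (EFin \o h) &
    forall s t : R, 0 <= s -> s < t -> t <= T ->
      (W (S1 t x) (S1 s x) <= \int[leb]_(u in `[s, t]) (h u)%:E)%E /\
      (W (S2 t y) (S2 s y) <= \int[leb]_(u in `[s, t]) (h u)%:E)%E].
Hypothesis K0 : forall t : R, 0 <= t <= T -> 0 < K t.
Hypothesis Kc : {within `[0, T], continuous K}.
Hypothesis WK : forall t : R, 0 <= t <= T -> forall x y, A2 x -> A2 y ->
  (W (S2 t x) (S2 t y) <= (K t)%:E * W x y)%E.
Hypothesis g0 : forall x, A1 x -> 0 <= g x.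
Hypothesis loc : forall x (e : R), A1 x -> 0 < e -> exists2 c : R, 0 < c &
  forall h : R, 0 < h < c -> (W (S1 h x) (S2 h x) <= (h * (g x + e))%:E)%E.

Let K_near (x e : R) : 0 <= x <= T -> 0 < e -> exists2 a : R, 0 < a &
  forall y : R, 0 <= y <= T -> `|y - x| < a -> K y <= K x + e.
Proof.
move=> xT e0; have xI : `[0, T]%classic x by rewrite /= in_itv.
have := (@subspace_continuousP _ `[0, T]%classic _ K).1 Kc x xI.
move=> /cvgrPdist_lt /(_ e e0) [a /= a0 ha]; exists a => // y yT yx.
have := ha y; rewrite /= -distrC => /(_ yx); rewrite in_itv/= => /(_ yT).
by rewrite ltr_norml => /andP[h _]; lra.
Qed.

Let modulus x y : A1 x -> A2 y -> forall e : R, 0 < e -> exists2 a : R, 0 < a &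
  forall r s : R, 0 <= r <= T -> 0 <= s <= T -> `|r - s| < a ->
    (W (S1 r x) (S1 s x) < e%:E)%E /\ (W (S2 r y) (S2 s y) < e%:E)%E.
Proof.
move=> Ax Ay e e0; have [h [h0 ih hW]] := AC Ax Ay.
have [a a0 ha] := small_interval_integral h0 (ih T) e0.
exists a => // r s /andP[r0 rT] /andP[s0 sT] rs.
have [rs'|sr|->] := ltgtP r s.
- have [h1 h2] := hW r s r0 rs' sT.
  have hl := ha r s r0 (ltW rs') sT; rewrite distrC gtr0_norm ?subr_gt0// in rs.
  by rewrite WC (WC (S2 r y)); split; [exact: le_lt_trans h1 (hl rs)|exact: le_lt_trans h2 (hl rs)].
- have [h1 h2] := hW s r s0 sr rT.
  have hl := ha s r s0 (ltW sr) rT; rewrite gtr0_norm ?subr_gt0// in rs.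
  by split; [exact: le_lt_trans h1 (hl rs)|exact: le_lt_trans h2 (hl rs)].
- by rewrite !Wxx lte_fin.
Qed.

(** [W] may take the value [+oo]. Absolute continuity makes it finite along orbits, which is what
    allows [phi] below to be real valued. *)
Let S1_fin x (r s : R) : A1 x -> 0 <= r <= T -> 0 <= s <= T -> (W (S1 r x) (S1 s x) < +oo)%E.
Proof.
move=> Ax rT sT; have [h [h0 ih hW]] := AC Ax (A12 Ax).
have fin (u v : R) : 0 <= u -> v <= T -> (\int[leb]_(w in `[u, v]) (h w)%:E < +oo)%E.
  move=> u0 vT; apply: integrable_lty; first exact: measurable_itv.
  apply: (integrableS _ _ _ (ih T)); [exact: measurable_itv|exact: measurable_itv|].
  by move=> w /=; rewrite !in_itv/= => /andP[uw wv]; rewrite (le_trans u0 uw) (le_trans wv vT).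
move: rT sT => /andP[r0 rT] /andP[s0 sT].
have [rs|sr|->] := ltgtP r s; last by rewrite Wxx ltry.
  by rewrite WC; apply: le_lt_trans (hW r s r0 rs sT).1 _; exact: fin.
by apply: le_lt_trans (hW s r s0 sr rT).1 _; exact: fin.
Qed.

Let S2_fin y (r s : R) x : A1 x -> A2 y -> 0 <= r <= T -> 0 <= s <= T -> (W (S2 r y) (S2 s y) < +oo)%E.
Proof.
move=> Ax Ay rT sT; have [h [h0 ih hW]] := AC Ax Ay.
have fin (u v : R) : 0 <= u -> v <= T -> (\int[leb]_(w in `[u, v]) (h w)%:E < +oo)%E.
  move=> u0 vT; apply: integrable_lty; first exact: measurable_itv.
  apply: (integrableS _ _ _ (ih T)); [exact: measurable_itv|exact: measurable_itv|].
  by move=> w /=; rewrite !in_itv/= => /andP[uw wv]; rewrite (le_trans u0 uw) (le_trans wv vT).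
move: rT sT => /andP[r0 rT] /andP[s0 sT].
have [rs|sr|->] := ltgtP r s; last by rewrite Wxx ltry.
  by rewrite WC; apply: le_lt_trans (hW r s r0 rs sT).2 _; exact: fin.
by apply: le_lt_trans (hW s r s0 sr rT).2 _; exact: fin.
Qed.

Variables (x : X) (t : R).
Hypothesis Ax : A1 x.
Hypotheses (t0 : 0 < t) (tT : t <= T).

(* Interpolates between [S2 t x] at [s = 0] and [S1 t x] at [s = t]. *)
Let F (s : R) : X := S2 (t - s) (S1 s x).

Let sT (s : R) : 0 <= s <= t -> 0 <= s <= T.
Proof. by move=> /andP[-> st]; exact: le_trans st tT. Qed.

Let tsT (s : R) : 0 <= s <= t -> 0 <= t - s <= T.
Proof. by move=> /andP[s0 st]; rewrite subr_ge0 st/= lerBlDr (le_trans tT)// lerDl. Qed.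

(** First the starting point of the second semigroup changes at fixed duration, then the duration
    changes at fixed starting point. *)
Let F_dist (r s : R) : 0 <= r <= t -> 0 <= s <= t ->
  (W (F r) (F s) <= (K (t - r))%:E * W (S1 r x) (S1 s x) +
     W (S2 (t - r) (S1 s x)) (S2 (t - s) (S1 s x)))%E.
Proof.
move=> rt st; apply: le_trans (Wtri (S2 (t - r) (S1 s x)) _ _) _.
apply: leeD => //; apply: WK; [exact: tsT| |]; apply: A12; apply: S1A => //; exact: sT.
Qed.

Let F_fin (r s : R) : 0 <= r <= t -> 0 <= s <= t -> (W (F r) (F s) < +oo)%E.
Proof.
move=> rt st; apply: le_lt_trans (F_dist rt st) _.
have As : A1 (S1 s x) by apply: S1A => //; exact: sT.
apply: lte_add_pinfty.
  apply: lte_mul_pinfty => //; first by rewrite lee_fin ltW// K0// tsT.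
  exact: (S1_fin Ax (sT rt) (sT st)).
exact: (S2_fin As (A12 As) (tsT rt) (tsT st)).
Qed.

(** Measuring from the fixed end [F 0] reduces the curve to a scalar function, whose increments are
    bounded by the distances between points of the curve. *)
Let phi (s : R) : R := fine (W (F s) (F 0)).

Let zt : 0 <= (0 : R) <= t. Proof. by rewrite lexx ltW. Qed.

Let Wf (r s : R) : 0 <= r <= t -> 0 <= s <= t -> W (F r) (F s) = (fine (W (F r) (F s)))%:E.
Proof. by move=> rt st; rewrite fineK// ge0_fin_numE//; exact: F_fin. Qed.

Let phi_diff (r s : R) (b : R) : 0 <= r <= t -> 0 <= s <= t -> (W (F r) (F s) <= b%:E)%E ->
  phi r - phi s <= b.
Proof.
move=> rt st rsb; have := Wtri (F s) (F r) (F 0).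
rewrite (Wf rt zt) (Wf st zt) => h; rewrite lerBlDr -lee_fin EFinD.
by apply: le_trans h _; rewrite leeD2r.
Qed.

Theorem semigroup_comparison : (W (S1 t x) (S2 t x) <=
  \int[leb]_(s in `[0%R, t]) (K (t - s) * g (S1 s x))%:E)%E.
Proof.
have tt : 0 <= t <= t by rewrite lexx ltW.
have Ft : F t = S1 t x by rewrite /F subrr S2_0//; apply: A12; apply: S1A => //; exact: sT.
have F0 : F 0 = S2 t x by rewrite /F subr0 S1_0.
rewrite -Ft -F0 (Wf tt zt) -/(phi t).
apply: dini_le_integral => //.
- move=> s st; rewrite mulr_ge0//; first by rewrite ltW// K0// tsT.
  by apply: g0; apply: S1A => //; exact: sT.
- move=> s st e e0.
  have As : A1 (S1 s x) by apply: S1A => //; exact: sT.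
  have [a1 a10 ha1] := K_near (tsT st) ltr01.
  have Ks : 0 < K (t - s) by apply: K0; exact: tsT.
  (* Near [t - s] the factor [K] is at most [K (t - s) + 1]; each of the two terms of [F_dist] then
     costs [e / 4]. *)
  pose e1 := e / 4 / (K (t - s) + 1).
  have e10 : 0 < e1 by rewrite !divr_gt0// ltr_wpDl// ltW.
  have [a2 a20 ha2] := modulus Ax (A12 Ax) e10.
  have e40 : 0 < e / 4 by rewrite divr_gt0.
  have [a3 a30 ha3] := modulus As (A12 As) e40.
  exists (Num.min a1 (Num.min a2 a3)); first by rewrite !lt_min a10 a20 a30.
  move=> r rt; rewrite !lt_min => /andP[r1 /andP[r2 r3]].
  have trs : `|(t - r) - (t - s)| = `|r - s|.
    by rewrite opprB addrC addrA subrK distrC.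
  have b : (W (F r) (F s) <= (e / 2)%:E)%E.
    apply: le_trans (F_dist rt st) _.
    have -> : e / 2 = (K (t - s) + 1) * e1 + e / 4.
      by rewrite /e1; field; rewrite gt_eqF// ltr_wpDl// ltW.
    rewrite EFinD; apply: leeD; last first.
      by apply: ltW; apply: (ha3 _ _ (tsT rt) (tsT st) _).2; rewrite trs.
    rewrite EFinM; apply: lee_pmul => //.
    + by rewrite lee_fin ltW// K0// tsT.
    + by rewrite lee_fin ha1 ?tsT// trs.
    + by apply: ltW; exact: (ha2 _ _ (sT rt) (sT st) r2).1.
  have h1 := phi_diff rt st b; rewrite WC in b; have h2 := phi_diff st rt b.
  by rewrite ltr_norml; apply/andP; split; lra.
- by rewrite /phi Wxx.
move=> s /andP[s0 st] e e0.
have sI : 0 <= s <= t by rewrite s0 ltW.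
have As : A1 (S1 s x) by apply: S1A => //; exact: sT.
have Ks : 0 < K (t - s) by apply: K0; exact: tsT.
set y := S1 s x in As *; set k := K (t - s) in Ks *.
have gy := g0 As.
(* Together with [e2] this makes the product of the perturbed factors, [(k + e2) * (g y + e1)], at
   most [k * g y + e], half of the error coming from each perturbation. *)
pose e1 := e / (2 * (k + 1)).
have e10 : 0 < e1 by rewrite divr_gt0// mulr_gt0// ltr_wpDl// ltW.
pose e2 := Num.min 1 (e / (2 * (g y + e1 + 1))).
have ge1 : 0 < g y + e1 + 1 by rewrite ltr_wpDl// addr_ge0// ltW.
have e20 : 0 < e2 by rewrite lt_min ltr01 divr_gt0// mulr_gt0.
have [a1 a10 ha1] := K_near (tsT sI) e20.
have [a2 a20 ha2] := loc As e10.
exists (Num.min a1 a2); first by rewrite lt_min a10 a20.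
move=> h; rewrite lt_min => /andP[h0 /andP[h1 h2]] sht.
have shI : 0 <= s + h <= t by rewrite sht andbT addr_ge0// ltW.
apply: phi_diff => //.
(* Both semigroup laws exhibit [F (s + h)] and [F s] as images under the same map [S2 (t - (s + h))]
   of [S1 h y] and [S2 h y]; its Lipschitz bound leaves only the distance after a short time from
   the common point [y]. *)
have -> : F (s + h) = S2 (t - (s + h)) (S1 h y).
  have hsT : h + s <= T by rewrite addrC; exact: le_trans sht tT.
  by rewrite /F /y (S1D (ltW h0) s0 hsT Ax) (addrC h).
have -> : F s = S2 (t - (s + h)) (S2 h y).
  rewrite /F -/y S2D//; first by congr S2; ring.
  - by rewrite subr_ge0.
  - exact: ltW.
  - by apply: le_trans tT; lra.
  - exact: A12.
have hT : 0 <= h <= T.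
  by rewrite (ltW h0)/=; apply: le_trans (le_trans sht tT); rewrite lerDr.
apply: le_trans (WK (tsT shI) (A12 (S1A hT As)) (S2A hT (A12 As))) _.
have KE : K (t - (s + h)) <= k + e2.
  apply: ha1; first exact: tsT.
  have -> : t - (s + h) - (t - s) = - h by ring.
  by rewrite normrN gtr0_norm.
apply: (@le_trans _ _ ((k + e2)%:E * (h * (g y + e1))%:E)%E).
  apply: lee_pmul => //; first by rewrite lee_fin ltW// K0// tsT.
  by apply: ha2; rewrite h0.
rewrite -EFinM lee_fin mulrCA; apply: ler_wpM2l; first exact: ltW.
have i1 : k * e1 <= e / 2.
  have -> : e / 2 = (k + 1) * e1 by rewrite /e1; field; rewrite gt_eqF// ltr_wpDl// ltW.
  by apply: ler_wpM2r; [exact: ltW|rewrite lerDl].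
have i2 : e2 * (g y + e1) <= e / 2.
  apply: (@le_trans _ _ (e / (2 * (g y + e1 + 1)) * (g y + e1 + 1))); last first.
    by rewrite le_eqVlt; apply/orP; left; apply/eqP; field; rewrite gt_eqF.
  apply: ler_pM; [exact: ltW|by rewrite addr_ge0// ltW| |by rewrite lerDl].
  by rewrite /e2 ge_min lexx orbT.
have -> : (k + e2) * (g y + e1) = k * g y + k * e1 + e2 * (g y + e1) by ring.
lra.
Qed.

End semigroup_comparison.

Lemma Pp_L1_abs_cont (R : realType) (d : nat) (D : domain R d) (p : R)
    (rho : probability 'rV[R]_d.+1 R) : Pp_L1 D p rho ->
  forall A, measurable A -> lebesgue_rV R d.+1 A = 0%E -> rho A = 0%E.
Proof.
move=> [_ _ [f [fi f0 fE]]] A mA A0; rewrite (fE A mA).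
apply: null_set_integral; [exact: mA| |exact: A0].
exact: measurable_funS measurableT (@subsetT _ A) (measurable_int _ fi).
Qed.

Unset Implicit Arguments.
Set Strict Implicit.

Theorem theorem1p6 (R : realType) (d : nat) (D : domain R d) (p T : R)
  (vmu vnu : probability 'rV[R]_d.+1 R -> 'rV[R]_d.+1 -> 'rV[R]_d.+1)
  (A1 A2 : set (probability 'rV[R]_d.+1 R))
  (S1 S2 : R -> probability 'rV[R]_d.+1 R -> probability 'rV[R]_d.+1 R)
  (K : R -> R)
  (hD : admissible D) (hp : 1 <= p) (hT : 0 < T)
  (* (I) *)
  (hA12 : A1 `<=` A2) (hA2 : A2 `<=` Pp_L1 D p)
  (hwp1 : well_posed D T vmu A1) (hwp2 : well_posed D T vnu A2)
  (hI1 : forall rho0 mu nu, A1 rho0 ->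
    solution_in D T vmu A1 rho0 mu -> solution_in D T vnu A2 rho0 nu ->
    narrowly_continuous D T mu /\ narrowly_continuous D T nu)
  (hI2 : forall rho0 mu nu, A1 rho0 ->
    solution_in D T vmu A1 rho0 mu -> solution_in D T vnu A2 rho0 nu ->
    exists h delta : R, [/\ 0 < h <= T, 0 < delta,
      Lq_BL D (2 + delta) h (fun t => vmu (mu t)) &
      Lq_BL D (2 + delta) h (fun t => vnu (nu t))])
  (hI3 : forall rho, A1 rho ->
    dcontinuous D (fun x => enorm (vmu rho x - vnu rho x) `^ p) /\
    (Linf (carrier D) (fun x => (enorm (vmu rho x - vnu rho x) `^ p)%R) < +oo)%E)
  (hI4 : forall rho0 mu nu, A1 rho0 ->
    solution_in D T vmu A1 rho0 mu -> solution_in D T vnu A2 rho0 nu ->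
    (exists2 h : R, 0 < h <= T &
      Linf_cyl D h (fun t x => vnu (nu t) x - vmu (mu t) x)) /\
    (forall C, dcompact D C ->
      ('N[@lebesgue_measure R]_+oo
         [(fun tau => Linf (C `&` carrier D)
             (fun x => (enorm (vnu (nu tau) x - vmu (mu tau) x) `^ p
                        - enorm (vnu rho0 x - vmu rho0 x) `^ p)%R))
          \_ `[0%R, h]])%E @[h --> 0^'+] --> 0%E))
  (hI5 : forall Om, D = Bounded Om -> forall rho0 mu nu, A1 rho0 ->
    solution_in D T vmu A1 rho0 mu -> solution_in D T vnu A2 rho0 nu ->
    exists2 h : R, 0 < h <= T &
      \forall t \ae (@lebesgue_measure R), 0 <= t <= h ->
        forall x n, outer_normal Om x n ->
          (exists2 l, boundary_value Om (vmu (mu t)) x l & dotv l n = 0) /\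
          (exists2 l, boundary_value Om (vnu (nu t)) x l & dotv l n <= 0))
  (* (II) *)
  (hII : forall mu0 nu0 mu nu, A1 mu0 -> A2 nu0 ->
    solution_in D T vmu A1 mu0 mu -> solution_in D T vnu A2 nu0 nu ->
    exists h : R -> R, [/\ forall u, 0 <= u -> 0 <= h u,
      forall M, (@lebesgue_measure R).-integrable `[0, M] (EFin \o h) &
      forall s t, 0 <= s -> s < t -> t <= T ->
        (Wp D p (mu t) (mu s) <=
           \int[@lebesgue_measure R]_(u in `[s, t]) (h u)%:E)%E /\
        (Wp D p (nu t) (nu s) <=
           \int[@lebesgue_measure R]_(u in `[s, t]) (h u)%:E)%E])
  (* (III) *)
  (hS1 : generates_semigroup D T vmu A1 S1)
  (hS2 : generates_semigroup D T vnu A2 S2)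
  (hK0 : forall t, 0 <= t <= T -> 0 < K t)
  (hKc : {within `[0, T], continuous K})
  (hK : forall t, 0 <= t <= T -> forall nu1 nu2, A2 nu1 -> A2 nu2 ->
    (Wp D p (S2 t nu1) (S2 t nu2) <= (K t)%:E * Wp D p nu1 nu2)%E) :
  forall rho0 mu nu, A1 rho0 ->
    solution_in D T vmu A1 rho0 mu -> solution_in D T vnu A2 rho0 nu ->
    forall t, 0 <= t <= T ->
    (Wp D p (mu t) (nu t) <=
      \int[@lebesgue_measure R]_(s in `[0%R, t])
        ((K (t - s)%R)%:E *
         (\int[mu s]_(x in carrier D)
            (enorm (vnu (mu s) x - vmu (mu s) x)%R `^ p)%:E) `^ p^-1))%E.
Proof.
move=> rho0 mu nu A0 solm soln t /andP[t0 tT].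
have [[S1A S1_0 S1D] S1s] := hS1.
have [[S2A S2_0 S2D] S2s] := hS2.
have z0 : 0 <= (0 : R) <= T by rewrite lexx ltW.
have muE (s : R) : 0 <= s <= T -> mu s = S1 s rho0.
  by move=> sT; exact: (hwp1 _ A0).2 _ _ solm (S1s _ A0) s sT.
have nuE (s : R) : 0 <= s <= T -> nu s = S2 s rho0.
  by move=> sT; exact: (hwp2 _ (hA12 _ A0)).2 _ _ soln (S2s _ (hA12 _ A0)) s sT.
have null rho : A2 rho -> rho (~` carrier D) = 0%E by move=> /hA2[].
have ac rho : A1 rho -> forall A, measurable A -> lebesgue_rV R d.+1 A = 0%E -> rho A = 0%E.
  by move=> /hA12 /hA2; exact: Pp_L1_abs_cont.
have S1null rho : A1 rho -> forall s : R, 0 <= s <= T -> S1 s rho (~` carrier D) = 0%E.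
  by move=> Ar s sT; apply/null/hA12/S1A.
have S2null rho : A1 rho -> forall s : R, 0 <= s <= T -> S2 s rho (~` carrier D) = 0%E.
  by move=> Ar s sT; apply/null/S2A => //; exact: hA12.
have spfin rho : A1 rho -> speed D p vmu vnu rho \is a fin_num.
  move=> Ar; have [_ _ w1] := S1s _ Ar; have [_ _ w2] := S2s _ (hA12 _ Ar).
  exact: (speed_fin_num hD hp hT (lexx T) w1 w2 (S1_0 _ Ar) (S2_0 _ (hA12 _ Ar))
    (S1null _ Ar) (ac _ Ar) (hI3 _ Ar).2).
(* The Dini argument requires a nondegenerate interval, so the initial time is treated apart. *)
have [t00|tpos] := leP t 0.
  have -> : t = 0 by apply/le_anti; rewrite t00.
  rewrite (muE _ z0) (nuE _ z0) (S1_0 _ A0) (S2_0 _ (hA12 _ A0)) (Wpxx D hp).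
  apply: integral_ge0 => s; rewrite /= in_itv/= => /andP[s0 sT].
  apply: mule_ge0; last exact: poweR_ge0.
  have -> : s = 0 by apply/le_anti; rewrite s0 sT.
  by rewrite subr0 lee_fin ltW// hK0.
rewrite (muE t) ?(nuE t); [|by rewrite ltW|by rewrite ltW].
have g0 rho : A1 rho -> 0 <= fine (speed D p vmu vnu rho).
  by move=> _; apply: fine_ge0; exact: poweR_ge0.
have loc rho (e : R) : A1 rho -> 0 < e -> exists2 c : R, 0 < c & forall h : R, 0 < h < c ->
    (Wp D p (S1 h rho) (S2 h rho) <= (h * (fine (speed D p vmu vnu rho) + e))%:E)%E.
  move=> Ar e0; have sol1 := S1s _ Ar; have sol2 := S2s _ (hA12 _ Ar).
  have [h [delta [/andP[h0 hleT] delta0 L1 L2]]] := hI2 _ _ _ Ar sol1 sol2.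
  have [cyl cpt] := hI4 _ _ _ Ar sol1 sol2.
  have [_ _ w1] := sol1; have [_ _ w2] := sol2.
  exact: (local_estimate hD hp h0 hleT delta0 w1 w2 (S1_0 _ Ar) (S2_0 _ (hA12 _ Ar))
    (S1null _ Ar) (S2null _ Ar) (ac _ Ar) L1 L2 (hI3 _ Ar).2 cyl cpt e0).
apply: le_trans (semigroup_comparison (@Wp_ge0 R d D p) (Wpxx D hp) (WpC D hp)
  (Wp_triangle D hp) hA12 S1A S2A S1_0 S2_0 S1D S2D
  (fun x y Ax Ay => hII x y _ _ Ax Ay (S1s x Ax) (S2s y Ay))
  hK0 hKc hK g0 loc A0 tpos tT) _.
(* The two integrands coincide on [[0, t]]: [speed] is finite at every measure of the orbit, so
   passing through [fine] loses nothing. *)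
rewrite le_eqVlt; apply/orP; left; apply/eqP.
apply: eq_integral => s; rewrite inE /= in_itv/= => /andP[s0 st].
have sT : 0 <= s <= T by rewrite s0 (le_trans st tT).
have As : A1 (mu s) by case: solm => _ + _; exact.
rewrite EFinM -(muE s sT); congr (_ * _)%E; exact: fineK (spfin _ As).
Qed.
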